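(* Let $H\in(0,1)$, $0<T<\infty$ and $\theta\in\mathbb R$, and let $Y^{(1)}_t=\int_0^t e^{-s}\,dB^H_{a_s}$ with $a_t=He^{t/H}$, where $B^H$ is a fractional Brownian motion with Hurst parameter $H$. Suppose that $\sigma_s$, $s\in[0,T]$, is a Hölder continuous function of order $\beta>1-H$, and let $X$ be the solution of $$dX_t=-\theta X_t\,dt+\sigma_t\,dY^{(1)}_t,\qquad t\in[0,T],$$ with some initial condition $X_0\in\mathbb R$. Let $QV_n(X)_t=n^{2H-1}V_n(X)_t$ for $t\in[0,T]$. Then, as $n\to\infty$, $$QV_n(X)_t\longrightarrow\int_0^t|\sigma_s|^2\,ds$$ almost surely and uniformly in $t\in[0,T]$.
   Context: A fractional Brownian motion $B^H=\{B^H_t,\ t\ge 0\}$ with Hurst parameter $H\in(0,1)$ is a zero-mean Gaussian process with covariance $E[B^H_sB^H_t]=\frac12\left(s^{2H}+t^{2H}-|t-s|^{2H}\right)$, taken with continuous paths (they are $(H-\varepsilon)$-Hölder continuous on every finite interval for every $\varepsilon\in(0,H)$). With $a_t=He^{t/H}$, the process $Y^{(1)}_t=\int_0^t e^{-s}\,dB^H_{a_s}$ is defined pathwise as a Riemann-Stieltjes integral (via integration by parts); its paths are Hölder continuous of order $H-\varepsilon$ for every $\varepsilon\in(0,H)$. The equation for $X$ means $X_t=X_0-\theta\int_0^tX_s\,ds+\int_0^t\sigma_s\,dY^{(1)}_s$, where the last integral is a pathwise Riemann-Stieltjes (Young) integral, which exists since $\beta>1-H$. For a stochastic process $X=\{X_t\}$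 and an integer $n\ge 1$, the realized quadratic variation is $$V_n(X)_t=\sum_{i=1}^{[nt]}\left|X_{\frac in}-X_{\frac{i-1}n}\right|^2,$$ where $[nt]$ is the largest integer that is at most $nt$. *)

(* Defs.v *)
From HB Require Import structures.
From mathcomp Require Import all_boot all_order all_algebra.
From mathcomp Require Import all_classical all_reals all_analysis.

Set Implicit Arguments.
Unset Strict Implicit.
Unset Printing Implicit Defensive.

Import Order.TTheory GRing.Theory Num.Theory.
Import numFieldNormedType.Exports.

Local Open Scope classical_set_scope.
Local Open Scope ring_scope.

Section gaussian.
Context {R : realType} {d : measure_display} {Omega : measurableType d}.
Variable P : probability Omega R.

(* Degenerate (constant) laws count as Gaussian. They need a separate case:
   [normal_prob m 0] is by convention the uniform law on [0, 1]. *)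
Definition is_gaussian (Z : Omega -> R) : Prop :=
  exists m : R,
    (exists2 s : R, 0 < s &
      forall A, measurable A -> P (Z @^-1` A) = normal_prob m s A) \/
    (forall A, measurable A -> P (Z @^-1` A) = \d_m A).

(* The index set of a process B : R -> {RV P >-> R} is [0, +oo[; nothing is
   required of B t for t < 0. *)
Definition gaussian_process (B : R -> {RV P >-> R}) : Prop :=
  forall (n : nat) (t c : 'I_n -> R), (forall i, 0 <= t i) ->
    is_gaussian (fun w => \sum_(i < n) c i * B (t i) w).

Definition fractional_brownian_motion (H : R) (B : R -> {RV P >-> R}) : Prop :=
  [/\ gaussian_process B,
      (forall t, 0 <= t -> ('E_P[B t] = 0)%E),
      (forall s t, 0 <= s -> 0 <= t ->
        ('E_P[B s \* B t])%E =
        (2^-1 * (s `^ (2 * H) + t `^ (2 * H) - `|t - s| `^ (2 * H)))%:E) &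
      (forall w, {within `[0, +oo[, continuous (fun t => B t w)})].

End gaussian.

Section paths.
Context {R : realType}.
Implicit Types (f g x sigma Y : R -> R) (a b t : R).

Definition hoelder_on (D : set R) (beta : R) f : Prop :=
  exists C : R, forall s t, D s -> D t -> `|f s - f t| <= C * `|s - t| `^ beta.

(* Riemann-Stieltjes sum of f against g over the partition a :: s with tags
   xi; as in [itv_partition], s lists the division points other than a. *)
Definition RS_sum f g a (s : seq R) (xi : nat -> R) : R :=
  \sum_(0 <= i < size s)
     f (xi i) * (g (nth a s i) - g (nth a (a :: s) i)).

Definition is_RS_integral f g a b (I : R) : Prop :=
  forall e : R, 0 < e -> exists2 delta : R, 0 < delta &
    forall (s : seq R) (xi : nat -> R), itv_partition a b s ->
      (forall i, (i < size s)%N ->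
         nth a s i - nth a (a :: s) i < delta /\
         nth a (a :: s) i <= xi i <= nth a s i) ->
      `|RS_sum f g a s xi - I| < e.

(* Total operator: the value is 0 if the integral does not exist. *)
Definition RS_integral f g a b : R := xget 0 [set I | is_RS_integral f g a b I].

Definition a_ (H t : R) : R := H * expR (t / H).

(* b stands for a path of the fractional Brownian motion. *)
Definition Y1 (H : R) (b : R -> R) (t : R) : R :=
  RS_integral (fun s => expR (- s)) (fun s => b (a_ H s)) 0 t.

(* Pathwise meaning of dx = - theta x dt + sigma dY on [0, T], x(0) = x0. *)
Definition is_solution (theta T x0 : R) sigma Y x : Prop :=
  (@lebesgue_measure R).-integrable `[0, T] (EFin \o x) /\
  forall t, 0 <= t <= T ->
    x t = x0 - theta * (\int[lebesgue_measure]_(s in `[0, t]) x s)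
          + RS_integral sigma Y 0 t.

Definition V_ (n : nat) x t : R :=
  \sum_(1 <= i < (Num.truncn (n%:R * t)).+1)
     `|x (i%:R / n%:R) - x (i.-1%:R / n%:R)| ^+ 2.

Definition QV (H : R) (n : nat) x t : R := n%:R `^ (2 * H - 1) * V_ n x t.

End paths.

(* Main.v *)
(** For a path of X, the Young estimate shows that the increment of X over
    [(i-1)/n, i/n] is sigma e^{-s} (B_{a_t} - B_{a_s}), with s = (i-1)/n and
    t = i/n, up to O(1/n); since H < 1, the error does not contribute in the
    limit.  It thus suffices to treat the Gaussian variables
    xi_i = n^{H-1/2} e^{-s} (B_{a_t} - B_{a_s}), whose variances sum to
    approximately t.  For Q = sum_i (xi_i^2 - E xi_i^2), Gaussian integration
    by parts gives
      E Q^{2m+2} <= (c^2 rho^2 + 2 c rho tau) E Q^{2m},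
    where c depends on m only, tau = sum_i E xi_i^2, and rho bounds the
    absolute row sums of the covariance matrix.  Covariances of disjoint
    increments of B have a constant sign, so the row sums telescope and rho is
    at most a negative power of n.  For large m the moments E Q^{2m} are
    summable in n, hence Q tends to 0 almost surely.  Doing this for countably
    many t, the weighted sums converge by Riemann approximation of sigma^2, and
    monotonicity in t makes the convergence uniform. *)

Require Import Defs.
From HB Require Import structures.
From mathcomp Require Import all_boot all_order all_algebra.
From mathcomp Require Import all_classical all_reals all_analysis.
From mathcomp Require Import measurable_realfun.
From mathcomp Require Import ring lra zify.

Set Implicit Arguments.
Unset Strict Implicit.
Unset Printing Implicit Defensive.

Import Order.TTheory GRing.Theory Num.Theory.
Import numFieldNormedType.Exports.

Local Open Scope classical_set_scope.
Local Open Scope ring_scope.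

(** * Moments of the normal law *)

Section normal_moments.
Context {R : realType}.
Local Notation mu := (@lebesgue_measure R).
Implicit Types (m s x : R) (k : nat).

(** The weight e^{-s} and the clock [a_ H] are matched: the increment of [a_ H] over a step starting
    at s is e^{s/H} times that over the first step, and the power 2H of this factor cancels e^{-2s},
    so all xi_i have the same variance. An obstacle is that no joint law is at hand:
    [gaussian_process] describes single linear combinations only. Integration by parts is therefore
    derived from the one-dimensional recursion E L^{k+2} = (k+1) E L^2 E L^k, applied to L + t Z for
    all t and read off at degree one in t; it extends to polynomials by multiplying by one Gaussian
    factor at a time. The row bound is of order n^{-delta} with delta = min(1, 2H) - (2H - 1), which
    is positive because H < 1; the moment order 2m is taken with delta m >= 2. The Young estimate
    asks for a Hoelder exponent of the path above 1 - beta, whereas [fractional_brownian_motion]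
    provides continuity only. Kolmogorov's criterion, fed by the same Gaussian moments, supplies
    every exponent below H. *)

Lemma normr_exprn_le_expR k x :
  `|x| ^+ k <= k`!%:R * (expR x + expR (- x)).
Proof.
have h (y : R) : 0 <= y -> y ^+ k <= k`!%:R * expR y.
  move=> y0; case: k => [|k].
    by rewrite expr0 fact0 mul1r -expR0 ler_expR.
  have /(le_trans _) H := expR_ge1Dxn k y0.
  rewrite -ler_pdivrMl ?ltr0n ?fact_gt0// mulrC; apply: H.
  by rewrite lerDr.
have [x0|x0] := leP 0 x.
  rewrite ger0_norm// (le_trans (h _ x0))// ler_wpM2l// lerDl expR_ge0//.
rewrite ltr0_norm//; apply: (le_trans (h _ _)); first by rewrite oppr_ge0 ltW.
by rewrite ler_wpM2l// lerDr expR_ge0.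
Qed.

(** Completing the square: exponential tilting shifts the mean. Thus the exponential bound for a
    power turns into a bound by two shifted normal densities, which are integrable. *)
Lemma normal_pdf_expRM m s t x : s != 0 ->
  expR (t * (x - m)) * normal_pdf m s x =
  expR (t ^+ 2 * s ^+ 2 / 2) * normal_pdf (m + t * s ^+ 2) s x.
Proof.
move=> s0; rewrite !normal_pdfE// /normal_fun mulrCA [RHS]mulrCA -!expRD.
by congr (_ * expR _); field.
Qed.

Let env m s x := normal_pdf (m + s ^+ 2) s x + normal_pdf (m - s ^+ 2) s x.

Lemma normal_pdf_moment_le m s k x : s != 0 ->
  `|(x - m) ^+ k * normal_pdf m s x| <=
  k`!%:R * expR (s ^+ 2 / 2) * env m s x.
Proof.
move=> s0; rewrite normrM (ger0_norm (normal_pdf_ge0 _ _ _)) normrX.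
rewrite (le_trans (ler_wpM2r (normal_pdf_ge0 _ _ _) (normr_exprn_le_expR k _)))//.
have := normal_pdf_expRM m 1 x s0; have := normal_pdf_expRM m (-1) x s0.
rewrite !mul1r !mulN1r sqrrN expr1n mul1r => e1 e2.
rewrite le_eqVlt; apply/orP; left; apply/eqP.
rewrite -(mulrA _ (_ + _)) (mulrDl (expR _)) e1 e2 /env; ring.
Qed.

Lemma integrable_normal_pdf_moment m s k : s != 0 ->
  mu.-integrable setT (fun x => ((x - m) ^+ k * normal_pdf m s x)%:E).
Proof.
move=> s0.
apply: (@le_integrable _ _ _ mu _ measurableT _
  (fun x => ((k`!%:R * expR (s ^+ 2 / 2)) * env m s x)%:E)) => //.
- apply/measurable_EFinP/measurable_funM; last exact: measurable_normal_pdf.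
  by apply: measurable_funX; apply: measurable_funB.
- move=> x _ /=; rewrite lee_fin; apply: le_trans (normal_pdf_moment_le _ _ _ s0) _.
  exact: ler_norm.
- under eq_fun do rewrite EFinM.
  apply: integrableZl => //.
  under eq_fun do rewrite EFinD.
  by apply: integrableD => //; apply: integrable_normal_pdf.
Qed.

(** The fundamental theorem on the interval from -(n+1) to n+1 leaves boundary terms of size at most
    2C / (n+1), and dominated convergence removes the cut-off. *)
Lemma integral_deriv_eq0 (F f : R -> R) (C : R) :
  continuous f -> (forall x, is_derive x 1 F (f x)) ->
  mu.-integrable setT (EFin \o f) -> (forall x, `|x * F x| <= C) ->
  (\int[mu]_x (f x)%:E = 0)%E.
Proof.
move=> cf dF intf FC.
pose f_ n := (EFin \o f) \_ `[- n.+1%:R, n.+1%:R].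
have cF : continuous F.
  by move=> x; apply/differentiable_continuous/derivable1_diffP; have [] := dF x.
have h n : (\int[mu]_x (f_ n x) = (F n.+1%:R - F (- n.+1%:R))%:E)%E.
  rewrite -integral_mkcond (@continuous_FTC2 _ f F) ?EFinB//.
  - by rewrite -subr_gt0 opprK -natrD.
  - exact: continuous_subspaceT.
  - split=> [x _||]; [by have [] := dF x | | ].
    + exact: cvg_at_right_filter (cF _).
    + exact: cvg_at_left_filter (cF _).
  - by move=> x _; rewrite derive1E; have [_] := dF x.
have mf : measurable_fun setT f by apply: continuous_measurable_fun.
have [] := @dominated_convergence _ _ _ mu setT measurableT f_ (EFin \o f)
  (fun x => `|f x|%:E).
- move=> n; apply: (measurable_restrictT _ _).1 => //.
  by apply: measurable_funTS; apply/measurable_EFinP.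
- exact/measurable_EFinP.
- apply: aeW => x _.
  apply: cvg_near_cst; near=> n; rewrite /f_ patchE ifT// inE/= in_itv/=.
  rewrite -ler_norml; near: n; exists (Num.truncn `|x|) => // n /= hn.
  by rewrite (le_trans (ltW (truncnS_gt _)))// ler_nat.
- exact: integrable_norm.
- apply: aeW => x n _; rewrite /f_ patchE; case: ifP => _ //=.
  by rewrite normr0 lee_fin.
move=> _ _ hc; rewrite -(cvg_lim _ hc)//; under eq_fun do rewrite h.
apply/cvg_lim => //; apply: cvg_EFin; first exact: nearW.
rewrite /comp /=.
apply/norm_cvg0P.
apply: (@squeeze_cvgr _ _ _ _ (fun=> 0) (fun n => (2 * C) * n.+1%:R^-1)).
- apply: nearW => n; rewrite normr_ge0/= ler_pdivlMr//.
  rewrite -[X in _ * X <= _](@ger0_norm _ n.+1%:R)// -normrM mulrBl.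
  rewrite (le_trans (ler_normB _ _))// mulr_natl mulr2n lerD//.
    by rewrite mulrC.
  by rewrite -normrN -mulrN mulrC.
- exact: cvg_cst.
- rewrite -[X in _ --> X](mulr0 (2 * C)); apply: cvgM; first exact: cvg_cst.
  exact: cvg_harmonic.
Unshelve. all: by end_near. Qed.

Lemma is_derive_normal_pdf m s x : s != 0 ->
  is_derive x 1 (normal_pdf m s) (- (x - m) / s ^+ 2 * normal_pdf m s x).
Proof.
move=> s0.
pose E : R -> R := cst (- (s ^+ 2 *+ 2)^-1) * (id - cst m) ^+ 2.
have dE : is_derive x 1 E (- (x - m) / s ^+ 2).
  apply: is_derive_eq; rewrite /GRing.scale/= !fctE /=.
  field.
  exact: s0.
have -> : normal_pdf m s = cst (normal_peak s) * (expR \o E).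
  apply/funext => y; rewrite normal_pdfE// /normal_fun; congr (_ * expR _).
  by rewrite /E !fctE mulNr [in RHS]mulNr mulrC.
have dexpE := is_derive1_comp (is_derive_expR (E x)) dE.
apply: is_derive_eq; rewrite /GRing.scale/= !fctE /=; ring.
Qed.

Lemma is_derive_normal_pdf_moment m s k x : s != 0 ->
  is_derive x 1 (fun x => (x - m) ^+ k * normal_pdf m s x)
    (k%:R * ((x - m) ^+ k.-1 * normal_pdf m s x) -
     s ^- 2 * ((x - m) ^+ k.+1 * normal_pdf m s x)).
Proof.
move=> s0; have := is_derive_normal_pdf m x s0 => dpdf.
rewrite (_ : (fun x => _) = (id - cst m) ^+ k * normal_pdf m s); last first.
  by apply/funext => y; rewrite !fctE.
apply: is_derive_eq; rewrite /GRing.scale/= !fctE /=.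
by rewrite [_ ^+ k.+1]exprS subr0; field.
Qed.

(** Integrate the derivative of [(x - m) ^+ k * normal_pdf m s x] over the line. At [k = 0] the
    truncated predecessor [k.-1] occurs with coefficient 0. *)
Lemma integral_normal_pdf_moment m s k : s != 0 ->
  (\int[mu]_x ((x - m) ^+ k.+1 * normal_pdf m s x)%:E =
   (s ^+ 2 * k%:R)%:E * \int[mu]_x ((x - m) ^+ k.-1 * normal_pdf m s x)%:E)%E.
Proof.
move=> s0.
pose C j := j`!%:R * expR (s ^+ 2 / 2) * (normal_peak s + normal_peak s).
have M j x : `|(x - m) ^+ j * normal_pdf m s x| <= C j.
  apply: le_trans (normal_pdf_moment_le m j x s0) _.
  apply: ler_wpM2l; first by rewrite mulr_ge0 ?expR_ge0.
  by apply: lerD; apply: normal_pdf_ub.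
have i1 := integrable_normal_pdf_moment m k.-1 s0.
have i2 := integrable_normal_pdf_moment m k.+1 s0.
have := @integral_deriv_eq0 (fun x => (x - m) ^+ k * normal_pdf m s x)
  (fun x => k%:R * ((x - m) ^+ k.-1 * normal_pdf m s x) -
     s ^- 2 * ((x - m) ^+ k.+1 * normal_pdf m s x)) (C k.+1 + `|m| * C k).
have c j : continuous (fun x => (x - m) ^+ j * normal_pdf m s x).
  move=> x; apply: (@continuousM R R (fun x => (x - m) ^+ j) (normal_pdf m s)).
    apply: (@continuous_comp _ _ _ (fun x : R => x - m) (fun x => x ^+ j)).
      by apply: cvgB; [exact: cvg_id|exact: cvg_cst].
    exact: exprn_continuous.
  exact: continuous_normal_pdf.
move=> H0; have {H0} : (\int[mu]_x (k%:R * ((x - m) ^+ k.-1 * normal_pdf m s x) -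
     s ^- 2 * ((x - m) ^+ k.+1 * normal_pdf m s x))%:E = 0)%E.
  apply: H0.
  - move=> x; apply: cvgB.
      by apply: cvgM; [exact: cvg_cst|exact: c].
    by apply: cvgM; [exact: cvg_cst|exact: c].
  - by move=> x; apply: is_derive_normal_pdf_moment.
  - rewrite /comp; under eq_fun do rewrite EFinB !EFinM.
    by apply: integrableB => //; apply: integrableZl.
  - move=> x; rewrite -[X in X * _](subrK m) mulrDl mulrA -exprS.
    apply: le_trans (ler_normD _ _) _; apply: lerD; first exact: M.
    by rewrite normrM ler_wpM2l.
under eq_integral do rewrite EFinB 2!(EFinM _ (_ * _)).
rewrite integralB//; try exact: integrableZl.
rewrite !integralZl//.
have /fineK <- := integrable_fin_num measurableT i1.
have /fineK <- := integrable_fin_num measurableT i2.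
rewrite -!EFinM -EFinB => -[/eqP]; rewrite subr_eq0 => /eqP h; congr EFin.
by rewrite -mulrA h mulrA divff ?mul1r// expf_neq0.
Qed.

(** The Radon-Nikodym derivative of [normal_prob] agrees almost everywhere with the density, both
    having the same integral over every measurable set. *)
Lemma ge0_integral_normal_prob m s (f : R -> \bar R) :
  measurable_fun setT f -> (forall x, 0 <= f x)%E ->
  (\int[normal_prob m s]_x f x = \int[mu]_x (f x * (normal_pdf m s x)%:E))%E.
Proof.
move=> mf f0; have dom := normal_prob_dominates m s.
rewrite -(Radon_Nikodym_SigmaFinite.change_of_variables dom)//.
apply: ae_eq_integral => //.
- apply: emeasurable_funM => //; apply: (measurable_int mu).
  exact: Radon_Nikodym_SigmaFinite.f_integrable.
- apply: emeasurable_funM => //; apply/measurable_EFinP.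
  exact: measurable_normal_pdf.
- apply: ae_eqe_mul2l; apply: integral_ae_eq => //.
  + exact: Radon_Nikodym_SigmaFinite.f_integrable.
  + by apply/measurable_EFinP; exact: measurable_normal_pdf.
  + by move=> E _ mE; rewrite -Radon_Nikodym_SigmaFinite.f_integral.
Qed.

Lemma integral_normal_prob m s (f : R -> R) :
  measurable_fun setT f ->
  mu.-integrable setT (fun x => (f x * normal_pdf m s x)%:E) ->
  (normal_prob m s).-integrable setT (EFin \o f) /\
  (\int[normal_prob m s]_x (f x)%:E = \int[mu]_x (f x * normal_pdf m s x)%:E)%E.
Proof.
move=> mf intf; have mpdf := measurable_normal_pdf m s.
split.
  apply/integrableP; split; first exact/measurable_EFinP.
  rewrite ge0_integral_normal_prob//; last first.
    by apply/measurableT_comp => //; apply/measurable_EFinP.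
  case/integrableP : intf => _; under eq_integral.
    move=> x _; rewrite /= normrM (ger0_norm (normal_pdf_ge0 _ _ _)) EFinM; over.
  by [].
rewrite integralE [RHS]integralE.
rewrite !ge0_integral_normal_prob//; try
  by [apply/measurable_funepos/measurable_EFinP|apply/measurable_funeneg/measurable_EFinP].
have p0 x := normal_pdf_ge0 m s x.
congr (_ - _)%E; apply: eq_integral => x _.
  by rewrite !funeposE /= -!EFin_max -EFinM maxr_pMl// mul0r.
by rewrite !funenegE /= -!EFin_max -EFinM maxr_pMl// mul0r mulNr.
Qed.

End normal_moments.

(** * Moment recursion for centred Gaussian variables *)

Section gaussian_moments.
Context {R : realType} {d : measure_display} {Omega : measurableType d}.
Variable P : probability Omega R.

Lemma Rintegral_probability_cst (c : R) : \int[P]_w c = c.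
Proof.
have P1 : P setT = 1%E by exact: probability_setT.
by rewrite Rintegral_cst//= P1 mulr1.
Qed.

Lemma law_integral (Z : Omega -> R) (nu : {measure set (measurableTypeR R) -> \bar R})
    (f : R -> R) :
  measurable_fun setT Z -> (forall A, measurable A -> P (Z @^-1` A) = nu A) ->
  measurable_fun setT f -> nu.-integrable setT (EFin \o f) ->
  P.-integrable setT (EFin \o (f \o Z)) /\
  (\int[P]_w (f (Z w))%:E = \int[nu]_x (f x)%:E)%E.
Proof.
move=> mZ PZ mf intf.
have mZR : @measurable_fun _ _ Omega (measurableTypeR R) setT Z by [].
pose mZ' := isMeasurableFun.Build _ _ _ _ _ mZR.
pose Z' : {RV P >-> measurableTypeR R} := HB.pack Z mZ'.
have E (g : R -> \bar R) :
   (\int[distribution P Z']_x g x = \int[nu]_x g x)%E.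
  by apply: eq_measure_integral => A mA _; rewrite -PZ.
have intfZ : P.-integrable setT (EFin \o (f \o Z)).
  case/integrableP : intf => _ intf.
  apply/integrableP; split; first exact/measurable_EFinP/measurableT_comp.
  move: intf; rewrite -E ge0_integral_distribution//.
  by apply/measurableT_comp => //; exact/measurable_EFinP.
split => //; rewrite -E (@integral_distribution _ _ _ _ _ P Z' (EFin \o f))//.
exact/measurable_EFinP.
Qed.

(** This recursion is all that is ever used of the Gaussian law. It covers the nondegenerate and the
    constant case alike, with the variance allowed to vanish. *)
Lemma centered_gaussian_moments (Z : Omega -> R) :
  measurable_fun setT Z -> is_gaussian P Z -> \int[P]_w Z w = 0 ->
  forall k, P.-integrable setT (fun w => (Z w ^+ k)%:E) /\
  \int[P]_w (Z w ^+ k.+2) =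
     k.+1%:R * \int[P]_w (Z w ^+ 2) * \int[P]_w (Z w ^+ k).
Proof.
move=> mZ [m PZ] EZ.
have mX m' k : measurable_fun setT (fun x : R => (x - m') ^+ k).
  by apply: measurable_funX; apply: measurable_funB.
(* The [m] in [is_gaussian] is not yet tied to the expectation of [Z]. A vanishing first moment of
   the law about [m], together with the zero mean of [Z], forces [m = 0]. *)
have centered (nu : {measure set (measurableTypeR R) -> \bar R}) :
    (forall A, measurable A -> P (Z @^-1` A) = nu A) ->
    nu.-integrable setT (fun x => ((x - m) ^+ 1)%:E) ->
    (\int[nu]_x ((x - m) ^+ 1)%:E = 0)%E -> m = 0.
  move=> PZnu i1 e1; have [iZ eZ] := law_integral mZ PZnu (mX m 1%N) i1.
  have ic : P.-integrable setT (EFin \o cst m).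
    exact: finite_measure_integrable_cst.
  have iZ' : P.-integrable setT (EFin \o Z).
    rewrite (_ : _ \o _ = (fun w => (EFin \o ((fun x => (x - m) ^+ 1)%R \o Z)) w + (EFin \o cst m) w)%E).
      exact: integrableD.
    by apply/funext => w /=; rewrite -EFinD expr1 subrK.
  have : \int[P]_w ((Z w - m) ^+ 1) = 0 by rewrite /Rintegral eZ e1.
  have -> : \int[P]_w ((Z w - m) ^+ 1) = \int[P]_w (Z w) - \int[P]_w m.
    by rewrite -RintegralB//; apply: eq_Rintegral => w _; rewrite expr1.
  rewrite EZ Rintegral_probability_cst sub0r => /eqP.
  by rewrite oppr_eq0 => /eqP.
case: PZ => [[s s0 PZ]|PZ].
  have sn0 : s != 0 by rewrite gt_eqF.
  have I m' k := integral_normal_prob (mX m' k)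
    (integrable_normal_pdf_moment m' k sn0).
  have m0 : m = 0.
    apply: (centered (normal_prob m s)) => //; first exact: (I _ _).1.
    by rewrite (I m 1%N).2 (integral_normal_pdf_moment m 0 sn0) mulr0 mul0e.
  rewrite {}m0 in PZ.
  have J k := law_integral mZ PZ (mX 0 k) (I 0 k).1.
  have Zk k w : (Z w - 0) ^+ k = Z w ^+ k by rewrite subr0.
  have mom k : \int[P]_w (Z w ^+ k.+1) =
      s ^+ 2 * k%:R * \int[P]_w (Z w ^+ k.-1).
    under eq_Rintegral do rewrite -Zk.
    under [X in _ = _ * X]eq_Rintegral do rewrite -Zk.
    rewrite /Rintegral !(J _).2 !(I 0 _).2 (integral_normal_pdf_moment 0 k sn0).
    by rewrite -(fineK (integrable_fin_num measurableT (integrable_normal_pdf_moment 0 k.-1 sn0))) -EFinM.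
  move=> k; split.
    by have := (J k).1; rewrite /comp; under eq_fun do rewrite Zk.
  rewrite mom (mom 1%N)/= mulr1.
  under [X in _ = _ * (_ * X) * _]eq_Rintegral do rewrite expr0.
  rewrite Rintegral_probability_cst; ring.
(* Degenerate case: every moment of positive order vanishes, and both sides of the recursion are
   0. *)
have D (f : R -> R) : measurable_fun setT f ->
    (\d_(m : measurableTypeR R)).-integrable setT (EFin \o f) /\
    (\int[\d_(m : measurableTypeR R)]_x (f x)%:E = (f m)%:E)%E.
  move=> mf; split.
    apply/integrableP; split; first exact/measurable_EFinP.
    rewrite integral_dirac//; first by rewrite diracT mul1e ltry.
    by apply/measurableT_comp => //; exact/measurable_EFinP.
  by rewrite integral_dirac ?diracT ?mul1e//; exact/measurable_EFinP.
have {}PZ A : measurable A -> P (Z @^-1` A) = \d_(m : measurableTypeR R) A.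
  by move=> mA; rewrite PZ.
have m0 : m = 0.
  apply: (centered (\d_(m : measurableTypeR R))) => //; first exact: (D _ (mX m 1%N)).1.
  by rewrite (D _ (mX m 1%N)).2 subrr expr1.
rewrite m0 in D PZ.
have J k := law_integral mZ PZ (mX 0 k) (D _ (mX 0 k)).1.
have Zk k w : (Z w - 0) ^+ k = Z w ^+ k by rewrite subr0.
have mom k : \int[P]_w (Z w ^+ k) = (k == 0)%:R.
  under eq_Rintegral do rewrite -Zk.
  by rewrite /Rintegral (J k).2 (D _ (mX 0 k)).2 subrr expr0n.
move=> k; split.
  by have := (J k).1; rewrite /comp; under eq_fun do rewrite Zk.
by rewrite !mom/= mulr0 mul0r.
Qed.

End gaussian_moments.

(** * The algebra of variables with finite moments of all orders *)

Section all_moments.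
Context {R : realType} {d : measure_display} {Omega : measurableType d}.
Variable P : probability Omega R.
Implicit Types (f g : Omega -> R) (k : nat).

(** Asking for all orders at once makes the class stable under products, so integrability of any
    polynomial in Gaussian variables follows from its shape. *)
Definition all_moments f : Prop := measurable_fun setT f /\
  forall k, P.-integrable setT (fun w => (`|f w| ^+ k)%:E).

Lemma all_moments_le f (b : nat -> Omega -> R) : measurable_fun setT f ->
  (forall k, P.-integrable setT (fun w => (b k w)%:E)) ->
  (forall k w, `|f w| ^+ k <= b k w) -> all_moments f.
Proof.
move=> mf ib fb; split => // k; apply: le_integrable (ib k) => //.
  by apply/measurable_EFinP/measurable_funX; apply: measurableT_comp.
move=> w _ /=; rewrite lee_fin ger0_norm ?exprn_ge0//.
exact: le_trans (fb k w) (ler_norm _).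
Qed.

Lemma all_moments_integrable f : all_moments f ->
  P.-integrable setT (EFin \o f).
Proof.
move=> [mf /(_ 1%N)]; apply: le_integrable => //; first exact/measurable_EFinP.
by move=> w _ /=; rewrite expr1 normr_id.
Qed.

Lemma all_moments_cst (c : R) : all_moments (fun=> c).
Proof. by split => // k; exact: finite_measure_integrable_cst. Qed.

Lemma all_momentsD f g : all_moments f -> all_moments g ->
  all_moments (fun w => f w + g w).
Proof.
move=> [mf intf] [mg ig].
apply: (all_moments_le (b := fun k w => 2 ^+ k * (`|f w| ^+ k + `|g w| ^+ k))).
- exact: measurable_funD.
- move=> k; under eq_fun do rewrite EFinM EFinD.
  by apply: integrableZl => //; exact: integrableD.
- move=> k w; have [fg|/ltW fg] := leP `|f w| `|g w|.
    apply: (@le_trans _ _ ((2 * `|g w|) ^+ k)).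
      rewrite lerXn2r ?nnegrE ?mulr_ge0// (le_trans (ler_normD _ _))//.
      by rewrite mulr_natl mulr2n lerD.
    by rewrite exprMn ler_wpM2l ?exprn_ge0// lerDr exprn_ge0.
  apply: (@le_trans _ _ ((2 * `|f w|) ^+ k)).
    rewrite lerXn2r ?nnegrE ?mulr_ge0// (le_trans (ler_normD _ _))//.
    by rewrite mulr_natl mulr2n lerD.
  by rewrite exprMn ler_wpM2l ?exprn_ge0// lerDl exprn_ge0.
Qed.

Lemma all_momentsM f g : all_moments f -> all_moments g ->
  all_moments (fun w => f w * g w).
Proof.
move=> [mf intf] [mg ig].
apply: (all_moments_le (b := fun k w => `|f w| ^+ (k * 2) + `|g w| ^+ (k * 2))).
- exact: measurable_funM.
- by move=> k; under eq_fun do rewrite EFinD; exact: integrableD.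
- move=> k w; rewrite normrM exprMn !exprM.
  set a := `|f w| ^+ k; set b := `|g w| ^+ k.
  have a0 : 0 <= a by rewrite exprn_ge0.
  have b0 : 0 <= b by rewrite exprn_ge0.
  nra.
Qed.

Lemma all_momentsZ (c : R) f : all_moments f -> all_moments (fun w => c * f w).
Proof. by move=> af; apply: all_momentsM => //; exact: all_moments_cst. Qed.

Lemma all_momentsB f g : all_moments f -> all_moments g ->
  all_moments (fun w => f w - g w).
Proof.
move=> af ag; under eq_fun do rewrite -[- _]mulN1r.
by apply: all_momentsD => //; exact: all_momentsZ.
Qed.

Lemma all_momentsX f k : all_moments f -> all_moments (fun w => f w ^+ k).
Proof.
move=> af; elim: k => [|k IH].
  by under eq_fun do rewrite expr0; exact: all_moments_cst.
by under eq_fun do rewrite exprS; exact: all_momentsM.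
Qed.

Lemma all_moments_sum (I : Type) (s : seq I) (F : I -> Omega -> R) :
  (forall i, all_moments (F i)) -> all_moments (fun w => \sum_(i <- s) F i w).
Proof.
move=> aF; elim: s => [|i s IH].
  by under eq_fun do rewrite big_nil; exact: all_moments_cst.
by under eq_fun do rewrite big_cons; exact: all_momentsD.
Qed.

Local Notation "'E f" := (Rintegral P setT f) (at level 10, f at level 8).

Lemma expectD f g : all_moments f -> all_moments g ->
  'E (fun w => f w + g w) = 'E f + 'E g.
Proof. by move=> af ag; rewrite RintegralD//; exact: all_moments_integrable. Qed.

Lemma expectZ (c : R) f : all_moments f -> 'E (fun w => c * f w) = c * 'E f.
Proof. by move=> af; rewrite RintegralZl//; exact: all_moments_integrable. Qed.

Lemma expectB f g : all_moments f -> all_moments g ->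
  'E (fun w => f w - g w) = 'E f - 'E g.
Proof. by move=> af ag; rewrite RintegralB//; exact: all_moments_integrable. Qed.

Lemma expect_sum (I : Type) (s : seq I) (F : I -> Omega -> R) :
  (forall i, all_moments (F i)) ->
  'E (fun w => \sum_(i <- s) F i w) = \sum_(i <- s) 'E (F i).
Proof.
move=> aF; elim: s => [|i s IH].
  by rewrite big_nil; under eq_Rintegral do rewrite big_nil; rewrite /Rintegral integral0.
rewrite big_cons -IH -expectD//; last exact: all_moments_sum.
by apply: eq_Rintegral => w _; rewrite big_cons.
Qed.

Lemma expect_le f g : all_moments f -> all_moments g ->
  (forall w, f w <= g w) -> 'E f <= 'E g.
Proof. by move=> af ag fg; apply: le_Rintegral => //; exact: all_moments_integrable. Qed.

Lemma eq_expect f g : f =1 g -> 'E f = 'E g.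
Proof. by move=> fg; apply: eq_Rintegral => w _; exact: fg. Qed.

Lemma expect_ge0 f : (forall w, 0 <= f w) -> 0 <= 'E f.
Proof. by move=> f0; apply: Rintegral_ge0 => w _; exact: f0. Qed.

End all_moments.

(** * Gaussian integration by parts *)

Section wick.
Context {R : realType} {d : measure_display} {Omega : measurableType d}.
Variable P : probability Omega R.
Implicit Types (F G L M Z : Omega -> R) (k N : nat).

Local Notation "'E f" := (Rintegral P setT f) (at level 10, f at level 8).

(** Joint Gaussianity is encoded by one-dimensional moments only: closure under [L + t * M] lets
    joint moments be recovered by polarization in [t]. *)
Definition gaussian_space (V : set (Omega -> R)) : Prop :=
  [/\ forall L, V L -> all_moments P L,
      forall L M t, V L -> V M -> V (fun w => L w + t * M w),
      forall L, V L -> 'E L = 0 &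
      forall L k, V L ->
        'E (fun w => L w ^+ k.+2) = k.+1%:R * 'E (fun w => L w ^+ 2) * 'E (fun w => L w ^+ k)].

(** The difference vanishes at as many distinct integers as its size, hence is zero. *)
Lemma horner_inj (p q : {poly R}) : (forall t, p.[t] = q.[t]) -> p = q.
Proof.
move=> pq; apply/eqP; rewrite -subr_eq0; apply/eqP.
apply: (@roots_geq_poly_eq0 _ _ (mkseq (fun i => i%:R) (size (p - q)))).
- by apply/allP => t _; rewrite rootE hornerD hornerN pq subrr.
- by rewrite mkseq_uniq// => i j /eqP; rewrite eqr_nat => /eqP.
- by rewrite size_mkseq.
Qed.

(** Binomial expansion: the expectation is a polynomial in [t], so an identity valid for all [t] may
    be compared coefficient by coefficient. The coefficient of degree one is the derivative at 0. *)
Lemma expect_expD F L M N :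
  all_moments P F -> all_moments P L -> all_moments P M ->
  exists p : {poly R}, [/\ forall t, p.[t] = 'E (fun w => F w * (L w + t * M w) ^+ N),
    p`_0 = 'E (fun w => F w * L w ^+ N) &
    p`_1 = N%:R * 'E (fun w => F w * M w * L w ^+ N.-1)].
Proof.
move=> aF aL aM.
pose c i := 'E (fun w => F w * (L w ^+ (N - i) * M w ^+ i)).
have a i : all_moments P (fun w => F w * (L w ^+ (N - i) * M w ^+ i)).
  by apply: all_momentsM => //; apply: all_momentsM; apply: all_momentsX.
exists (\poly_(i < N.+1) ('C(N, i)%:R * c i)); split.
- move=> t; rewrite horner_poly.
  transitivity ('E (fun w => \sum_(i < N.+1) ('C(N, i)%:R * t ^+ i *
     (F w * (L w ^+ (N - i) * M w ^+ i))))).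
    rewrite expect_sum; last by move=> i; exact: all_momentsZ.
    by apply: eq_bigr => i _; rewrite expectZ// mulrAC.
  apply: eq_expect => w; rewrite exprDn mulr_sumr; apply: eq_bigr => i _.
  by rewrite exprMn -mulr_natl; ring.
- rewrite coef_poly/= bin0 mul1r; apply: eq_expect => w.
  by rewrite subn0 expr0 mulr1.
- rewrite coef_poly /c; case: (N) => [|n] /=; first by rewrite mul0r.
  rewrite bin1; congr (_ * _); apply: eq_expect => w.
  by rewrite subSS subn0 expr1; ring.
Qed.

Variable V : set (Omega -> R).
Hypothesis gV : gaussian_space V.

Let am L : V L -> all_moments P L. Proof. by case: gV => + _ _ _; apply. Qed.

Local Notation cov := (fun Z L => 'E (fun w => Z w * L w)).

(* Compare the coefficients of t in the moment recursion for L + t Z. *)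
Lemma gaussian_space_wick Z L N : V Z -> V L ->
  'E (fun w => Z w * L w ^+ N) =
  N%:R * cov Z L * 'E (fun w => L w ^+ N.-1).
Proof.
move=> VZ VL; have [_ lin E0 mom] := gV.
elim/ltn_ind: N => -[_|[_|N IH]].
- by rewrite !mul0r -[RHS](E0 _ VZ); apply: eq_expect => w; rewrite expr0 mulr1.
- rewrite mul1r [X in _ * X](_ : _ = 1) ?mulr1.
    by apply: eq_expect => w; rewrite expr1.
  by under eq_Rintegral do rewrite expr0; rewrite Rintegral_probability_cst.
have [p [hp _ p1]] := expect_expD N.+3 (all_moments_cst P 1) (am VL) (am VZ).
have [q [hq q0 q1]] := expect_expD 2 (all_moments_cst P 1) (am VL) (am VZ).
have [r [hr r0 r1]] := expect_expD N.+1 (all_moments_cst P 1) (am VL) (am VZ).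
have : p = N.+2%:R *: (q * r).
  apply: horner_inj => t; rewrite hornerZ hornerM hp hq hr.
  under eq_Rintegral do rewrite mul1r.
  under [X in _ = _ * (X * _)]eq_Rintegral do rewrite mul1r.
  under [X in _ = _ * (_ * X)]eq_Rintegral do rewrite mul1r.
  by rewrite mulrA mom//; exact: lin.
move/(congr1 (fun u : {poly R} => u`_1)); rewrite coefZ coefM big_ord_recr big_ord1/=.
rewrite subnn subn0 p1 q0 q1 r0 r1 /=.
have e1 k : 'E (fun w => 1 * Z w * L w ^+ k) = 'E (fun w => Z w * L w ^+ k).
  by apply: eq_expect => w; rewrite mul1r.
have e2 k : 'E (fun w => 1 * L w ^+ k) = 'E (fun w => L w ^+ k).
  by apply: eq_expect => w; rewrite mul1r.
have e3 : 'E (fun w => Z w * L w ^+ 1) = cov Z L.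
  by apply: eq_expect => w; rewrite expr1.
rewrite !e1 !e2 e3 (IH N)//= => h.
have n0 : N.+3%:R != 0 :> R by rewrite pnatr_eq0.
(* The moment of [L] of order N+1 is reduced to that of order N-1 by the recursion only if N > 0;
   for N = 0 it is the mean, which is 0. *)
apply: (mulfI n0); rewrite {}h; case: N {IH p p1 hp r hr r0 r1 n0} => [|N].
  have -> : 'E (fun w => L w ^+ 1) = 0.
    by rewrite -[RHS](E0 _ VL); apply: eq_expect => w; rewrite expr1.
  ring.
rewrite /= (mom _ N)//; ring.
Qed.

(* Gaussian integration by parts for F: D Z plays the role of the derivative
   of F in the Cameron-Martin direction of Z.  The factor L ^+ N makes the
   identity stable under multiplication of F by elements of V. *)
Definition stein F (D : (Omega -> R) -> Omega -> R) : Prop :=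
  [/\ all_moments P F, forall Z, V Z -> all_moments P (D Z) &
   forall Z L N, V Z -> V L ->
    'E (fun w => Z w * F w * L w ^+ N) =
    'E (fun w => D Z w * L w ^+ N) +
    N%:R * cov Z L * 'E (fun w => F w * L w ^+ N.-1)].

Lemma stein_cst c : stein (fun=> c) (fun _ _ => 0).
Proof.
split; first exact: all_moments_cst.
  by move=> Z _; exact: all_moments_cst.
move=> Z L N VZ VL; have := gaussian_space_wick N VZ VL => h.
have aX k : all_moments P (fun w => L w ^+ k) by apply/all_momentsX/am.
transitivity (c * 'E (fun w => Z w * L w ^+ N)).
  rewrite -expectZ; last by apply: all_momentsM => //; exact: am.
  by apply: eq_expect => w; ring.
under [X in _ = X + _]eq_Rintegral do rewrite mul0r.
by rewrite Rintegral_probability_cst add0r expectZ// h; ring.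
Qed.

Lemma steinD F D G D' : stein F D -> stein G D' ->
  stein (fun w => F w + G w) (fun Z w => D Z w + D' Z w).
Proof.
move=> [aF aD hF] [aG aD' hG]; split; first exact: all_momentsD.
  by move=> Z VZ; apply: all_momentsD; [exact: aD|exact: aD'].
move=> Z L N VZ VL.
have aX k : all_moments P (fun w => L w ^+ k) by apply/all_momentsX/am.
transitivity ('E (fun w => Z w * F w * L w ^+ N) + 'E (fun w => Z w * G w * L w ^+ N)).
  rewrite -expectD; first by apply: eq_expect => w; ring.
    by do 2 (apply: all_momentsM => //); exact: am.
  by do 2 (apply: all_momentsM => //); exact: am.
rewrite hF// hG//.
transitivity ('E (fun w => D Z w * L w ^+ N) + 'E (fun w => D' Z w * L w ^+ N) +
  N%:R * cov Z L * ('E (fun w => F w * L w ^+ N.-1) + 'E (fun w => G w * L w ^+ N.-1))).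
  by ring.
rewrite -!expectD//; try by [apply: all_momentsM => //; auto].
congr (_ + _ * _); apply: eq_expect => w; ring.
Qed.

Lemma stein_ext F D G D' : F =1 G -> (forall Z, V Z -> D Z =1 D' Z) ->
  stein F D -> stein G D'.
Proof.
move=> FG DD' [aF aD hF]; have FG' : F = G by apply/funext.
split; first by rewrite -FG'.
  by move=> Z VZ; rewrite -(_ : D Z = D' Z); [exact: aD|exact/funext/DD'].
by move=> Z L N VZ VL; rewrite -FG' -(_ : D Z = D' Z); [exact: hF|exact/funext/DD'].
Qed.

(* Compare the coefficients of t in the identity for F and L + t M. *)
Lemma stein_mulV F D M : V M -> stein F D ->
  stein (fun w => F w * M w) (fun Z w => D Z w * M w + cov Z M * F w).
Proof.
move=> VM [aF aD hF]; have [_ lin _ _] := gV.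
have aM := am VM.
have aDM Z : V Z -> all_moments P (fun w => D Z w * M w + cov Z M * F w).
  by move=> VZ; apply: all_momentsD; [apply: all_momentsM => //; exact: aD|exact: all_momentsZ].
split => //; first exact: all_momentsM.
move=> Z L N VZ VL.
have aX k : all_moments P (fun w => L w ^+ k) by apply/all_momentsX/am.
have aZ := am VZ; have aL := am VL; have aDZ := aD _ VZ.
have [p [hp p0 p1]] := expect_expD N.+1 (all_momentsM aZ aF) aL aM.
have [q [hq q0 q1]] := expect_expD N.+1 aDZ aL aM.
have [r [hr r0 r1]] := expect_expD N aF aL aM.
have : p = q + N.+1%:R *: (((cov Z L)%:P + (cov Z M) *: 'X) * r).
  apply: horner_inj => t; rewrite hornerD hornerZ hornerM hornerD hornerC hornerZ hornerX.
  rewrite hp hq hr hF//; last exact: lin.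
  rewrite mulrA; congr (_ + _ * _ * _).
  have aZL := all_momentsM aZ aL; have aZM := all_momentsM aZ aM.
  rewrite (mulrC _ t) -expectZ// -expectD//; last exact: all_momentsZ.
  by apply: eq_expect => w; ring.
move/(congr1 (fun u : {poly R} => u`_1)).
rewrite coefD coefZ mulrDl coefD coefCM -scalerAl coefZ coefXM/= p1 q1 r0 r1 => h.
have n0 : N.+1%:R != 0 :> R by rewrite pnatr_eq0.
have := mulfI n0; apply.
transitivity (N.+1%:R * 'E (fun w => Z w * F w * M w * L w ^+ N)).
  by congr (_ * _); apply: eq_expect => w; ring.
have -> : 'E (fun w => (D Z w * M w + cov Z M * F w) * L w ^+ N) =
    'E (fun w => D Z w * M w * L w ^+ N) + cov Z M * 'E (fun w => F w * L w ^+ N).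
  have aFL : all_moments P (fun w => F w * L w ^+ N) by exact: all_momentsM.
  rewrite -expectZ// -expectD//; first by apply: eq_expect => w; ring.
    exact/all_momentsM/aX/all_momentsM.
  exact: all_momentsZ.
rewrite h/=; ring.
Qed.

Lemma stein_sum (I : Type) (s : seq I) (F : I -> Omega -> R) D :
  (forall i, stein (F i) (D i)) ->
  stein (fun w => \sum_(i <- s) F i w) (fun Z w => \sum_(i <- s) D i Z w).
Proof.
move=> sF; elim: s => [|i s IH].
  apply: stein_ext (stein_cst 0) => [w|Z _ w]; by rewrite big_nil.
by apply: stein_ext (steinD (sF i) IH) => [w|Z _ w]; rewrite big_cons.
Qed.

Lemma steinZ c F D : stein F D -> stein (fun w => c * F w) (fun Z w => c * D Z w).
Proof.
move=> [aF aD hF]; split; first exact: all_momentsZ.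
  by move=> Z VZ; apply: all_momentsZ; exact: aD.
move=> Z L N VZ VL.
have aX k : all_moments P (fun w => L w ^+ k) by apply/all_momentsX/am.
have aZ := am VZ; have aDZ := aD _ VZ.
transitivity (c * 'E (fun w => Z w * F w * L w ^+ N)).
  rewrite -expectZ; last by apply: all_momentsM => //; exact: all_momentsM.
  by apply: eq_expect => w; ring.
rewrite hF// mulrDr; congr (_ + _).
  rewrite -expectZ; last exact: all_momentsM.
  by apply: eq_expect => w; ring.
rewrite mulrCA; congr (_ * _); rewrite -expectZ; last exact: all_momentsM.
by apply: eq_expect => w; ring.
Qed.

Variables (n : nat) (xi : 'I_n -> Omega -> R) (rho : R).
Hypothesis Vxi : forall i, V (xi i).

Local Notation Gamma i j := ('E (fun w => xi i w * xi j w)).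
Local Notation tau := (\sum_i Gamma i i).
Local Notation Q := (fun w => \sum_i xi i w ^+ 2 - tau).
Hypothesis row_le : forall i, \sum_j `|Gamma i j| <= rho.

Let axi i : all_moments P (xi i). Proof. exact: am. Qed.

Let aQ : all_moments P Q.
Proof.
apply: all_momentsD; last exact: all_moments_cst.
by apply: all_moments_sum => i; exact: all_momentsX.
Qed.

(** Product rule: each square arises by multiplying twice by [xi i], which yields the derivative 2
    cov(Z, [xi i]) [xi i], and the constant [tau] contributes none. *)
Lemma stein_quad F D : stein F D ->
  stein (fun w => F w * Q w)
    (fun Z w => D Z w * Q w + F w * (2 * \sum_i cov Z (xi i) * xi i w)).
Proof.
move=> sF.
have h i := stein_mulV (Vxi i) (stein_mulV (Vxi i) sF).
apply: stein_ext (steinD (stein_sum (index_enum _) h) (steinZ (- tau) sF)).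
  by move=> w; rewrite mulrBr mulr_sumr mulNr (mulrC tau); congr (_ - _);
     apply: eq_bigr => i _; rewrite expr2 mulrA.
move=> Z VZ w.
rewrite (eq_bigr (fun i => D Z w * xi i w ^+ 2 + F w * 2 * (cov Z (xi i) * xi i w))).
  by rewrite big_split/= -!mulr_sumr; ring.
by move=> i _; ring.
Qed.

Lemma stein_quadX p :
  stein (fun w => Q w ^+ p)
    (fun Z w => p%:R * Q w ^+ p.-1 * (2 * \sum_i cov Z (xi i) * xi i w)).
Proof.
elim: p => [|p IH].
  by apply: stein_ext (stein_cst 1) => [w|Z _ w]; rewrite ?expr0// !mul0r.
apply: stein_ext (stein_quad IH) => [w|Z _ w]; first by rewrite exprSr.
rewrite /=; case: p {IH} => [|p] /=; first by rewrite !expr0; ring.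
by rewrite !exprS -!natr1; ring.
Qed.

(** Schur's test: |x y| <= (x^2 + y^2) / 2, and by symmetry of the covariance the column sums obey
    the same bound as the row sums. *)
Lemma quad_le (x : 'I_n -> R) :
  `|\sum_i \sum_j Gamma i j * x i * x j| <= rho * \sum_i x i ^+ 2.
Proof.
have symG i j : Gamma i j = Gamma j i by apply: eq_expect => w; rewrite mulrC.
apply: (@le_trans _ _ (\sum_i \sum_j `|Gamma i j| * (x i ^+ 2 / 2 + x j ^+ 2 / 2))).
  apply: le_trans (ler_norm_sum _ _ _) _; apply: ler_sum => i _.
  apply: le_trans (ler_norm_sum _ _ _) _; apply: ler_sum => j _.
  rewrite -mulrA normrM ler_wpM2l// normrM.
  rewrite -(real_normK (num_real (x i))) -(real_normK (num_real (x j))).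
  have := sqr_ge0 (`|x i| - `|x j|); nra.
under eq_bigr do under eq_bigr do rewrite mulrDr.
under eq_bigr do rewrite big_split/=.
rewrite big_split/= [X in _ + X]exchange_big/= -big_split mulr_sumr/=.
apply: ler_sum => i _; rewrite -big_split/=.
under eq_bigr do rewrite (symG _ i) -mulrDr -splitr.
by rewrite -mulr_suml ler_wpM2r// sqr_ge0.
Qed.

(** Split Q^{p+1} as the sum of [xi i] times (Q^p [xi i]), minus tau Q^p, and integrate the leading
    factor by parts. Differentiating the second [xi i] gives the variances, whose sum cancels tau;
    differentiating Q^p leaves the quadratic form. *)
Lemma expect_quadS p : 'E (fun w => Q w ^+ p.+1) =
  (2 * p%:R) * 'E (fun w => Q w ^+ p.-1 * \sum_i \sum_j Gamma i j * xi i w * xi j w).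
Proof.
have aQp k : all_moments P (fun w => Q w ^+ k) by exact: all_momentsX.
have E1 i : 'E (fun w => xi i w * (Q w ^+ p * xi i w)) =
  'E (fun w => (p%:R * Q w ^+ p.-1 * (2 * \sum_j Gamma i j * xi j w)) * xi i w) +
  Gamma i i * 'E (fun w => Q w ^+ p).
  have [_ aD] := stein_mulV (Vxi i) (stein_quadX p).
  (* The power of [L] in [stein] is switched off by taking its exponent to be 0. *)
  move=> /(_ (xi i) (xi i) 0%N (Vxi i) (Vxi i)).
  rewrite mul0r mul0r addr0 => h.
  transitivity ('E (fun w => xi i w * (Q w ^+ p * xi i w) * xi i w ^+ 0)).
    by apply: eq_expect => w; rewrite expr0 mulr1.
  rewrite h -expectZ// -expectD//; first by apply: eq_expect => w; rewrite expr0 mulr1.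
    apply: all_momentsM => //; apply: all_momentsM; first exact: all_momentsZ.
    apply/all_momentsZ/all_moments_sum => j; exact: all_momentsZ.
  exact: all_momentsZ.
transitivity (\sum_i 'E (fun w => xi i w * (Q w ^+ p * xi i w)) - tau * 'E (fun w => Q w ^+ p)).
  have a i : all_moments P (fun w => xi i w * (Q w ^+ p * xi i w)).
    by apply: all_momentsM => //; exact: all_momentsM.
  rewrite -(expect_sum (index_enum _) a) -(expectZ tau (aQp p)) -expectB//; first last.
  - exact: all_momentsZ.
  - exact: all_moments_sum.
  apply: eq_expect => w; rewrite exprSr mulrBr (mulrC tau); congr (_ - _).
  by rewrite mulr_sumr; apply: eq_bigr => i _; ring.
under eq_bigr do rewrite E1.
rewrite big_split/= -mulr_suml addrK -(expect_sum (index_enum _)); last first.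
  move=> i; apply: all_momentsM => //; apply: all_momentsM; first exact: all_momentsZ.
  apply/all_momentsZ/all_moments_sum => j; exact: all_momentsZ.
rewrite -expectZ; last first.
  apply: all_momentsM => //; apply: all_moments_sum => i; apply: all_moments_sum => j.
  by apply: all_momentsM => //; exact: all_momentsZ.
apply: eq_expect => w; rewrite !mulr_sumr; apply: eq_bigr => i _.
rewrite !mulr_sumr mulr_suml; apply: eq_bigr => j _; ring.
Qed.

(** Here c = 2p with p = 2m + 1, so the factor Q^{p-1} is nonnegative and [quad_le] bounds the form
    by rho (Q + tau). Then c rho Q <= (Q^2 + c^2 rho^2) / 2, and half of the left-hand side is
    absorbed. *)
Lemma expect_quad_even_le m c : c = 2 * (m * 2).+1%:R ->
  'E (fun w => Q w ^+ (m.+1 * 2)) <=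
  (c ^+ 2 * rho ^+ 2 + 2 * c * rho * tau) * 'E (fun w => Q w ^+ (m * 2)).
Proof.
move=> cE; pose p := (m * 2).+1.
have aQp k : all_moments P (fun w => Q w ^+ k) by exact: all_momentsX.
have aS : all_moments P (fun w => \sum_i \sum_j Gamma i j * xi i w * xi j w).
  apply: all_moments_sum => i; apply: all_moments_sum => j.
  by apply: all_momentsM => //; exact: all_momentsZ.
have -> : (m.+1 * 2 = p.+1)%N by rewrite mulSn.
have e0 := expect_quadS p.
set K := c ^+ 2 * rho ^+ 2 + 2 * c * rho * tau.
have c0 : 0 <= c by rewrite cE mulr_ge0.
suff : 'E (fun w => Q w ^+ p.+1) <=
    2^-1 * 'E (fun w => Q w ^+ p.+1) + 2^-1 * K * 'E (fun w => Q w ^+ (m * 2)).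
  lra.
rewrite {1}e0 -!expectZ//; last exact: all_momentsM.
rewrite -expectD; [|exact: all_momentsZ|exact: all_momentsZ].
apply: expect_le.
- exact/all_momentsZ/all_momentsM.
- by apply: all_momentsD; exact: all_momentsZ.
move=> w; have := quad_le (fun i => xi i w).
set q := \sum_i _ - tau.
have -> : \sum_i xi i w ^+ 2 = q + tau by rewrite subrK.
set S := \sum_i \sum_j _; rewrite /p /=.
have -> : q ^+ (m * 2).+2 = q ^+ 2 * q ^+ (m * 2) by rewrite -exprD.
have : 0 <= q ^+ (m * 2) by rewrite exprM sqr_ge0.
set a := q ^+ (m * 2) => a0 /(le_trans (ler_norm _)) hS.
rewrite -cE.
apply: (@le_trans _ _ (c * (rho * (q + tau)) * a)).
  have -> : c * (a * S) = c * S * a by ring.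
  by apply: ler_wpM2r => //; exact: ler_wpM2l.
rewrite [X in _ <= X + _]mulrA -mulrDl; apply: ler_wpM2r => //.
have := sqr_ge0 (q - c * rho); rewrite /K; nra.
Qed.

(** The product is the double factorial (2m - 1)!!. *)
Lemma gaussian_space_moment_even m L : V L ->
  'E (fun w => L w ^+ (m * 2)) =
  \prod_(j < m) (j * 2).+1%:R * ('E (fun w => L w ^+ 2)) ^+ m.
Proof.
move=> VL; have [_ _ _ mom] := gV; elim: m => [|m IH].
  rewrite big_ord0 mul1r; under eq_Rintegral do rewrite expr0.
  exact: Rintegral_probability_cst.
rewrite (_ : (m.+1 * 2 = (m * 2).+2)%N) ?mulSn// mom// IH big_ord_recr /= exprS; ring.
Qed.

End wick.

(** The order of quantifiers is the point: [K] depends on [m] alone, so one constant serves every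
    [n]. The induction uses c^2 rho^2 + 2 c rho tau <= (c^2 + 2c) rho (rho + tau). *)
Lemma expect_quad_le {R : realType} (m : nat) : exists2 K : R, 0 <= K &
  forall (d : measure_display) (Omega : measurableType d)
    (P : probability Omega R) (V : set (Omega -> R)),
    gaussian_space P V -> forall (n : nat) (xi : 'I_n -> Omega -> R) (rho : R),
    (forall i, V (xi i)) -> 0 <= rho ->
    (forall i, \sum_j `|\int[P]_w (xi i w * xi j w)| <= rho) ->
    forall tau, tau = \sum_i \int[P]_w (xi i w * xi i w) ->
    \int[P]_w ((\sum_i xi i w ^+ 2 - tau) ^+ (m * 2)) <=
    K * (rho * (rho + tau)) ^+ m.
Proof.
elim: m => [|m [K K0 IH]].
  exists 1 => // d Omega P V gV n xi rho Vxi rho0 row tau _.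
  under eq_Rintegral do rewrite expr0.
  by rewrite Rintegral_probability_cst mulr1.
pose c : R := 2 * (m * 2).+1%:R.
have c0 : 0 <= c by rewrite /c mulr_ge0.
exists ((c ^+ 2 + 2 * c) * K); first by rewrite mulr_ge0// addr_ge0 ?mulr_ge0 ?sqr_ge0.
move=> d Omega P V gV n xi rho Vxi rho0 row tau tauE.
have tau0 : 0 <= tau.
  by rewrite tauE; apply: sumr_ge0 => i _; apply: expect_ge0 => w; rewrite -expr2 sqr_ge0.
have := expect_quad_even_le gV Vxi row (erefl c).
rewrite -tauE => /le_trans; apply.
rewrite [(rho * _) ^+ m.+1]exprS [leRHS]mulrACA; apply: ler_pM.
- by rewrite addr_ge0 ?mulr_ge0 ?sqr_ge0.
- by apply: expect_ge0 => w; rewrite exprM sqr_ge0.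
- have : 0 <= c ^+ 2 * (rho * tau) + 2 * c * rho ^+ 2.
    by rewrite addr_ge0 ?mulr_ge0 ?sqr_ge0.
  lra.
- exact: IH gV _ _ _ Vxi rho0 row _ tauE.
Qed.

(** * From summable expectations to almost sure bounds *)

Section ae_bounded.
Context {R : realType} {d : measure_display} {Omega : measurableType d}.
Variable P : probability Omega R.

(** The series has a finite integral by monotone convergence, hence is finite almost everywhere.
    This takes the place of a Borel-Cantelli argument. *)
Lemma ae_bounded_series (X : nat -> Omega -> R) (K : R) :
  (forall n, all_moments P (X n)) -> (forall n w, 0 <= X n w) ->
  (forall N, \sum_(n < N) \int[P]_w X n w <= K) ->
  {ae P, forall w, exists M, forall N, \sum_(n < N) X n w <= M}.
Proof.
move=> aX X0 XK.
have mX n : measurable_fun setT (EFin \o X n) by apply/measurable_EFinP; exact: (aX n).1.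
have iX n : (\int[P]_w (X n w)%:E = (\int[P]_w X n w)%:E)%E.
  by rewrite /Rintegral fineK// integrable_fin_num//; exact: all_moments_integrable.
have fin : (\int[P]_w (\sum_(n <oo) (X n w)%:E) < +oo)%E.
  rewrite integral_nneseries//; last by move=> n w _; rewrite lee_fin.
  apply: (@le_lt_trans _ _ K%:E); last exact: ltry.
  apply: lime_le.
    by apply: is_cvg_ereal_nneg_natsum => n _; rewrite iX lee_fin; apply: expect_ge0.
  apply: nearW => N; under eq_bigr do rewrite iX.
  by rewrite sumEFin lee_fin big_mkord.
have intS : P.-integrable setT (fun w => \sum_(n <oo) (X n w)%:E)%E.
  apply/integrableP; split.
    rewrite (_ : (fun w => _) = (fun w => \sum_(0 <= i <oo | i \in predT) (X i w)%:E)%E).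
      have X0' n w : setT w -> n \in predT -> (0 <= (X n w)%:E)%E by rewrite lee_fin.
      exact: (ge0_emeasurable_sum X0' (fun n _ => mX n)).
    by apply/funext => w; apply: eq_eseriesl => i; rewrite inE.
  under eq_integral => w _.
    rewrite gee0_abs; last by apply: nneseries_ge0 => n _ _; rewrite lee_fin.
    over.
  exact: fin.
have h := integrable_ae measurableT intS; apply: filterS h => w h; have {}h := h I.
exists (fine (\sum_(n <oo) (X n w)%:E)%E) => N.
rewrite -lee_fin fineK//.
apply: le_trans (nneseries_lim_ge N _); last by move=> n _ _; rewrite lee_fin.
by rewrite big_mkord sumEFin.
Qed.

Lemma bounded_series_cvg0 (u : R^nat) (M : R) : (forall n, 0 <= u n) ->
  (forall N, \sum_(n < N) u n <= M) -> u n @[n --> \oo] --> 0.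
Proof.
move=> u0 uM; apply: cvg_series_cvg_0.
apply: nondecreasing_is_cvgn.
  by apply: nondecreasing_series => n _ _.
exists M => _ [N _ <-]; rewrite /series/= big_mkord; exact: uM.
Qed.

End ae_bounded.

(** * Covariance of the increments of fractional Brownian motion *)

Section powR_increments.
Context {R : realType}.
Implicit Types (p x y u v l L M : R).

Lemma powR_convex p t x y : 1 <= p -> 0 <= t <= 1 -> 0 <= x -> 0 <= y ->
  (t * x + (1 - t) * y) `^ p <= t * x `^ p + (1 - t) * y `^ p.
Proof.
move=> p1 /andP[t0 t1] x0 y0.
have := @convex_powR R p p1 (Itv01 t0 t1) x y.
by rewrite !convRE /= !inE/= !in_itv/= !andbT; apply.
Qed.

(** Convexity for the exponent 1/p, applied to the p-th powers, followed by the increasing map y ->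
    y^p. *)
Lemma powR_concave p t x y : 0 < p <= 1 -> 0 <= t <= 1 -> 0 <= x -> 0 <= y ->
  t * x `^ p + (1 - t) * y `^ p <= (t * x + (1 - t) * y) `^ p.
Proof.
move=> /andP[p0 p1] t01 x0 y0; have /andP[t0 t1] := t01.
have ip1 : 1 <= p^-1 by rewrite invf_ge1.
have := powR_convex ip1 t01 (powR_ge0 x p) (powR_ge0 y p).
rewrite -!powRrM mulfV ?gt_eqF// !powRr1// => h.
have S0 : 0 <= t * x `^ p + (1 - t) * y `^ p.
  by rewrite addr_ge0 ?mulr_ge0 ?powR_ge0// subr_ge0.
have := ge0_ler_powR (ltW p0) (powR_ge0 _ _) _ h.
rewrite -powRrM mulVf ?gt_eqF// powRr1//; apply.
by rewrite nnegrE addr_ge0 ?mulr_ge0// subr_ge0.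
Qed.

Let midpoint x u v : u + v != 0 ->
  (v / (u + v)) * x + (1 - v / (u + v)) * (x + u + v) = x + u.
Proof. by move=> uv; field. Qed.

Let frac01 u v : 0 <= u -> 0 <= v -> u + v != 0 -> 0 <= v / (u + v) <= 1.
Proof.
move=> u0 v0 uv; have uv0 : 0 < u + v by rewrite lt_neqAle eq_sym uv addr_ge0.
by rewrite divr_ge0 ?addr_ge0//= ler_pdivrMr// mul1r lerDr.
Qed.

(** The two inner points are convex combinations of the two outer ones with complementary weights,
    so adding the two convexity inequalities gives total weight one to each outer point. *)
Lemma powR_four_convex p x u v : 1 <= p -> 0 <= x -> 0 <= u -> 0 <= v ->
  (x + u) `^ p + (x + v) `^ p <= x `^ p + (x + u + v) `^ p.
Proof.
move=> p1 x0 u0 v0; have [uv|uv] := eqVneq (u + v) 0.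
  have [-> ->] : u = 0 /\ v = 0 by move/eqP: uv; rewrite paddr_eq0// => /andP[/eqP-> /eqP->].
  by rewrite !addr0.
have vu : v + u != 0 by rewrite addrC.
have y0 : 0 <= x + u + v by rewrite !addr_ge0.
have h1 := powR_convex p1 (frac01 u0 v0 uv) x0 y0.
have h2 := powR_convex p1 (frac01 v0 u0 vu) x0 y0.
move: h1 h2; rewrite (midpoint _ uv).
have -> : u / (v + u) * x + (1 - u / (v + u)) * (x + u + v) = x + v by field.
move=> h1 h2.
apply: le_trans (lerD h1 h2) _.
rewrite le_eqVlt; apply/orP; left; apply/eqP; by field.
Qed.

Lemma powR_four_concave p x u v : 0 < p <= 1 -> 0 <= x -> 0 <= u -> 0 <= v ->
  x `^ p + (x + u + v) `^ p <= (x + u) `^ p + (x + v) `^ p.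
Proof.
move=> p1 x0 u0 v0; have [uv|uv] := eqVneq (u + v) 0.
  have [-> ->] : u = 0 /\ v = 0 by move/eqP: uv; rewrite paddr_eq0// => /andP[/eqP-> /eqP->].
  by rewrite !addr0.
have vu : v + u != 0 by rewrite addrC.
have y0 : 0 <= x + u + v by rewrite !addr_ge0.
have h1 := powR_concave p1 (frac01 u0 v0 uv) x0 y0.
have h2 := powR_concave p1 (frac01 v0 u0 vu) x0 y0.
move: h1 h2; rewrite (midpoint _ uv).
have -> : u / (v + u) * x + (1 - u / (v + u)) * (x + u + v) = x + v by field.
move=> h1 h2.
apply: le_trans (lerD h1 h2).
rewrite le_eqVlt; apply/orP; left; apply/eqP; by field.
Qed.

(** The left-hand side is twice the absolute covariance of adjacent increments of lengths [l] and
    [L] for Hurst parameter p/2. For p <= 1 it is at most l^p; for p > 1 it is of the order of the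
    derivative of the power times l. Hence the exponent min(1, p). *)
Lemma powR_increment_le p l L M : 0 < p < 2 -> 0 <= l -> 0 <= L -> l + L <= M -> 1 <= M ->
  `|(l + L) `^ p - L `^ p - l `^ p| <= 2 * M * l `^ Num.min 1 p.
Proof.
move=> /andP[p0 p2] l0 L0 lLM M1.
have M0 : 0 <= M by rewrite (le_trans _ M1).
have [p1|/ltW p1] := leP p 1.
  rewrite ler0_norm; last first.
    have := @powR_four_concave p 0 l L; rewrite !add0r powR0 ?gt_eqF// add0r p0 p1.
    by move=> /(_ isT (lexx _) l0 L0); lra.
  have : L `^ p <= (l + L) `^ p.
    by apply: ge0_ler_powR; rewrite ?nnegrE ?(ltW p0) ?addr_ge0// lerDr.
  have := powR_ge0 l p; nra.
have l1 : l `^ 1 = l by rewrite powRr1.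
rewrite l1 ger0_norm; last first.
  have := @powR_four_convex p 0 l L; rewrite !add0r powR0 ?gt_eqF// add0r p1.
  by move=> /(_ isT (lexx _) l0 L0); lra.
pose q := p - 1; have q0 : 0 <= q by rewrite subr_ge0.
have q1 : q <= 1 by rewrite /q; lra.
have pq x : 0 <= x -> x `^ p = x * x `^ q by move=> x0; rewrite mulr_powRB1.
have M2 : (l + L) `^ q <= M.
  apply: le_trans (ge0_ler_powR q0 _ _ lLM) _; rewrite ?nnegrE ?addr_ge0//.
  exact: ler1_powR.
(* Substitute for the mean value theorem. As (l+L)^p = l (l+L)^q + L (l+L)^q, it yields (l+L)^p -
   L^p <= l ((l+L)^q + L^q). It holds because y <= y^q for y in (0, 1] and q <= 1. *)
have h : L * (l + L) `^ q <= (l + L) * L `^ q.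
  have [->|Ln0] := eqVneq L 0; first by rewrite mul0r addr0 mulr_ge0 ?powR_ge0.
  have Lp : 0 < L by rewrite lt_neqAle eq_sym Ln0.
  have lL : 0 < l + L by rewrite ltr_wpDl.
  have f : 0 < L / (l + L) <= 1 by rewrite divr_gt0//= ler_pdivrMr// mul1r lerDr.
  rewrite -[X in _ * X `^ q](divfK (lt0r_neq0 lL)).
  have -> : L `^ q = (L / (l + L)) `^ q * (l + L) `^ q.
    by rewrite -powRM ?divfK ?gt_eqF// ltW//; case/andP: f.
  rewrite divfK ?gt_eqF// mulrA ler_wpM2r ?powR_ge0// -ler_pdivrMl// mulrC.
  exact: ger1_powR.
have Lq : L `^ q <= (l + L) `^ q.
  by apply: (ge0_ler_powR q0); rewrite ?nnegrE ?lerDr// addr_ge0.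
have := ler_wpM2l l0 (le_trans Lq M2); have := ler_wpM2l l0 M2.
have := mulr_ge0 l0 (powR_ge0 l q).
rewrite !pq ?addr_ge0//; lra.
Qed.

Lemma powR_le_min1 p l M : 0 < p < 2 -> 0 <= l <= M -> 1 <= M ->
  l `^ p <= M * l `^ Num.min 1 p.
Proof.
move=> /andP[p0 p2] /andP[l0 lM] M1.
have [p1|/ltW p1] := leP p 1; first by rewrite ler_peMl// powR_ge0.
rewrite powRr1// -[leLHS](@mulr_powRB1 _ l) // mulrC ler_wpM2r//.
apply: le_trans (@ge0_ler_powR _ (p - 1) _ _ _ _ _ lM) _; rewrite ?nnegrE ?subr_ge0 ?(le_trans l0)//.
by apply: ler1_powR => //; lra.
Qed.

Lemma sum_norm_increments (f : nat -> R) (m n : nat) : (m <= n)%N ->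
  (forall j, (m <= j < n)%N -> f j <= f j.+1) \/
  (forall j, (m <= j < n)%N -> f j.+1 <= f j) ->
  \sum_(m <= j < n) `|f j.+1 - f j| = `|f n - f m|.
Proof.
move=> mn hf; rewrite -[in RHS](telescope_sumr _ mn).
case: hf => hf.
  rewrite ger0_norm; last by rewrite big_nat sumr_ge0// => j /hf; rewrite subr_ge0.
  by apply: eq_big_nat => j /hf h; rewrite ger0_norm// subr_ge0.
rewrite ler0_norm; last by rewrite big_nat sumr_le0// => j /hf; rewrite subr_le0.
rewrite -sumrN; apply: eq_big_nat => j /hf h.
by rewrite ler0_norm// subr_le0.
Qed.

(** Each summand is, for p = 2H, twice the absolute covariance of two increments of fractional
    Brownian motion along the points [q]. Off the diagonal the sign is constant on either side of
    [i], so that both sums telescope to boundary terms; with the diagonal there are three terms of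
    size at most 2M l^{min(1,p)}. *)
Lemma increment_cov_row_le p (q : nat -> R) N i M : 0 < p < 2 -> 1 <= M ->
  (forall a b, (a <= b)%N -> q a <= q b) -> q N - q 0%N <= M -> (i < N)%N ->
  \sum_(0 <= j < N) `| `|q j.+1 - q i| `^ p + `|q j - q i.+1| `^ p -
     `|q j - q i| `^ p - `|q j.+1 - q i.+1| `^ p|
  <= 6 * M * (q i.+1 - q i) `^ Num.min 1 p.
Proof.
move=> p02 M1 qh qM iN; have /andP[p0 p2] := p02.
(* A discrete primitive of the row: its increments are the signed summands, so constant sign means
   monotonicity of [g]. *)
pose g j := `|q j - q i| `^ p - `|q j - q i.+1| `^ p.
pose k := Num.min 1 p; pose l := q i.+1 - q i.
rewrite (eq_bigr (fun j => `|g j.+1 - g j|)); last first.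
  by move=> j _; congr `|_|; rewrite /g; ring.
have l0 : 0 <= l by rewrite subr_ge0 qh.
have gN j : (i < j)%N -> g j = (q j - q i) `^ p - (q j - q i.+1) `^ p.
  by move=> ij; rewrite /g !ger0_norm// subr_ge0 qh// ltnW.
have gP j : (j <= i)%N -> g j = (q i - q j) `^ p - (q i.+1 - q j) `^ p.
  move=> ji; rewrite /g !(distrC (q j)) !ger0_norm// subr_ge0 qh//.
  exact: leqW.
have mono m n : (n <= i)%N \/ (i < m)%N ->
   (forall j, (m <= j < n)%N -> g j <= g j.+1) \/
   (forall j, (m <= j < n)%N -> g j.+1 <= g j).
  have [p1|/ltW p1] := leP p 1 => -[ni|im]; [right|right|left|left] => j /andP[mj jn];
    [have ji : (j < i)%N by exact: leq_trans ni | have ij : (i < j)%N by exact: leq_trans mj |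
     have ji : (j < i)%N by exact: leq_trans ni | have ij : (i < j)%N by exact: leq_trans mj].
  - have x0 : 0 <= q i - q j.+1 by rewrite subr_ge0 qh.
    have u0 : 0 <= q j.+1 - q j by rewrite subr_ge0 qh.
    have := @powR_four_concave p _ _ _ _ x0 u0 l0; rewrite p0 p1 => /(_ isT).
    rewrite !gP//; last exact: ltnW.
    have -> : q i - q j.+1 + (q j.+1 - q j) = q i - q j by ring.
    have -> : q i - q j.+1 + l = q i.+1 - q j.+1 by rewrite /l; ring.
    have -> : q i - q j + l = q i.+1 - q j by rewrite /l; ring.
    lra.
  - have x0 : 0 <= q j - q i.+1 by rewrite subr_ge0 qh.
    have u0 : 0 <= q j.+1 - q j by rewrite subr_ge0 qh.
    have := @powR_four_concave p _ _ _ _ x0 u0 l0; rewrite p0 p1 => /(_ isT).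
    rewrite !gN//; last exact: ltnW.
    have -> : q j - q i.+1 + (q j.+1 - q j) = q j.+1 - q i.+1 by ring.
    have -> : q j - q i.+1 + l = q j - q i by rewrite /l; ring.
    have -> : q j.+1 - q i.+1 + l = q j.+1 - q i by rewrite /l; ring.
    lra.
  - have x0 : 0 <= q i - q j.+1 by rewrite subr_ge0 qh.
    have u0 : 0 <= q j.+1 - q j by rewrite subr_ge0 qh.
    have := @powR_four_convex p _ _ _ p1 x0 u0 l0.
    rewrite !gP//; last exact: ltnW.
    have -> : q i - q j.+1 + (q j.+1 - q j) = q i - q j by ring.
    have -> : q i - q j.+1 + l = q i.+1 - q j.+1 by rewrite /l; ring.
    have -> : q i - q j + l = q i.+1 - q j by rewrite /l; ring.
    lra.
  - have x0 : 0 <= q j - q i.+1 by rewrite subr_ge0 qh.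
    have u0 : 0 <= q j.+1 - q j by rewrite subr_ge0 qh.
    have := @powR_four_convex p _ _ _ p1 x0 u0 l0.
    rewrite !gN//; last exact: ltnW.
    have -> : q j - q i.+1 + (q j.+1 - q j) = q j.+1 - q i.+1 by ring.
    have -> : q j - q i.+1 + l = q j - q i by rewrite /l; ring.
    have -> : q j.+1 - q i.+1 + l = q j.+1 - q i by rewrite /l; ring.
    lra.
have q0i : q 0%N <= q i by exact: qh.
have qii : q i <= q i.+1 by exact: qh.
have qiN : q i.+1 <= q N by exact: qh.
have p_neq0 : p != 0 by rewrite gt_eqF.
have hk L : 0 <= L -> l + L <= M -> `|(l + L) `^ p - L `^ p - l `^ p| <= 2 * M * l `^ k.
  by move=> L0 lLM; exact: powR_increment_le.
(* The row is cut into the columns left of [i], the diagonal column, and the columns right of it;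
   [h1], [h2] and [h3] bound them. *)
rewrite (big_cat_nat (n := i))//=; last exact: ltnW.
rewrite [X in _ + X]big_ltn//.
rewrite (sum_norm_increments (leq0n i)); last by apply: mono; left.
rewrite (sum_norm_increments iN); last by apply: mono; right.
have -> : g i = - l `^ p by rewrite gP// subrr powR0// sub0r.
have -> : g i.+1 = l `^ p by rewrite gN// subrr powR0// subr0.
rewrite gP// gN//.
have h1 : `|- l `^ p - ((q i - q 0%N) `^ p - (q i.+1 - q 0%N) `^ p)| <= 2 * M * l `^ k.
  have := hk (q i - q 0%N); have -> : l + (q i - q 0%N) = q i.+1 - q 0%N by rewrite /l; ring.
  have -> : - l `^ p - ((q i - q 0%N) `^ p - (q i.+1 - q 0%N) `^ p) =
    (q i.+1 - q 0%N) `^ p - (q i - q 0%N) `^ p - l `^ p by ring.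
  by apply; [rewrite subr_ge0|lra].
have h2 : `|l `^ p - - l `^ p| <= 2 * M * l `^ k.
  rewrite opprK -mulr2n normrMn ger0_norm ?powR_ge0// -mulrA mulr_natl lerMn2r/=.
  by apply: powR_le_min1 => //; rewrite l0 /l; lra.
have h3 : `|(q N - q i) `^ p - (q N - q i.+1) `^ p - l `^ p| <= 2 * M * l `^ k.
  have := hk (q N - q i.+1); have -> : l + (q N - q i.+1) = q N - q i by rewrite /l; ring.
  by apply; [rewrite subr_ge0|lra].
rewrite -/l -/k; lra.
Qed.

End powR_increments.

(** * The Gaussian space spanned by fractional Brownian motion *)

Section fbm.
Context {R : realType} {d : measure_display} {Omega : measurableType d}.
Variable P : probability Omega R.
Variables (H : R) (B : R -> {RV P >-> R}).
Hypotheses (H_gt0 : 0 < H) (H_lt1 : H < 1).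
Hypothesis fBm : fractional_brownian_motion H B.

Local Notation "'E f" := (Rintegral P setT f) (at level 10, f at level 8).

Definition fbm_span : set (Omega -> R) :=
  [set L | exists n (t c : 'I_n -> R), (forall i, 0 <= t i) /\
     L = fun w => \sum_(i < n) c i * B (t i) w].

Lemma fbm_span_increment s t : 0 <= s -> 0 <= t ->
  fbm_span (fun w => B t w - B s w).
Proof.
move=> s0 t0; exists 2%N, (fun i => if i == ord0 then t else s),
  (fun i => if i == ord0 then 1 else -1); split; first by move=> i; case: ifP.
by apply/funext => w; rewrite big_ord_recl big_ord1/= mul1r mulN1r.
Qed.

Lemma fbm_span_lin L M r : fbm_span L -> fbm_span M ->
  fbm_span (fun w => L w + r * M w).
Proof.
move=> [n [t [c [t0 ->]]]] [m [t' [c' [t'0 ->]]]].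
exists (n + m)%N, (fun i => match fintype.split i with inl j => t j | inr k => t' k end),
  (fun i => match fintype.split i with inl j => c j | inr k => r * c' k end); split.
  by move=> i; case: fintype.split.
apply/funext => w; rewrite big_split_ord/=; congr (_ + _).
  by apply: eq_bigr => i _; rewrite -[lshift _ _]/(unsplit (inl i)) unsplitK.
rewrite mulr_sumr; apply: eq_bigr => i _.
by rewrite -[rshift _ _]/(unsplit (inr i)) unsplitK mulrA.
Qed.

Lemma measurable_fbm_span L : fbm_span L -> measurable_fun setT L.
Proof.
move=> [n [t [c [_ ->]]]].
by apply: measurable_sum => i; apply: measurable_funM.
Qed.

Let B_mem t : 0 <= t -> fbm_span (B t).
Proof.
move=> t0; exists 1%N, (fun=> t), (fun=> 1); split => //.
by apply/funext => w; rewrite big_ord1 mul1r.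
Qed.

(** The zero mean is a hypothesis here to avoid a circle: linearity of the expectation on the span
    needs integrability of each [B t], whose mean vanishes by definition. *)
Lemma fbm_span_all_moments L : fbm_span L -> 'E L = 0 -> all_moments P L.
Proof.
move=> VL EL; have mL := measurable_fbm_span VL; split => // k.
have [gB _ _ _] := fBm.
have gL : is_gaussian P L by case: VL => n [t [c [t0 ->]]]; exact: gB.
have [iL _] := centered_gaussian_moments mL gL EL k.
have := integrable_norm iL; rewrite /comp.
by under eq_fun do rewrite normrX.
Qed.

Lemma expect_fbm_span L : fbm_span L -> 'E L = 0.
Proof.
move=> [n [t [c [t0 ->]]]]; have [_ EB _ _] := fBm.
have aB s : 0 <= s -> all_moments P (B s).
  move=> s0; apply: fbm_span_all_moments; first exact: B_mem.
  by have := EB s s0; rewrite expectation_def /Rintegral => ->.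
rewrite expect_sum; last by move=> i; apply/all_momentsZ/aB.
apply: big1 => i _; rewrite expectZ; last exact: aB.
by have := EB _ (t0 i); rewrite expectation_def /Rintegral => -> /=; rewrite mulr0.
Qed.

Lemma fbm_gaussian_space : gaussian_space P fbm_span.
Proof.
split.
- by move=> L VL; apply: fbm_span_all_moments => //; exact: expect_fbm_span.
- by move=> L M t; exact: fbm_span_lin.
- exact: expect_fbm_span.
move=> L k VL; have [gB _ _ _] := fBm.
have gL : is_gaussian P L by case: VL => n [t [c [t0 ->]]]; exact: gB.
by have [_ ->] := centered_gaussian_moments (measurable_fbm_span VL) gL (expect_fbm_span VL) k.
Qed.

Lemma expect_fbm_increments a b c e : 0 <= a -> 0 <= b -> 0 <= c -> 0 <= e ->
  'E (fun w => (B b w - B a w) * (B e w - B c w)) =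
  2^-1 * (`|e - a| `^ (2 * H) + `|c - b| `^ (2 * H) - `|c - a| `^ (2 * H)
          - `|e - b| `^ (2 * H)).
Proof.
move=> a0 b0 c0 e0; have [_ _ EBB _] := fBm.
have aB s : 0 <= s -> all_moments P (B s).
  by move=> s0; have [am _ _ _] := fbm_gaussian_space; apply/am/B_mem.
have aBB s t : 0 <= s -> 0 <= t -> all_moments P (fun w => B s w * B t w).
  by move=> s0 t0; apply: all_momentsM; exact: aB.
have C s t : 0 <= s -> 0 <= t -> 'E (fun w => B s w * B t w) =
   2^-1 * (s `^ (2 * H) + t `^ (2 * H) - `|t - s| `^ (2 * H)).
  move=> s0 t0; have := EBB s t s0 t0.
  by rewrite unlock /Rintegral => ->.
transitivity ('E (fun w => (B b w * B e w - B b w * B c w) - (B a w * B e w - B a w * B c w))).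
  by apply: eq_expect => w; ring.
rewrite !expectB//; try by [exact: aBB|apply: all_momentsB; exact: aBB].
rewrite !C//; ring.
Qed.

End fbm.

(** * The time change and elementary estimates *)

Section time_change.
Context {R : realType}.
Implicit Types (H x y t h : R).

Lemma expR_sub1_le x : expR x - 1 <= x * expR x.
Proof.
have := expR_ge1Dx (- x); rewrite expRN => h.
have e0 := expR_gt0 x.
have : (1 - x) * expR x <= 1 by rewrite -ler_pdivlMr// div1r.
lra.
Qed.

Lemma a_gt0 H t : 0 < H -> 0 < a_ H t.
Proof. by move=> H0; rewrite mulr_gt0 ?expR_gt0. Qed.

Lemma a_nondecreasing H x y : 0 < H -> x <= y -> a_ H x <= a_ H y.
Proof. by move=> H0 xy; rewrite ler_pM2l// ler_expR ler_pM2r ?invr_gt0. Qed.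

Lemma a_increment H x y : a_ H y - a_ H x = expR (x / H) * a_ H (y - x) - a_ H x.
Proof. by rewrite /a_ mulrCA -expRD -mulrDl subrKC. Qed.

Lemma a_increment_le H t x y : 0 < H -> x <= y -> y <= t ->
  a_ H y - a_ H x <= expR (t / H) * (y - x).
Proof.
move=> H0 xy yt; have := expR_sub1_le ((y - x) / H).
have e0 := expR_gt0 (x / H).
move=> /(ler_wpM2l (ltW e0)); rewrite mulrBr mulr1 mulrCA -!expRD -!mulrDl subrKC.
move=> /(ler_wpM2l (ltW H0)); rewrite mulrBr -/(a_ H y) -/(a_ H x) => h.
apply: le_trans h _.
have -> : H * ((y - x) / H * expR (y / H)) = expR (y / H) * (y - x).
  by field; rewrite gt_eqF.
by rewrite ler_wpM2r ?subr_ge0// ler_expR ler_pM2r ?invr_gt0.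
Qed.

Lemma sum_inv_sqr_le N : \sum_(n < N) (n.+1%:R ^+ 2)^-1 <= 2 :> R.
Proof.
(* Comparison of 1/n^2 with the telescoping term 2/n - 2/(n+1); the strengthened bound makes the
   induction go through. *)
suff : \sum_(n < N) (n.+1%:R ^+ 2)^-1 <= 2 * (1 - N.+1%:R^-1) :> R.
  by move=> /le_trans; apply; rewrite ler_piMr// gerBl invr_ge0.
elim: N => [|N IH]; first by rewrite big_ord0 invr1 subrr mulr0.
rewrite big_ord_recr/=; apply: le_trans (lerD IH (lexx _)) _.
have h1 : 0 < N.+1%:R :> R by [].
have h2 : N.+2%:R = N.+1%:R + 1 :> R by rewrite natr1.
have h3 : 1 <= N.+1%:R :> R by rewrite ler1n.
rewrite h2; set a : R := N.+1%:R in h1 h3 *.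
rewrite -subr_ge0.
have -> : 2 * (1 - (a + 1)^-1) - (2 * (1 - a^-1) + (a ^+ 2)^-1) =
  (a - 1) / (a ^+ 2 * (a + 1)) by field; rewrite ?andbT; apply/andP; split; lra.
by rewrite divr_ge0 ?subr_ge0// mulr_ge0 ?sqr_ge0// addr_ge0 ?ltW.
Qed.

End time_change.

(** * Quadratic variation of the time-changed noise *)

Section fbm_quadratic_variation.
Context {R : realType} {d : measure_display} {Omega : measurableType d}.
Variable P : probability Omega R.
Variables (H : R) (B : R -> {RV P >-> R}).
Hypotheses (H_gt0 : 0 < H) (H_lt1 : H < 1).
Hypothesis fBm : fractional_brownian_motion H B.

Local Notation "'E f" := (Rintegral P setT f) (at level 10, f at level 8).
Local Notation g := (fun s => B (a_ H s)).
Local Notation dg n i := (fun w => g (i.+1%:R / n%:R) w - g (i%:R / n%:R) w).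

Let xi n i w := n%:R `^ (H - 2^-1) * expR (- (i%:R / n%:R)) * dg n i w.
Let N (t : R) n := Num.truncn (n%:R * t).
(** An increment of [a_ H] over one step has length O(1/n), so [increment_cov_row_le] gives
    covariance rows of order n^{-kappa}; the normalisation n^{2H-1} turns this into n^{-delta}. *)
Let kappa := Num.min 1 (2 * H).
Let delta := kappa - (2 * H - 1).
Let tau (t : R) n := \sum_(i < N t n) 'E (fun w => xi n i w * xi n i w).

Let a_ge0 s : 0 <= a_ H s. Proof. by apply/ltW/a_gt0. Qed.

Let xi_mem n i : fbm_span B (xi n i).
Proof.
have := fbm_span_lin (n%:R `^ (H - 2^-1) * expR (- (i%:R / n%:R)) - 1)
  (fbm_span_increment B (a_ge0 (i%:R / n%:R)) (a_ge0 (i.+1%:R / n%:R)))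
  (fbm_span_increment B (a_ge0 (i%:R / n%:R)) (a_ge0 (i.+1%:R / n%:R))).
by congr (fbm_span B _); apply/funext => w; rewrite /xi; ring.
Qed.

Let sqr_pow n : (0 < n)%N -> n%:R `^ (H - 2^-1) * n%:R `^ (H - 2^-1) = n%:R `^ (2 * H - 1) :> R.
Proof.
move=> n0; rewrite -powRD; last by rewrite pnatr_eq0 -lt0n n0 implybT.
by congr (_ `^ _); field.
Qed.

Let cov_xi n i j : (0 < n)%N -> 'E (fun w => xi n i w * xi n j w) =
  n%:R `^ (2 * H - 1) * expR (- (i%:R / n%:R)) * expR (- (j%:R / n%:R)) *
  'E (fun w => dg n i w * dg n j w).
Proof.
move=> n0; rewrite -expectZ; last first.
  have [am _ _ _] := fbm_gaussian_space fBm.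
  by apply: all_momentsM; apply: am; apply: fbm_span_increment.
by apply: eq_expect => w; rewrite /xi -(sqr_pow n0); ring.
Qed.

Let half_add (x : R) : 2^-1 * (x + x) = x. Proof. by field. Qed.

Let h_ n := a_ H n%:R^-1 - H.

(** The increment of [a_ H] over step [i] is e^{i/(nH)} [h_ n]. Its power 2H carries the factor
    e^{2i/n}, which the two exponential weights remove, so the result is free of [i]. *)
Let cov_xi_diag n i : (0 < n)%N ->
  'E (fun w => xi n i w * xi n i w) = n%:R^-1 * (n%:R * h_ n) `^ (2 * H).
Proof.
move=> n0; rewrite cov_xi// (expect_fbm_increments fBm)// !subrr normr0.
have n0' : n%:R != 0 :> R by rewrite pnatr_eq0 -lt0n.
have H2 : 2 * H != 0 by rewrite mulf_neq0// gt_eqF.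
have H2' : 0 <= 2 * H by rewrite mulr_ge0// ltW.
rewrite powR0// !subr0 (distrC (a_ H (i%:R / n%:R))) half_add.
have -> : a_ H (i.+1%:R / n%:R) - a_ H (i%:R / n%:R) = expR (i%:R / n%:R / H) * h_ n.
  rewrite a_increment -mulrBl -natrB// subSnn mul1r /h_ mulrBr; congr (_ - _).
  exact: mulrC.
have h0 : 0 <= h_ n.
  have := a_nondecreasing H_gt0 (_ : 0 <= n%:R^-1); rewrite /h_ subr_ge0.
  by rewrite {1}/a_ mul0r expR0 mulr1; apply; rewrite invr_ge0.
rewrite ger0_norm ?mulr_ge0 ?expR_ge0// powRM ?expR_ge0// powRM//.
rewrite -expRM.
have -> : i%:R / n%:R / H * (2 * H) = i%:R / n%:R + i%:R / n%:R.
  by field; rewrite n0' gt_eqF.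
rewrite expRD expRN.
have -> : n%:R `^ (2 * H - 1) = n%:R^-1 * n%:R `^ (2 * H).
  by rewrite powRB ?n0' ?implybT// powRr1// mulrC.
field; rewrite n0' gt_eqF// expR_gt0//.
Qed.

Let tauE t n : (0 < n)%N ->
  tau t n = (N t n)%:R / n%:R * (n%:R * h_ n) `^ (2 * H).
Proof.
move=> n0; rewrite /tau (eq_bigr (fun=> n%:R^-1 * (n%:R * h_ n) `^ (2 * H))).
  by rewrite sumr_const card_ord -[LHS]mulr_natl mulrA.
by move=> i _; exact: cov_xi_diag.
Qed.

(** With x = 1/(nH) the base is (e^x - 1)/x, which lies between 1 and e^x, and the power 2H of e^x
    is e^{2/n}. *)
Let nh_bounds n : (0 < n)%N -> 1 <= (n%:R * h_ n) `^ (2 * H) <= expR (2 / n%:R).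
Proof.
move=> n0; have n0' : 0 < n%:R :> R by rewrite ltr0n.
have H2' : 0 <= 2 * H by rewrite mulr_ge0// ltW.
have e : n%:R * h_ n = (expR (n%:R^-1 / H) - 1) / (n%:R^-1 / H).
  by rewrite /h_ /a_; field; rewrite !gt_eqF.
set x := n%:R^-1 / H in e *.
have x0 : 0 < x by rewrite divr_gt0 ?invr_gt0.
have l1 : 1 <= n%:R * h_ n.
  rewrite e ler_pdivlMr// mul1r; have := expR_ge1Dx x; lra.
have l2 : n%:R * h_ n <= expR x.
  by rewrite e ler_pdivrMr// mulrC; exact: expR_sub1_le.
apply/andP; split.
  have h1 : 1 `^ (2 * H) = 1 :> R by rewrite powR1.
  rewrite -[leLHS]h1.
  by apply: (ge0_ler_powR H2'); rewrite ?nnegrE// (le_trans _ l1).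
apply: le_trans (ge0_ler_powR H2' _ _ l2) _; rewrite ?nnegrE ?expR_ge0 ?(le_trans _ l1)//.
rewrite -expRM ler_expR /x le_eqVlt; apply/orP; left; apply/eqP.
by field; rewrite !gt_eqF.
Qed.

Let N_bounds t n : 0 <= t -> (0 < n)%N ->
  t - n%:R^-1 <= (N t n)%:R / n%:R <= t.
Proof.
move=> t0 n0; have n0' : 0 < n%:R :> R by rewrite ltr0n.
have nt0 : 0 <= n%:R * t by rewrite mulr_ge0.
have /andP[h1 h2] := truncn_itv nt0.
rewrite /N ler_pdivrMr// (mulrC t) h1 andbT.
rewrite ler_pdivlMr// mulrBl mulVf ?gt_eqF// lerBlDr (mulrC t) natr1 ltW//.
Qed.

Let tau_cvg t : 0 <= t -> tau t n.+1 @[n --> \oo] --> t.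
Proof.
move=> t0.
apply: (@squeeze_cvgr _ _ _ _ (fun n => t - n.+1%:R^-1) (fun n => t * expR (2 / n.+1%:R))).
- apply: nearW => n; rewrite tauE//.
  have /andP[h1 h2] := @nh_bounds n.+1 isT; have /andP[h3 h4] := @N_bounds t n.+1 t0 isT.
  have h5 : 0 <= (N t n.+1)%:R / n.+1%:R :> R by rewrite divr_ge0.
  apply/andP; split; first by apply: le_trans h3 _; rewrite ler_peMr.
  by apply: ler_pM => //; rewrite (le_trans _ h1).
- rewrite -[X in _ --> X]subr0; apply: cvgB; [exact: cvg_cst|exact: cvg_harmonic].
- rewrite -[X in _ --> X]mulr1; apply: cvgM; first exact: cvg_cst.
  rewrite -[X in _ --> X]expR0.
apply: continuous_cvg; first exact: continuous_expR.
  rewrite -[X in _ --> X](mulr0 2); apply: cvgM; [exact: cvg_cst|exact: cvg_harmonic].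
Qed.

Let kappa_gt0 : 0 < kappa. Proof. by rewrite lt_min ltr01 mulr_gt0. Qed.

Let delta_gt0 : 0 < delta.
Proof.
have h : 2 * H - 1 < 1 by move: H_lt1 => ?; lra.
by rewrite subr_gt0 lt_min h gtrBl ltr01.
Qed.

Let weight_le (W e1 e2 x : R) : 0 <= W -> 0 <= e1 <= 1 -> 0 <= e2 <= 1 ->
  `|W * e1 * e2 * (2^-1 * x)| <= W * (2^-1 * `|x|).
Proof.
move=> W0 /andP[e10 e11] /andP[e20 e21]; rewrite !normrM.
rewrite (ger0_norm W0) (ger0_norm e10) (ger0_norm e20) [`|2^-1|]ger0_norm//.
apply: ler_wpM2r; first by rewrite mulr_ge0.
rewrite -mulrA ler_piMr//; nra.
Qed.

Let row t : 0 <= t -> exists2 C : R, 0 <= C & forall n, (0 < n)%N ->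
  forall i : 'I_(N t n),
  \sum_(j < N t n) `|'E (fun w => xi n i w * xi n j w)| <= C * n%:R `^ (- delta).
Proof.
(* The summand 1 secures [1 <= M], and [a_ H t] bounds the range of the points [q]. The 3 below is
   the 6 of the row estimate times the factor 1/2 of the covariance. *)
move=> t0; pose M := 1 + a_ H t.
have M1 : 1 <= M by rewrite lerDl.
have M0 : 0 <= M by rewrite (le_trans _ M1).
exists (3 * M * expR (t / H) `^ kappa); first by rewrite !mulr_ge0 ?powR_ge0.
move=> n n0 i; have n0' : 0 < n%:R :> R by rewrite ltr0n.
pose q j := a_ H (j%:R / n%:R).
have qh a b : (a <= b)%N -> q a <= q b.
  by move=> ab; apply: a_nondecreasing => //; rewrite ler_pM2r ?invr_gt0// ler_nat.
have /andP[_ Nt] := N_bounds t0 n0.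
have qM : q (N t n) - q 0%N <= M.
  have : q (N t n) <= a_ H t by exact: a_nondecreasing.
  have := a_ge0 (0%:R / n%:R); rewrite -/(q 0%N) /M; lra.
have p02 : 0 < 2 * H < 2 by move: H_gt0 H_lt1 => *; apply/andP; split; lra.
have := increment_cov_row_le p02 M1 qh qM (ltn_ord i).
rewrite big_mkord -/kappa => hrow.
have dq : q i.+1 - q i <= expR (t / H) / n%:R.
  have := @a_increment_le _ H t (i%:R / n%:R) (i.+1%:R / n%:R) H_gt0.
  rewrite -mulrBl -natrB// subSnn mul1r; apply.
    by rewrite ler_pM2r ?invr_gt0// ler_nat.
  by apply: le_trans Nt; rewrite ler_pM2r ?invr_gt0// ler_nat.
have dq' : (q i.+1 - q i) `^ kappa <= (expR (t / H) / n%:R) `^ kappa.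
  by apply: (ge0_ler_powR (ltW kappa_gt0)); rewrite ?nnegrE ?subr_ge0 ?qh// divr_ge0 ?expR_ge0.
have W0 : 0 <= n%:R `^ (2 * H - 1) :> R by exact: powR_ge0.
apply: (@le_trans _ _ (n%:R `^ (2 * H - 1) * 2^-1 * (6 * M * (q i.+1 - q i) `^ kappa))).
  rewrite -mulrA; apply: le_trans _ (ler_wpM2l W0 (ler_wpM2l _ hrow)); last by [].
  rewrite !mulr_sumr; apply: ler_sum => j _.
  rewrite cov_xi// (expect_fbm_increments fBm)//.
  have e01 k : 0 <= expR (- (k%:R / n%:R) : R) <= 1.
    by rewrite expR_ge0 expR_le1 oppr_le0 divr_ge0.
  by apply: weight_le.
have -> : n%:R `^ (- delta) = n%:R `^ (2 * H - 1) * n%:R^-1 `^ kappa :> R.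
  rewrite -powR_inv1 ?ltW// -powRrM -powRD; last by apply/implyP => _; rewrite gt_eqF.
  by congr (_ `^ _); rewrite /delta; ring.
have K0 : 0 <= n%:R `^ (2 * H - 1) * 3 * M by rewrite mulr_ge0 ?mulr_ge0.
have in0 : 0 <= n%:R^-1 :> R by rewrite invr_ge0.
move: dq'; rewrite (powRM kappa (expR_ge0 _) in0) => /(ler_wpM2l K0) h.
rewrite [leLHS](_ : _ = n%:R `^ (2 * H - 1) * 3 * M * (q i.+1 - q i) `^ kappa); last by field.
apply: le_trans h _; rewrite le_eqVlt; apply/orP; left; apply/eqP; ring.
Qed.

Let dev t n w := \sum_(i < N t n) xi n i w ^+ 2 - tau t n.

Let dev_ae_bounded t : 0 <= t -> exists2 m, (0 < m)%N &
  {ae P, forall w, exists M, forall k, \sum_(n < k) dev t n.+1 w ^+ (m * 2) <= M}.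
Proof.
move=> t0; have [C C0 hC] := row t0.
have [am _ _ _] := fbm_gaussian_space fBm.
(* The moment bound decays like n^{-delta m}; this choice makes it at most n^{-2}, which is
   summable. *)
pose m := (Num.truncn (2 / delta)).+1.
have dm : 2 <= delta * m%:R.
  by rewrite mulrC -ler_pdivrMr//; apply/ltW/truncnS_gt.
have [K K0 hK] := @expect_quad_le R m.
(* Since n^{-delta} <= 1 and tau <= t e^2, one has rho (rho + tau) <= A n^{-delta} for rho = C
   n^{-delta}. *)
pose A := C * (C + t * expR 2).
have A0 : 0 <= A by rewrite mulr_ge0 ?addr_ge0 ?mulr_ge0 ?expR_ge0.
exists m => //; apply: (@ae_bounded_series _ _ _ _ (fun n w => dev t n.+1 w ^+ (m * 2)) (K * A ^+ m * 2)).
- move=> n; apply: all_momentsX; apply: all_momentsB; last exact: all_moments_cst.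
  by apply: all_moments_sum => i; apply/all_momentsX/am.
- by move=> n w; rewrite exprM sqr_ge0.
move=> k; apply: (@le_trans _ _ (\sum_(n < k) K * A ^+ m * (n.+1%:R ^+ 2)^-1)); last first.
  rewrite -mulr_sumr; apply: ler_wpM2l; last exact: sum_inv_sqr_le.
  by rewrite mulr_ge0 ?exprn_ge0.
apply: ler_sum => n _; set x : R := n.+1%:R.
have x1 : 1 <= x by rewrite ler1n.
have x0 : 0 < x by rewrite (lt_le_trans _ x1).
have xd0 : 0 <= x `^ (- delta) by exact: powR_ge0.
have xd1 : x `^ (- delta) <= 1.
  by rewrite -(powRr0 x); apply: ler_powR => //; rewrite oppr_le0 ltW.
have tau_ge0 : 0 <= tau t n.+1.
  by apply: sumr_ge0 => i _; apply: expect_ge0 => w; rewrite -expr2 sqr_ge0.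
have tau_le : tau t n.+1 <= t * expR 2.
  rewrite tauE//; have /andP[h1 h2] := @nh_bounds n.+1 isT.
  have /andP[_ h4] := @N_bounds t n.+1 t0 isT.
  apply: ler_pM; rewrite ?divr_ge0 ?(le_trans _ h1)//.
  by rewrite (le_trans h2)// ler_expR ler_pdivrMr// ler_peMr.
have rho0 : 0 <= C * x `^ (- delta) by rewrite mulr_ge0.
apply: le_trans (hK _ _ _ _ (fbm_gaussian_space fBm) _ (fun i : 'I__ => xi n.+1 i) _
  (fun i => xi_mem n.+1 i) rho0 (@hC n.+1 isT) _ erefl) _.
rewrite -[leRHS]mulrA; apply: ler_wpM2l => //.
apply: (@le_trans _ _ ((A * x `^ (- delta)) ^+ m)).
  apply: lerXn2r; rewrite ?nnegrE; [by rewrite mulr_ge0 ?addr_ge0|exact: mulr_ge0|].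
  rewrite /A [leRHS]mulrAC; apply: ler_wpM2l => //; apply: lerD => //.
  exact: ler_piMr.
rewrite exprMn; apply: ler_wpM2l; first exact: exprn_ge0.
have -> : (x `^ (- delta)) ^+ m = x `^ (- delta * m%:R) by rewrite powRrM powR_mulrn.
have -> : (x ^+ 2)^-1 = x `^ (- 2%:R) by rewrite powR_invn// ltW.
by apply: ler_powR => //; rewrite mulNr lerN2.
Qed.

Lemma fbm_weighted_qv_cvg (t : R) : 0 <= t ->
  {ae P, forall w,
    \sum_(i < Num.truncn (n.+1%:R * t)) (n.+1%:R : R) `^ (2 * H - 1) *
      (expR (- (i%:R / n.+1%:R)) * dg n.+1 i w) ^+ 2 @[n --> \oo] --> t}.
Proof.
move=> t0; have [m m0 h] := dev_ae_bounded t0.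
apply: filterS h => w [M hM].
have dev0 n : 0 <= dev t n.+1 w ^+ (m * 2) by rewrite exprM sqr_ge0.
have /cvgrPdist_lt h0 := bounded_series_cvg0 dev0 hM.
have {}h0 : dev t n.+1 w @[n --> \oo] --> (0 : R).
  apply/cvgrPdist_lt => e e0; have := h0 _ (exprn_gt0 (m * 2) e0).
  apply: filterS => n; rewrite !sub0r !normrN normrX.
  by rewrite ltr_pXn2r ?nnegrE ?muln_gt0 ?m0// ltW.
have h1 := cvgD h0 (tau_cvg t0); rewrite add0r in h1.
rewrite (_ : (fun n : nat => _) = (fun n => dev t n.+1 w + tau t n.+1)); first exact: h1.
apply/funext => n; rewrite /dev subrK; apply: eq_bigr => i _.
by rewrite /xi -(sqr_pow (ltn0Sn n)); ring.
Qed.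

End fbm_quadratic_variation.

(** * Hoelder continuity of the paths *)

Section chaining.
Context {R : realType}.
Implicit Types (f : R -> R) (x s t : R) (j k : nat).

Let p j x : R := (Num.truncn (2 ^+ j * x))%:R / 2 ^+ j.

Let p2_gt0 j : 0 < 2 ^+ j :> R. Proof. exact: exprn_gt0. Qed.

Let p_bounds j x : 0 <= x -> p j x <= x < p j x + (2 ^+ j)^-1.
Proof.
move=> x0; have h : 0 <= 2 ^+ j * x by rewrite mulr_ge0// ltW.
have /andP[h1 h2] := truncn_itv h; rewrite /p ler_pdivrMr// (mulrC x) h1/=.
by rewrite -[X in _ + X]mul1r -mulrDl natr1 ltr_pdivlMr// mulrC.
Qed.

Let nat_between (a b : nat) : (a <= b)%N -> (b <= a.+1)%N -> b = a \/ b = a.+1.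
Proof. lia. Qed.

(** Kolmogorov-Chentsov chaining. The points s and t are joined through their dyadic roundings from
    level k on: one step at level k, and two geometric tails of ratio r. This is the constant 1 +
    2/(1 - r). Continuity closes the tails at s and t. *)
Lemma dyadic_chaining f (r K : R) :
  {within `[0, 1], continuous f} -> 0 < r < 1 -> 0 <= K ->
  (forall k i, (i < 2 ^ k)%N ->
     `|f (i.+1%:R / 2 ^+ k) - f (i%:R / 2 ^+ k)| <= K * r ^+ k) ->
  forall s t k, 0 <= s <= t -> t <= 1 -> t - s <= (2 ^+ k)^-1 ->
    `|f t - f s| <= K * (1 + 2 / (1 - r)) * r ^+ k.
Proof.
move=> cf /andP[r0 r1] K0 hK.
have r1' : 0 < 1 - r by rewrite subr_gt0.
(* The integer part of 2y is either twice that of y or one more, so refining the rounding moves it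
   by at most one cell of the finer grid. *)
have step j x : 0 <= x <= 1 -> `|f (p j.+1 x) - f (p j x)| <= K * r ^+ j.+1.
  move=> /andP[x0 x1].
  set a := Num.truncn (2 ^+ j * x); set b := Num.truncn (2 ^+ j.+1 * x).
  have h : 0 <= 2 ^+ j * x by rewrite mulr_ge0// ltW.
  have h' : 0 <= 2 ^+ j.+1 * x by rewrite mulr_ge0// ltW.
  have /andP[a1 a2] := truncn_itv h; have /andP[b1 b2] := truncn_itv h'.
  rewrite -/a -/b in a1 a2 b1 b2.
  rewrite exprS -mulrA in b1 b2.
  have ab : (a * 2 <= b)%N.
    rewrite -ltnS -(ltr_nat R) natrM (le_lt_trans _ b2)//.
    by rewrite mulrC ler_pM2l.
  have ba : (b <= (a * 2).+1)%N.
    rewrite -ltnS -(ltr_nat R) (le_lt_trans b1)//.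
    rewrite (_ : (a * 2).+2 = 2 * a.+1)%N; last by rewrite (mulnC 2) mulSn.
    by rewrite natrM ltr_pM2l.
  have pa : p j x = (a * 2)%N%:R / 2 ^+ j.+1.
    by rewrite /p -/a natrM exprS; field; rewrite gt_eqF.
  have [ab'|ab'] := nat_between ab ba.
    rewrite pa /p -/b ab' subrr normr0 mulr_ge0// exprn_ge0// ltW//.
  rewrite pa /p -/b ab'; apply: hK.
  have b3 : b%:R <= 2 ^+ j.+1 :> R.
    by rewrite (le_trans b1)// exprS ler_pM2l// ler_piMr// ltW.
  by rewrite -natrX ler_nat ab' in b3.
have tele j l x : 0 <= x <= 1 ->
    `|f (p (j + l)%N x) - f (p j x)| <= K * r ^+ j * (1 / (1 - r)).
  move=> x01.
  suff : `|f (p (j + l)%N x) - f (p j x)| <= K * r ^+ j * ((1 - r ^+ l) / (1 - r)).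
    move=> /le_trans; apply; apply: ler_wpM2l.
      by rewrite mulr_ge0// exprn_ge0// ltW.
    by rewrite ler_pM2r ?invr_gt0// gerBl exprn_ge0// ltW.
  elim: l => [|l IH]; first by rewrite addn0 !subrr normr0 mul0r mulr0.
  rewrite -[X in `|X|](subrKA (f (p (j + l)%N x))) addnS.
  apply: le_trans (ler_normD _ _) _; apply: le_trans (lerD (step _ _ x01) IH) _.
  have -> : K * r ^+ j * ((1 - r ^+ l.+1) / (1 - r)) =
     K * r ^+ (j + l) + K * r ^+ j * ((1 - r ^+ l) / (1 - r)).
    by rewrite exprD exprS; field; rewrite gt_eqF.
  rewrite lerD2r ler_wpM2l// exprSr ler_piMr ?(ltW r1)// exprn_ge0// ltW//.
have lim j x : 0 <= x <= 1 -> `|f x - f (p j x)| <= K * r ^+ j * (1 / (1 - r)).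
  move=> x01; have /andP[x0 x1] := x01.
  apply/ler_addgt0Pr => e e0.
  have px l : `[0, 1]%classic (p l x).
    have /andP[h1 h2] := p_bounds l x0; rewrite /= in_itv/= (le_trans h1 x1) andbT.
    by rewrite divr_ge0// ltW.
  move/subspace_continuousP : cf => /(_ x); rewrite /= in_itv/= x01 => /(_ isT) cfx.
  have := cfx; move=> /cvgrPdist_lt/(_ _ e0)/nbhs_ballP[de /= de0 hde].
  have [l hl] : exists l, (2 ^+ (j + l))^-1 < de.
    exists (Num.truncn de^-1).
    rewrite invf_plt ?posrE// (lt_le_trans (truncnS_gt _))//.
    rewrite -natrX ler_nat; apply: (@leq_trans (2 ^ (Num.truncn de^-1))).
      exact: ltn_expl.
    by rewrite leq_pexp2l// leq_addl.
  have /andP[h1 h2] := p_bounds (j + l) x0.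
  have h3 : `|f x - f (p (j + l)%N x)| < e.
    apply: hde; last exact: px.
    rewrite /ball/= ger0_norm ?subr_ge0//.
    by rewrite ltrBlDl (lt_trans h2)// ltrD2l.
  have h4 := tele j l x x01.
  have -> : f x - f (p j x) =
    (f (p (j + l)%N x) - f (p j x)) + (f x - f (p (j + l)%N x)) by ring.
  apply: le_trans (ler_normD _ _) _; apply: lerD; first exact: h4.
  exact: ltW.
move=> s t k /andP[s0 st] t1 tsk.
have s1 : s <= 1 by exact: le_trans t1.
have t0 : 0 <= t by exact: le_trans st.
have hs := lim k s; have ht := lim k t; rewrite s0 s1 in hs; rewrite t0 t1 in ht.
have {hs} hs := hs isT; have {ht} ht := ht isT.
(* As t - s is at most one cell of level k, the roundings of s and t are equal or neighbours. *)
have mid : `|f (p k t) - f (p k s)| <= K * r ^+ k.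
  set a := Num.truncn (2 ^+ k * s); set b := Num.truncn (2 ^+ k * t).
  have h : 0 <= 2 ^+ k * s by rewrite mulr_ge0// ltW.
  have h' : 0 <= 2 ^+ k * t by rewrite mulr_ge0// ltW.
  have /andP[a1 a2] := truncn_itv h; have /andP[b1 b2] := truncn_itv h'.
  rewrite -/a -/b in a1 a2 b1 b2.
  have ts' : 2 ^+ k * t <= 2 ^+ k * s + 1.
    have := ler_wpM2l (ltW (p2_gt0 k)) tsk; rewrite mulrBr mulfV ?gt_eqF//; lra.
  have ts'' : 2 ^+ k * s <= 2 ^+ k * t by rewrite ler_pM2l.
  have ab : (a <= b)%N by rewrite -ltnS -(ltr_nat R); lra.
  have ba : (b <= a.+1)%N.
    by rewrite -ltnS -(ltr_nat R); rewrite -[a.+2]addn1 natrD; lra.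
  have [ab'|ab'] := nat_between ab ba.
    by rewrite /p -/a -/b ab' subrr normr0 mulr_ge0// exprn_ge0// ltW.
  rewrite /p -/a -/b ab'; apply: hK.
  have b3 : b%:R <= 2 ^+ k :> R by rewrite (le_trans b1)// ler_piMr// ltW.
  by rewrite -natrX ler_nat ab' in b3.
have -> : f t - f s = (f t - f (p k t)) + (f (p k t) - f (p k s)) - (f s - f (p k s)) by ring.
apply: le_trans (ler_normB _ _) _.
apply: le_trans (lerD (le_trans (ler_normD _ _) (lerD ht mid)) hs) _.
by rewrite le_eqVlt; apply/orP; left; apply/eqP; field; rewrite gt_eqF.
Qed.

End chaining.

Section hoelder_paths.
Context {R : realType}.

Lemma dyadic_scale (x : R) : 0 < x <= 1 ->
  exists k, (2 ^+ k.+1)^-1 < x <= (2 ^+ k)^-1.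
Proof.
move=> /andP[x0 x1].
have ex : exists k, (2 ^+ k.+1)^-1 < x.
  exists (Num.truncn x^-1); rewrite invf_plt ?posrE// ?exprn_gt0//.
  rewrite (lt_le_trans (truncnS_gt _))// -natrX ler_nat.
  exact/ltnW/ltn_expl.
exists (ex_minn ex); case: ex_minnP => k -> hmin /=.
case: k hmin => [|k] hmin; first by rewrite expr0 invr1.
by rewrite leNgt; apply/negP => /hmin; rewrite ltnn.
Qed.

(** Chaining with ratio r = 2^{-alpha}, at the level k for which 2^{-k} is within a factor 2 of (t -
    s)/T; this factor and the rescaling by T produce (2/T)^alpha. *)
Lemma dyadic_hoelder (f : R -> R) (T alpha K : R) : 0 < T -> 0 < alpha -> 0 <= K ->
  {within `[0, 1], continuous (fun x => f (T * x))} ->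
  (forall k i, (i < 2 ^ k)%N ->
     `|f (T * (i.+1%:R / 2 ^+ k)) - f (T * (i%:R / 2 ^+ k))| <= K * (2 ^+ k) `^ (- alpha)) ->
  hoelder_on `[0, T] alpha f.
Proof.
move=> T0 al0 K0 cf hK; pose r : R := 2 `^ (- alpha).
have rk k : r ^+ k = (2 ^+ k) `^ (- alpha).
  by rewrite -powR_mulrn ?powR_ge0// -powRrM mulrC powRrM powR_mulrn.
have r01 : 0 < r < 1.
  rewrite powR_gt0//= /r powRN invf_lt1 ?powR_gt0//.
  by have /(gt0_ltr_powR al0) := ltr1n R 2; rewrite powR1; apply; rewrite ?nnegrE.
have hK' k i : (i < 2 ^ k)%N ->
    `|f (T * (i.+1%:R / 2 ^+ k)) - f (T * (i%:R / 2 ^+ k))| <= K * r ^+ k.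
  by rewrite rk; exact: hK.
have chain := dyadic_chaining cf r01 K0 hK'.
pose C := K * (1 + 2 / (1 - r)).
have C0 : 0 <= C.
  by case/andP: r01 => r0 r1; rewrite mulr_ge0// addr_ge0// divr_ge0// subr_ge0 ltW.
exists (C * (2 / T) `^ alpha).
suff main s t : 0 <= s <= t -> t <= T ->
    `|f t - f s| <= C * (2 / T) `^ alpha * (t - s) `^ alpha.
  move=> s t; rewrite /= !in_itv/= => /andP[s0 sT] /andP[t0 tT].
  have [st|/ltW ts] := leP s t.
    rewrite (distrC (f s)) (distrC s) (ger0_norm (_ : 0 <= t - s)) ?subr_ge0//.
    by apply: main => //; rewrite s0.
  by rewrite (ger0_norm (_ : 0 <= s - t)) ?subr_ge0//; apply: main => //; rewrite t0.
move=> /andP[s0 st] tT; have [->|ts] := eqVneq t s.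
  by rewrite subrr normr0 mulr_ge0 ?powR_ge0// mulr_ge0 ?powR_ge0.
have d0 : 0 < t - s by rewrite subr_gt0 lt_neqAle eq_sym ts.
have [|k /andP[k1 k2]] := @dyadic_scale ((t - s) / T).
  by rewrite divr_gt0//= ler_pdivrMr// mul1r; lra.
have := chain (s / T) (t / T) k.
rewrite !(mulrC T) !divfK ?gt_eqF//.
have -> : 0 <= s / T <= t / T by rewrite (divr_ge0 s0 (ltW T0)) ler_pM2r ?invr_gt0.
have -> : t / T <= 1 by rewrite ler_pdivrMr// mul1r.
rewrite -mulrBl k2 => /(_ isT isT isT) /le_trans; apply.
rewrite -/C -mulrA; apply: ler_wpM2l => //; rewrite rk.
have d1 : 0 <= 2 / T by rewrite divr_ge0// ltW.
have d2 := ltW d0; rewrite -(powRM alpha d1 d2).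
have -> : (2 ^+ k) `^ (- alpha) = (2 ^+ k)^-1 `^ alpha :> R.
  by rewrite -powR_inv1 ?exprn_ge0// -powRrM mulN1r.
have k20 : 0 <= (2 ^+ k)^-1 :> R by rewrite invr_ge0 exprn_ge0.
apply: (ge0_ler_powR (ltW al0)); rewrite ?nnegrE//; first exact: mulr_ge0.
have -> : (2 ^+ k)^-1 = 2 * (2 ^+ k.+1)^-1 :> R.
  by rewrite exprS; field; rewrite gt_eqF// exprn_gt0.
by rewrite -mulrA ler_pM2l// ltW// mulrC.
Qed.

Lemma sum_geometric_half_le N : \sum_(k < N) (2 ^+ k)^-1 <= 2 :> R.
Proof.
suff -> : \sum_(k < N) (2 ^+ k)^-1 = 2 - 2 * (2 ^+ N)^-1 :> R.
  by rewrite gerBl mulr_ge0// invr_ge0 exprn_ge0.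
elim: N => [|N IH]; first by rewrite big_ord0 expr0 invr1 mulr1 subrr.
by rewrite big_ord_recr/= IH exprS; field; rewrite gt_eqF// exprn_gt0.
Qed.

Lemma within_continuous_interior (A : set R) (f : R -> R) x :
  {within A, continuous f} -> nbhs x A -> {for x, continuous f}.
Proof.
move=> /subspace_continuousP cf Ax; have := cf x (nbhs_singleton Ax).
move=> /cvgrPdist_lt h; apply/cvgrPdist_lt => e /h.
by apply: filterS2 Ax => y Ay; exact.
Qed.

End hoelder_paths.

Section fbm_hoelder.
Context {R : realType} {d : measure_display} {Omega : measurableType d}.
Variable P : probability Omega R.
Variables (H : R) (B : R -> {RV P >-> R}).
Hypotheses (H_gt0 : 0 < H) (H_lt1 : H < 1).
Hypothesis fBm : fractional_brownian_motion H B.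

Local Notation "'E f" := (Rintegral P setT f) (at level 10, f at level 8).

Let a_ge0 s : 0 <= a_ H s. Proof. by apply/ltW/a_gt0. Qed.

Lemma fbm_path_continuous w s : {for s, continuous (fun s => B (a_ H s) w)}.
Proof.
have [_ _ _ cB] := fBm.
apply: (@continuous_comp _ _ _ (a_ H) (fun t => B t w)).
  apply: cvgM; first exact: cvg_cst.
  apply: continuous_cvg; first exact: continuous_expR.
  by apply: cvgM; [exact: cvg_id|exact: cvg_cst].
apply: (within_continuous_interior (cB w)).
have a0 := a_gt0 s H_gt0; apply/nbhs_ballP; exists (a_ H s) => //= y.
rewrite /ball/= in_itv/= andbT ltr_norml => /andP[_]; lra.
Qed.

Lemma fbm_increment_moment m s t : 0 <= s -> 0 <= t ->
  'E (fun w => (B t w - B s w) ^+ (m * 2)) =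
  \prod_(j < m) (j * 2).+1%:R * (`|t - s| `^ (2 * H)) ^+ m.
Proof.
move=> s0 t0; have gV := fbm_gaussian_space fBm.
rewrite (gaussian_space_moment_even gV m (fbm_span_increment B s0 t0)).
congr (_ * _ ^+ _).
transitivity ('E (fun w => (B t w - B s w) * (B t w - B s w))).
  by apply: eq_expect => w; rewrite expr2.
rewrite (expect_fbm_increments fBm)// !subrr normr0 powR0; last first.
  by rewrite mulf_neq0// gt_eqF.
by rewrite !subr0 (distrC s); field.
Qed.

(** Kolmogorov's criterion. [X k] adds the normalised 2m-th powers of all increments of level k. Its
    expectation is O(2^{-k}), so almost surely the [X k] are bounded uniformly in k, and hence so is
    each single increment. The clock costs a Lipschitz constant on [0, T]. *)
Lemma fbm_hoelder_ae (T alpha : R) : 0 < T -> 0 < alpha < H ->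
  {ae P, forall w, hoelder_on `[0, T] alpha (fun s => B (a_ H s) w)}.
Proof.
move=> T0 /andP[al0 alH]; have [am _ _ _] := fbm_gaussian_space fBm.
(* There are 2^k increments of level k, each contributing the power 2m (alpha - H) of 2^k; m (H -
   alpha) >= 1 makes this exponent at most -2. *)
pose m := (Num.truncn (H - alpha)^-1).+1.
have hm : 1 <= m%:R * (H - alpha).
  rewrite -ler_pdivrMr ?subr_gt0// div1r; exact/ltW/truncnS_gt.
pose x k : R := 2 ^+ k.
have x0 k : 0 < x k by exact: exprn_gt0.
have x1 k : 1 <= x k by rewrite exprn_ege1// ler1n.
pose dB k i w := B (a_ H (T * (i.+1%:R / x k))) w - B (a_ H (T * (i%:R / x k))) w.
have aB k i : all_moments P (dB k i) by apply/am/fbm_span_increment.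
pose X k w := \sum_(i < 2 ^ k) ((x k) `^ alpha * dB k i w) ^+ (m * 2).
pose c : R := \prod_(j < m) (j * 2).+1%:R.
have c0 : 0 <= c by apply: prodr_ge0.
pose D := (expR (T / H) * T) `^ (2 * H).
have D0 : 0 <= D by exact: powR_ge0.
have EX k : 'E (X k) <= c * D ^+ m * (x k)^-1.
  rewrite /X expect_sum; last by move=> i; apply/all_momentsX/all_momentsZ.
  have term (i : 'I_(2 ^ k)) :
      'E (fun w => ((x k) `^ alpha * dB k i w) ^+ (m * 2)) <=
      c * D ^+ m * (x k `^ (- (2 : R))).
    rewrite [leLHS](_ : _ = 'E (fun w => (x k `^ alpha) ^+ (m * 2) * dB k i w ^+ (m * 2))); last first.
      by apply: eq_expect => w; rewrite exprMn.
    rewrite expectZ; last exact: all_momentsX.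
    rewrite fbm_increment_moment// -/c.
    have hi : T * (i%:R / x k) <= T * (i.+1%:R / x k).
      by rewrite ler_pM2l// ler_pM2r ?invr_gt0// ler_nat.
    have hi' : T * (i.+1%:R / x k) <= T.
      by rewrite -[leRHS]mulr1 ler_pM2l// ler_pdivrMr// mul1r /x -natrX ler_nat.
    have := a_increment_le H_gt0 hi hi'.
    have -> : T * (i.+1%:R / x k) - T * (i%:R / x k) = T / x k.
      by rewrite -natr1; field; rewrite gt_eqF.
    rewrite ger0_norm ?subr_ge0 ?a_nondecreasing// => hl.
    set l := _ - _ in hl *.
    have l0 : 0 <= l by rewrite subr_ge0 a_nondecreasing.
    have lD : l `^ (2 * H) <= D * x k `^ (- (2 * H)).
      have h2 : 0 <= expR (T / H) * T by rewrite mulr_ge0 ?expR_ge0// ltW.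
      rewrite mulrA in hl.
      have H20 : 0 <= 2 * H by rewrite mulr_ge0// ltW.
      have ix0 : 0 <= (x k)^-1 by rewrite invr_ge0 ltW.
      apply: le_trans (ge0_ler_powR H20 _ _ hl) _; rewrite ?nnegrE//.
        exact: mulr_ge0.
      rewrite (powRM _ h2 ix0) -[(x k)^-1]powR_inv1; last exact: ltW.
      by rewrite -powRrM mulN1r lexx.
    apply: (@le_trans _ _ ((x k `^ alpha) ^+ (m * 2) * (c * (D * x k `^ (- (2 * H))) ^+ m))).
      apply: ler_wpM2l; first by rewrite exprn_ge0 ?powR_ge0.
      apply: ler_wpM2l => //; apply: lerXn2r; rewrite ?nnegrE ?powR_ge0//.
      by rewrite mulr_ge0 ?powR_ge0.
    have e1 : (x k `^ alpha) ^+ (m * 2) = x k `^ (alpha * (m%:R * 2)).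
      by rewrite -natrM powRrM powR_mulrn// powR_ge0.
    have e2 : (x k `^ (- (2 * H))) ^+ m = x k `^ (- (2 * H) * m%:R).
      by rewrite powRrM powR_mulrn// powR_ge0.
    rewrite exprMn e1 e2 [leLHS](_ : _ = c * D ^+ m *
      (x k `^ (alpha * (m%:R * 2)) * x k `^ (- (2 * H) * m%:R))); last by ring.
    apply: ler_wpM2l; first by rewrite mulr_ge0 ?exprn_ge0.
    rewrite -powRD; last by apply/implyP => _; rewrite gt_eqF.
    apply: ler_powR => //; move: hm; set q := m%:R; lra.
  apply: le_trans (ler_sum _ (fun i _ => term i)) _.
  rewrite sumr_const card_ord -[leLHS]mulr_natl natrX -/(x k).
  rewrite mulrCA; apply: ler_wpM2l; first by rewrite mulr_ge0 ?exprn_ge0.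
  have -> : x k `^ (- 2) = (x k ^+ 2)^-1 by rewrite powR_invn// ltW.
  by rewrite le_eqVlt; apply/orP; left; apply/eqP; field; rewrite gt_eqF.
have aX k : all_moments P (X k).
  by apply: all_moments_sum => i; apply/all_momentsX/all_momentsZ.
have X0 k w : 0 <= X k w by apply: sumr_ge0 => i _; rewrite exprM sqr_ge0.
have SX N : \sum_(k < N) 'E (X k) <= c * D ^+ m * 2.
  apply: le_trans (ler_sum _ (fun (k : 'I_N) _ => EX k)) _.
  rewrite -mulr_sumr ler_wpM2l//; last exact: sum_geometric_half_le.
  by rewrite mulr_ge0 ?exprn_ge0.
have := ae_bounded_series aX X0 SX.
apply: filterS => w [M hM].
(* Since K >= 1 and K >= M, also M <= K^{2m}; this bounds the 2m-th root of M by K. *)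
pose K := 1 + `|M|; have K1 : 1 <= K by rewrite lerDl.
have K0 : 0 <= K by rewrite (le_trans _ K1).
apply: (@dyadic_hoelder _ _ _ _ K T0 al0 K0).
  apply: continuous_subspaceT => y.
  apply: (@continuous_comp _ _ _ (fun y => T * y) (fun s => B (a_ H s) w)).
    by apply: cvgM; [exact: cvg_cst|exact: cvg_id].
  exact: fbm_path_continuous.
move=> k i ik; rewrite -/(x k) -/(dB k i w).
suff h : x k `^ alpha * `|dB k i w| <= K.
  by rewrite powRN ler_pdivlMr ?powR_gt0// mulrC.
have xa0 : 0 <= x k `^ alpha by exact: powR_ge0.
rewrite -(@ler_pXn2r _ (m * 2)) ?nnegrE ?mulr_ge0//.
apply: (@le_trans _ _ M); last first.
  apply: le_trans (ler_norm M) _; apply: (@le_trans _ _ K); first by rewrite lerDr.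
  by rewrite mulSn ler_eXnr.
apply: le_trans (hM k.+1); rewrite big_ord_recr/=.
rewrite -[leLHS]add0r; apply: lerD; first by apply: sumr_ge0 => j _.
rewrite /X (bigD1 (Ordinal ik))//= -[leLHS]addr0; apply: lerD; last first.
  by apply: sumr_ge0 => j _; rewrite exprM sqr_ge0.
by rewrite !exprMn (mulnC m) !(exprM _ 2) real_normK ?num_real.
Qed.

End fbm_hoelder.

(** * Young integration *)

Section rs_unique.
Context {R : realType}.
Implicit Types (f g : R -> R) (a b : R).

(** Without partitions of arbitrarily small mesh, [is_RS_integral] would hold vacuously for any
    value; uniqueness of the integral rests on their existence. Division points are strictly
    increasing, so [a = b] has the empty partition. *)
Lemma fine_partition a b delta : 0 < delta -> a <= b ->
  exists2 s, itv_partition a b s &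
    forall i, (i < size s)%N -> nth a (a :: s) i <= nth a s i < nth a (a :: s) i + delta.
Proof.
move=> d0; pose h := delta / 2.
have h0 : 0 < h by rewrite divr_gt0.
have hd : h < delta by rewrite /h; lra.
suff main n x : x <= b -> b - x <= n%:R * h -> exists2 s, itv_partition x b s &
    forall i, (i < size s)%N -> nth a (x :: s) i <= nth a s i < nth a (x :: s) i + delta.
  move=> ab; apply: (main (Num.truncn ((b - a) / h)).+1) => //.
  by rewrite -ler_pdivrMr//; apply/ltW/truncnS_gt.
elim: n x => [|n IH] x xb.
  rewrite mul0r => xb'; have -> : x = b by apply/eqP; rewrite eq_le xb/=; lra.
  by exists [::] => //; split.
move=> hn; have [xbh|xbh] := leP (b - x) h.
  have [->|xb'] := eqVneq x b; first by exists [::] => //; split.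
  have lt_xb : x < b by rewrite lt_neqAle xb'.
  exists [:: b]; first exact: itv_partition1.
  by case=> //= _; rewrite xb/=; lra.
have [||s [ps ls] hs] := IH (x + h); first by lra.
  by move: hn; rewrite -natr1 mulrDl mul1r; lra.
exists (x + h :: s); first by split => //=; rewrite ps andbT ltrDl.
case=> [_|i] /=; first by rewrite lerDl ltrD2l hd ltW.
exact: hs.
Qed.

Lemma is_RS_integral_unique f g a b I I' : a <= b ->
  is_RS_integral f g a b I -> is_RS_integral f g a b I' -> I = I'.
Proof.
move=> ab hI hI'; apply/eqP; rewrite -subr_eq0 -normr_le0.
apply/ler_addgt0Pr => e e0; rewrite add0r.
have e2 : 0 < e / 2 by rewrite divr_gt0.
have [d1 d10 h1] := hI _ e2; have [d2 d20 h2] := hI' _ e2.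
pose dd := Num.min d1 d2.
have dd0 : 0 < dd by rewrite lt_min d10.
have [s ps hs] := fine_partition dd0 ab.
pose xi i := nth a (a :: s) i.
have hh dl : dd <= dl -> forall i, (i < size s)%N ->
    nth a s i - nth a (a :: s) i < dl /\ nth a (a :: s) i <= xi i <= nth a s i.
  move=> ddl i /hs /andP[u v]; split; first by rewrite ltrBlDl (lt_le_trans v)// lerD2l.
  by rewrite /xi lexx.
have m1 : dd <= d1 by rewrite ge_min lexx.
have m2 : dd <= d2 by rewrite ge_min lexx orbT.
have := h1 s xi ps (hh _ m1); have := h2 s xi ps (hh _ m2).
set S := RS_sum _ _ _ _ _ => k2 k1.
have -> : I - I' = (S - I') - (S - I) by ring.
apply: le_trans (ler_normB _ _) _; rewrite (splitr e).
by apply: lerD; exact: ltW.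
Qed.

Lemma RS_integralE f g a b I : a <= b ->
  is_RS_integral f g a b I -> RS_integral f g a b = I.
Proof.
move=> ab hI; apply: xget_unique => // I' hI'; exact: (is_RS_integral_unique ab hI' hI).
Qed.

End rs_unique.

Section young.
Context {R : realType}.
Implicit Types (f g : R -> R).

Lemma powR_small (gamma eta : R) : 0 < gamma -> 0 < eta ->
  exists2 delta, 0 < delta & forall x, 0 <= x < delta -> x `^ gamma < eta.
Proof.
move=> g0 e0; exists (eta `^ gamma^-1); first exact: powR_gt0.
move=> x /andP[x0 xd].
have := gt0_ltr_powR g0 _ _ xd; rewrite !nnegrE x0 powR_ge0 => /(_ isT isT).
by rewrite -powRrM mulVf ?gt_eqF// powRr1 ?ltW.
Qed.

Variables (f g : R -> R) (T alpha beta C : R).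
Hypotheses (T_gt0 : 0 < T) (C_ge0 : 0 <= C) (ab_gt1 : 1 < alpha + beta).
Hypotheses (alpha_gt0 : 0 < alpha) (beta_gt0 : 0 < beta).
Local Notation theta := (alpha + beta).
(* Holds with C the product of the Hoelder constants of f and g. *)
Hypothesis fg_le : forall r s u v L, 0 <= r <= T -> 0 <= s <= T -> 0 <= u <= T -> 0 <= v <= T ->
  `|r - s| <= L -> `|u - v| <= L -> `|(f r - f s) * (g u - g v)| <= C * L `^ theta.

(** [K] is the fixed point of K = 2^{1-theta} K + 2C, the recursion produced by halving an interval
    ([K_eq]). It is finite and nonnegative because theta > 1. *)
Let kf := 2 `^ (1 - theta).
Let K := 2 * C / (1 - kf).

Let kf_lt1 : kf < 1.
Proof.
have l0 : 0 < theta - 1 by rewrite subr_gt0.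
rewrite /kf -opprB powRN invf_lt1 ?powR_gt0//.
by have := gt0_ltr_powR l0 _ _ (ltr1n R 2); rewrite powR1 !nnegrE; apply.
Qed.

Let K_ge0 : 0 <= K.
Proof. by rewrite divr_ge0 ?mulr_ge0// subr_ge0 ltW. Qed.

Let K_eq (x : R) : 0 <= x -> 2 * (K * (x / 2) `^ theta) + 2 * (C * x `^ theta) = K * x `^ theta.
Proof.
move=> x0; rewrite powRM// ?invr_ge0//.
have -> : 2^-1 `^ theta = kf / 2 :> R.
  have e1 : 2 `^ (1 - theta) = 2 / 2 `^ theta :> R.
    by rewrite powRB ?powRr1//; apply/implyP => _; rewrite pnatr_eq0.
  have e2 : 2^-1 `^ theta = (2 `^ theta)^-1 :> R.
    by rewrite -[2^-1]powR_inv1// -powRrM mulN1r powRN.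
  by rewrite /kf e1 e2; field; rewrite gt_eqF// powR_gt0.
by rewrite /K; field; rewrite gt_eqF// subr_gt0.
Qed.

(** Young's estimate by bisection. Cut after the last point [p j] in the left half: the parts before
    [p j] and after [p j.+1] have at most half the length and are treated by induction. The cell in
    between and the change of tag from [p 0] to [p j.+1] cost C L^theta each. *)
Lemma young_partition_le n (p : nat -> R) :
  (forall i, p i <= p i.+1) -> (forall i, 0 <= p i <= T) ->
  `|\sum_(0 <= i < n) f (p i) * (g (p i.+1) - g (p i)) - f (p 0%N) * (g (p n) - g (p 0%N))|
   <= K * (p n - p 0%N) `^ theta.
Proof.
elim/ltn_ind: n p => -[_|n IH] p pS pT.
  by rewrite big_geq// !subrr mulr0 subrr normr0 mulr_ge0 ?powR_ge0.
have ph i j : (i <= j)%N -> p i <= p j.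
  by move=> ij; rewrite -(subnKC ij); elim: (j - i)%N => [|k IHk]; rewrite ?addn0// addnS (le_trans IHk).
pose L := p n.+1 - p 0%N; have L0 : 0 <= L by rewrite subr_ge0 ph.
pose P j := (j < n.+1)%N && (p j - p 0%N <= L / 2).
have exP : exists j, P j by exists 0%N; rewrite /P/= subrr divr_ge0.
have ubP j : P j -> (j <= n)%N by case/andP.
have [j /andP[jn jL] jmax] := ex_maxnP exP ubP.
(* By maximality of [j] the point [p j.+1] lies in the right half, unless [j = n] and nothing
   remains. *)
have last_le : p n.+1 - p j.+1 <= L / 2.
  have [jn'|jn'] := ltnP j n.
    have := contraNN (jmax j.+1); rewrite ltnn => /(_ isT).
    by rewrite /P ltnS jn'/= -ltNge /L; lra.
  have -> : j = n by apply/eqP; rewrite eqn_leq jn' andbT -ltnS.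
  by rewrite subrr divr_ge0.
pose F i := f (p i) * (g (p i.+1) - g (p i)).
have IH1 := IH j jn p pS pT.
have jn2 : (n - j < n.+1)%N by rewrite ltnS leq_subr.
have IH2 := IH (n - j)%N jn2 (fun i => p (i + j.+1)%N) (fun i => pS (i + j.+1)%N) (fun i => pT (i + j.+1)%N).
rewrite add0n (_ : (n - j + j.+1 = n.+1)%N) in IH2; last by rewrite addnS subnK.
have E : \sum_(0 <= i < n.+1) F i = \sum_(0 <= i < j) F i + F j +
    \sum_(0 <= i < n - j) f (p (i + j.+1)%N) * (g (p (i.+1 + j.+1)%N) - g (p (i + j.+1)%N)).
  rewrite (big_cat_nat (n := j.+1))//=.
  rewrite big_nat_recr//=; congr (_ + _).
  by rewrite -{1}[j.+1]add0n big_addn subSS.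
rewrite -/(F _) E; set S1 := \sum_(0 <= i < j) _ in IH1 E *; set S2 := \sum_(0 <= i < n - j) _ in IH2 E *.
pose A := S1 - f (p 0%N) * (g (p j) - g (p 0%N)).
pose D := S2 - f (p j.+1) * (g (p n.+1) - g (p j.+1)).
have -> : S1 + F j + S2 - f (p 0%N) * (g (p n.+1) - g (p 0%N)) =
   A + (f (p j) - f (p 0%N)) * (g (p j.+1) - g (p j)) + D +
   (f (p j.+1) - f (p 0%N)) * (g (p n.+1) - g (p j.+1)).
  by rewrite /A /D /F; ring.
have dist i k : (k <= i)%N -> (i <= n.+1)%N -> `|p i - p k| <= L.
  move=> ki iN; rewrite ger0_norm ?subr_ge0 ?ph//.
  by have := ph _ _ iN; have := ph 0%N k (leq0n _); rewrite /L; lra.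
have b1 : `|(f (p j) - f (p 0%N)) * (g (p j.+1) - g (p j))| <= C * L `^ theta.
  by apply: fg_le => //; apply: dist => //; exact: ltnW.
have b2 : `|(f (p j.+1) - f (p 0%N)) * (g (p n.+1) - g (p j.+1))| <= C * L `^ theta.
  by apply: fg_le => //; apply: dist.
have th0 : 0 <= theta by rewrite addr_ge0 ?ltW.
have hA : `|A| <= K * (L / 2) `^ theta.
  apply: le_trans IH1 _; apply: ler_wpM2l => //.
  by apply: ge0_ler_powR; rewrite ?nnegrE ?subr_ge0 ?ph ?divr_ge0.
have hD : `|D| <= K * (L / 2) `^ theta.
  apply: le_trans IH2 _; apply: ler_wpM2l => //.
  by apply: ge0_ler_powR; rewrite ?nnegrE ?subr_ge0 ?ph ?divr_ge0.
rewrite -/L -(K_eq L0).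
apply: le_trans (ler_normD _ _) _; apply: le_trans (lerD (ler_normD _ _) (lexx _)) _.
apply: le_trans (lerD (lerD (ler_normD _ _) (lexx _)) (lexx _)) _.
lra.
Qed.

Let q n i : R := T * (i%:R / n.+1%:R).
(** Riemann sums over a regular grid stopped at [t]. Clipping the grid points, with tags kept on the
    full grid, gives one function on [0, T] for each n, whose increments are again Riemann sums. *)
Let J n t := \sum_(0 <= i < n.+1) f (q n i) * (g (Num.min (q n i.+1) t) - g (Num.min (q n i) t)).

Let q_itv n i : (i <= n.+1)%N -> 0 <= q n i <= T.
Proof.
move=> iN; apply/andP; split; first by rewrite mulr_ge0 ?divr_ge0// ltW.
by rewrite -[leRHS]mulr1 ler_pM2l// ler_pdivrMr// mul1r ler_nat.
Qed.

Let qS n i : q n i <= q n i.+1.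
Proof. by rewrite ler_pM2l// ler_pM2r ?invr_gt0// ler_nat. Qed.

Let q_mesh n i : q n i.+1 - q n i = T / n.+1%:R.
Proof. by rewrite /q -mulrBr -mulrBl -natrB// subSnn mul1r. Qed.

(** Clipping the grid to [u, v] reduces the increment to [young_partition_le]. The mesh term pays
    for the tag that lies left of u. *)
Let J_increment_le n u v : 0 <= u -> u <= v -> v <= T ->
  `|J n v - J n u - f u * (g v - g u)| <=
  K * (v - u) `^ theta + C * (T / n.+1%:R) `^ theta.
Proof.
move=> u0 uv vT.
pose c i := Num.max u (Num.min (q n i) v).
have cS i : c i <= c i.+1.
  by rewrite /c; case: (leP (q n i) v); case: (leP (q n i.+1) v);
     have := qS n i => ? ? ?; rewrite !le_max !ge_max; lra.
have c_itv i : 0 <= c i <= T.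
  by rewrite /c le_max u0/= ge_max (le_trans uv vT)/= ge_min vT orbT.
have c0 : c 0%N = u by rewrite /c /q mul0r mulr0 min_l ?max_l// (le_trans u0).
have cN : c n.+1 = v.
  by rewrite /c /q divff ?pnatr_eq0// mulr1 min_r// max_r.
have gc x : g (Num.min x v) - g (Num.min x u) = g (Num.max u (Num.min x v)) - g u.
  have [xu|ux] := leP x u.
    by rewrite (min_l (le_trans xu uv)) (max_l xu) !subrr.
  by rewrite max_r// le_min (ltW ux) uv.
have -> : J n v - J n u = \sum_(0 <= i < n.+1) f (q n i) * (g (c i.+1) - g (c i)).
  rewrite /J -sumrB; apply: eq_bigr => i _; rewrite -mulrBr; congr (_ * _).
  have := gc (q n i); have := gc (q n i.+1); rewrite -/(c i) -/(c i.+1) => h1 h2.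
  lra.
have := young_partition_le n.+1 cS c_itv; rewrite c0 cN.
set S := \sum_(0 <= i < _) _ => hS.
rewrite [X in `|X - _|](_ : _ = S + \sum_(0 <= i < n.+1) (f (q n i) - f (c i)) * (g (c i.+1) - g (c i))); last first.
  by rewrite /S -big_split; apply: eq_bigr => i _ /=; ring.
rewrite addrAC; apply: le_trans (ler_normD _ _) _; apply: lerD => //.
apply: le_trans (ler_norm_sum _ _ _) _.
pose b i : R := (q n i < u)%R%:R.
(* The grid interval containing u is the only one where the tag differs. *)
apply: (@le_trans _ _ (\sum_(0 <= i < n.+1) C * (T / n.+1%:R) `^ theta * (b i - b i.+1))); last first.
  rewrite -mulr_sumr ler_piMr ?mulr_ge0 ?powR_ge0//.
  rewrite (eq_bigr (fun i => (- b i.+1) - (- b i))); last by move=> i _; ring.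
  have b01 i : 0 <= b i <= 1 by rewrite /b; case: ltP; rewrite ?lexx ?ler01.
  rewrite telescope_sumr//.
  by have /andP[] := b01 n.+1; have /andP[] := b01 0%N; lra.
rewrite big_nat [leRHS]big_nat; apply: ler_sum => i /andP[_ iN].
have qi := q_itv (ltnW iN); have qi1 := q_itv iN.
have := qS n i => qq; have mesh := q_mesh n i.
have hm : 0 <= T / n.+1%:R by rewrite divr_ge0// ltW.
have X0 : 0 <= C * (T / n.+1%:R) `^ theta by rewrite mulr_ge0 ?powR_ge0.
have bb : 0 <= b i - b i.+1.
  by rewrite /b; case: (ltP (q n i) u); case: (ltP (q n i.+1) u) => /= h1 h2; rewrite ?subrr ?subr0 ?ler01//; lra.
have zero : c i.+1 = c i -> `|(f (q n i) - f (c i)) * (g (c i.+1) - g (c i))| <=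
   C * (T / n.+1%:R) `^ theta * (b i - b i.+1).
  by move=> ->; rewrite subrr mulr0 normr0 mulr_ge0.
have [qu|uq] := ltP (q n i) u; last first.
  have [qv|vq] := leP (q n i) v.
    have -> : c i = q n i by rewrite /c min_l// max_r.
    by rewrite subrr mul0r normr0 mulr_ge0.
  apply: zero; rewrite /c (min_r (ltW vq)) min_r//.
  exact: le_trans (ltW vq) qq.
have ci : c i = u by rewrite /c min_l ?max_l// ltW// (lt_le_trans qu).
have [qu1|uq1] := ltP (q n i.+1) u.
  by apply: zero; rewrite ci /c min_l ?max_l// ltW// (lt_le_trans qu1).
rewrite /b qu ltNge uq1/= subr0 mulr1.
apply: fg_le; [exact: qi|exact: c_itv|exact: c_itv|exact: c_itv| |].
  by rewrite ci ltr0_norm ?subr_lt0// opprB -mesh lerD2r.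
have ciu : c i.+1 - u <= T / n.+1%:R.
  rewrite -mesh lerB ?(ltW qu)// /c ge_max uq1 ge_min lexx//.
by rewrite ci ger0_norm// subr_ge0 /c le_max lexx.
Qed.

Let err_small (e : R) : 0 < e -> \forall n \near \oo, C * (T / n.+1%:R) `^ theta < e.
Proof.
move=> e0; have th0 : 0 < theta by rewrite addr_gt0.
have eC : 0 < e / (C + 1) by rewrite divr_gt0// ltr_wpDl.
have [delta d0 hd] := powR_small th0 eC.
exists (Num.truncn (T / delta)) => // n /= hn.
have : (T / n.+1%:R) `^ theta < e / (C + 1).
  apply: hd; rewrite divr_ge0 ?(ltW T_gt0)//= ltr_pdivrMr// mulrC -ltr_pdivrMr//.
  by rewrite (lt_le_trans (truncnS_gt _))// ler_nat ltnS.
rewrite ltr_pdivlMr; last by rewrite ltr_wpDl.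
have := powR_ge0 (T / n.+1%:R) theta; nra.
Qed.

Let block_small (e : R) : 0 < e -> exists N : nat, N.+1%:R * (2 * K * (T / N.+1%:R) `^ theta) < e.
Proof.
move=> e0; have th1 : 0 < theta - 1 by rewrite subr_gt0.
pose A := 2 * K * T + 1.
have KT0 : 0 <= 2 * K * T by rewrite mulr_ge0 ?(ltW T_gt0)// mulr_ge0.
have A0 : 0 < A by rewrite ltr_wpDl.
have [delta d0 hd] := powR_small th1 (divr_gt0 e0 A0).
pose N := Num.truncn (T / delta); exists N.
have : (T / N.+1%:R) `^ (theta - 1) < e / A.
  apply: hd; rewrite divr_ge0 ?(ltW T_gt0)//= ltr_pdivrMr// mulrC -ltr_pdivrMr//.
  exact: truncnS_gt.
have N0 : 0 <= T / N.+1%:R by rewrite divr_ge0// ltW.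
have th0 : 0 < theta by rewrite addr_gt0.
rewrite -(mulr_powRB1 N0 th0); set y := (_ `^ _) => hy.
have -> : N.+1%:R * (2 * K * (T / N.+1%:R * y)) = 2 * K * T * y.
  have : N.+1%:R != 0 :> R by rewrite pnatr_eq0.
  by set z := N.+1%:R => z0; field.
have y0 : 0 <= y by exact: powR_ge0.
by move: hy; rewrite ltr_pdivlMr// /A; nra.
Qed.

(** Two of these functions have the same local increment f(u) (g(v) - g(u)) up to 2K (v-u)^theta and
    mesh terms. Summed over N+1 blocks the first error is small for a suitable N because theta > 1;
    with N fixed, the mesh terms, each at most e/4/(N+1), add up to e/2. *)
Let J_cauchy t : 0 <= t <= T -> cvgn (J ^~ t).
Proof.
move=> /andP[t0 tT]; apply/cauchy_cvgP/cauchy_exP => e e0.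
have [N hN] := block_small (divr_gt0 e0 (ltr0n R 2) : 0 < e / 2).
have e4 : 0 < e / 4 / N.+1%:R by rewrite !divr_gt0.
have [n0 _ hn0] := err_small e4.
exists (J n0 t); exists n0 => // n /= hn.
rewrite /ball/=.
have bound k l u v : 0 <= u -> u <= v -> v <= T -> (n0 <= k)%N -> (n0 <= l)%N ->
   `|(J k v - J l v) - (J k u - J l u)| <= 2 * K * (v - u) `^ theta + 2 * (e / 4 / N.+1%:R).
  move=> u0 uv vT hk hl.
  have h1 := J_increment_le k u0 uv vT; have h2 := J_increment_le l u0 uv vT.
  have h3 : C * (T / k.+1%:R) `^ theta <= e / 4 / N.+1%:R := ltW (hn0 k hk).
  have h4 : C * (T / l.+1%:R) `^ theta <= e / 4 / N.+1%:R := ltW (hn0 l hl).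
  have -> : (J k v - J l v) - (J k u - J l u) =
    (J k v - J k u - f u * (g v - g u)) - (J l v - J l u - f u * (g v - g u)) by ring.
  apply: le_trans (ler_normB _ _) _; apply: le_trans (lerD h1 h2) _.
  set y := (v - u) `^ theta; move: h3 h4.
  set z1 := (T / k.+1%:R) `^ theta; set z2 := (T / l.+1%:R) `^ theta; set z3 := e / 4 / _.
 lra.
pose D x := J n0 x - J n x.
have D0 : D 0 = 0.
  have z k : J k 0 = 0.
    rewrite /J big_nat big1// => i /andP[_ ik].
    have /andP[h1 _] := q_itv (ltnW ik); have /andP[h2 _] := q_itv ik.
    by rewrite !min_r// subrr mulr0.
  by rewrite /D !z subrr.
pose x i := t * (i%:R / N.+1%:R).
have -> : J n0 t - J n t = \sum_(0 <= i < N.+1) (D (x i.+1) - D (x i)).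
  by rewrite telescope_sumr// /x mul0r mulr0 D0 subr0 divff ?pnatr_eq0// mulr1.
apply: (@le_lt_trans _ _ (\sum_(0 <= i < N.+1) (2 * K * (T / N.+1%:R) `^ theta + 2 * (e / 4 / N.+1%:R)))).
  apply: le_trans (ler_norm_sum _ _ _) _.
  rewrite big_nat [leRHS]big_nat; apply: ler_sum => i /andP[_ iN].
  have x0 : 0 <= x i by rewrite mulr_ge0// divr_ge0.
  have xx : x i <= x i.+1 by rewrite ler_wpM2l// ler_pM2r ?invr_gt0// ler_nat.
  have xT : x i.+1 <= T.
    by rewrite (le_trans _ tT)// ler_piMr// ler_pdivrMr// mul1r ler_nat.
  apply: le_trans (bound n0 n _ _ x0 xx xT (leqnn _) hn) _.
  rewrite lerD2r; apply: ler_wpM2l; first by rewrite mulr_ge0.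
  apply: ge0_ler_powR; rewrite ?nnegrE ?subr_ge0 ?divr_ge0 ?(ltW T_gt0)//.
    by rewrite addr_ge0 ?ltW.
  rewrite /x -mulrBr -mulrBl -natrB// subSnn mul1r.
  by rewrite ler_wpM2r ?invr_ge0.
rewrite big_const_nat subn0 iter_addr_0 -[ltLHS]mulr_natl mulrDr.
have -> : N.+1%:R * (2 * (e / 4 / N.+1%:R)) = e / 2.
  have : N.+1%:R != 0 :> R by rewrite pnatr_eq0.
  by set z := N.+1%:R => z0; field.
lra.
Qed.

Lemma young_sewing : exists I : R -> R, I 0 = 0 /\
  forall u v, 0 <= u -> u <= v -> v <= T ->
    `|I v - I u - f u * (g v - g u)| <= K * (v - u) `^ theta.
Proof.
exists (fun t => limn (J ^~ t)); split.
  have z k : J k 0 = 0.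
    rewrite /J big_nat big1// => i /andP[_ ik].
    have /andP[h1 _] := q_itv (ltnW ik); have /andP[h2 _] := q_itv ik.
    by rewrite !min_r// subrr mulr0.
  by under eq_fun do rewrite z; exact: lim_cst.
move=> u v u0 uv vT.
have cu : cvgn (J ^~ u) by apply: J_cauchy; rewrite u0 (le_trans uv).
have cv : cvgn (J ^~ v) by apply: J_cauchy; rewrite vT (le_trans u0).
have cc : `|J n v - J n u - f u * (g v - g u)| @[n --> \oo] -->
   `|limn (J ^~ v) - limn (J ^~ u) - f u * (g v - g u)|.
  by apply: cvg_norm; apply: cvgB; [exact: cvgB|exact: cvg_cst].
have cK : K * (v - u) `^ theta + C * (T / n.+1%:R) `^ theta @[n --> \oo] -->
   K * (v - u) `^ theta.
  rewrite -[X in _ --> X]addr0; apply: cvgD; first exact: cvg_cst.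
  apply/cvgrPdist_lt => e e0; have := err_small e0; apply: filterS => n.
  by rewrite sub0r normrN ger0_norm// mulr_ge0 ?powR_ge0.
rewrite -(cvg_lim _ cc)// -(cvg_lim _ cK)//; apply: ler_lim.
- by apply/cvg_ex; eexists; exact: cc.
- by apply/cvg_ex; eexists; exact: cK.
- by apply: nearW => n; exact: J_increment_le.
Qed.

(** On a cell of length h the error is at most (K + C) h^theta, where C covers an arbitrary tag. For
    a fine mesh this is a small multiple of h, and the lengths add up to t. *)
Lemma sewing_is_RS_integral (I : R -> R) t : I 0 = 0 ->
  (forall u v, 0 <= u -> u <= v -> v <= T ->
    `|I v - I u - f u * (g v - g u)| <= K * (v - u) `^ theta) ->
  0 <= t <= T -> is_RS_integral f g 0 t (I t).
Proof.
move=> I0 hI /andP[t0 tT] e e0.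
have th1 : 0 < theta - 1 by rewrite subr_gt0.
have th0 : 0 < theta by rewrite addr_gt0.
pose A := (K + C) * T + 1.
have A0 : 0 < A by rewrite ltr_wpDl// mulr_ge0 ?(ltW T_gt0)// addr_ge0.
have [delta d0 hd] := powR_small th1 (divr_gt0 e0 A0).
exists delta => // s xi ps hs.
pose x i := nth 0 (0 :: s) i.
have xS i : nth 0 s i = x i.+1 by [].
have x_itv i : (i <= size s)%N -> 0 <= x i <= T.
  move=> iS; rewrite /x (set_nth_default t)//=.
  rewrite (itv_partition_nth_ge _ ps) ?ltnS//=.
  by rewrite (le_trans _ tT)// (itv_partition_nth_le _ ps) ?ltnS.
have IE : I t = \sum_(0 <= i < size s) (I (x i.+1) - I (x i)).
  by rewrite telescope_sumr// /x (itv_partition_nth_size _ ps) I0 subr0.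
rewrite /RS_sum IE -sumrB.
have tE : t = \sum_(0 <= i < size s) (x i.+1 - x i).
  by rewrite telescope_sumr// /x (itv_partition_nth_size _ ps) subr0.
apply: (@le_lt_trans _ _ (\sum_(0 <= i < size s) (K + C) * (e / A) * (x i.+1 - x i))).
  apply: le_trans (ler_norm_sum _ _ _) _.
  rewrite big_nat [leRHS]big_nat; apply: ler_sum => i /andP[_ iN].
  have [] := hs i iN; rewrite xS -/(x i) => hm /andP[h1 h2].
  have xi0 := x_itv i (ltnW iN); have xi1 := x_itv i.+1 iN.
  have xx : x i <= x i.+1 by exact: le_trans h2.
  have dx : 0 <= x i.+1 - x i by rewrite subr_ge0.
  have /andP[xi00 xi0T] := xi0; have /andP[xi10 xi1T] := xi1.
  have xit : 0 <= xi i <= T by rewrite (le_trans xi00)//= (le_trans h2).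
  have b1 := hI _ _ xi00 xx xi1T.
  have b2 : `|(f (xi i) - f (x i)) * (g (x i.+1) - g (x i))| <= C * (x i.+1 - x i) `^ theta.
    by apply: fg_le => //; rewrite ger0_norm ?subr_ge0//; lra.
  have -> : f (xi i) * (g (x i.+1) - g (x i)) - (I (x i.+1) - I (x i)) =
    (f (xi i) - f (x i)) * (g (x i.+1) - g (x i)) -
    (I (x i.+1) - I (x i) - f (x i) * (g (x i.+1) - g (x i))) by ring.
  apply: le_trans (ler_normB _ _) _; apply: le_trans (lerD b2 b1) _.
  have : (x i.+1 - x i) `^ (theta - 1) < e / A by apply: hd; rewrite dx.
  rewrite -(mulr_powRB1 dx th0) => /ltW hh.
  have := ler_wpM2l (mulr_ge0 (addr_ge0 K_ge0 C_ge0) dx) hh; lra.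
rewrite -mulr_sumr -tE (_ : _ * t = (K + C) * t * e / A); last by ring.
rewrite ltr_pdivrMr// (mulrC e) ltr_pM2r//.
have := ler_wpM2l (addr_ge0 K_ge0 C_ge0) tT; rewrite /A; lra.
Qed.

End young.

Lemma young_integral {R : realType} (f g : R -> R) (T alpha beta : R) :
  0 < T -> 0 < alpha -> 0 < beta -> 1 < alpha + beta ->
  hoelder_on `[0, T] beta f -> hoelder_on `[0, T] alpha g ->
  exists2 K : R, 0 <= K & RS_integral f g 0 0 = 0 /\
  forall u v, 0 <= u -> u <= v -> v <= T ->
    `|RS_integral f g 0 v - RS_integral f g 0 u - f u * (g v - g u)|
      <= K * (v - u) `^ (alpha + beta).
Proof.
move=> T0 al0 be0 ab1 [Cf hf] [Cg hg].
pose C := `|Cf| * `|Cg|.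
have fg r s u v L : 0 <= r <= T -> 0 <= s <= T -> 0 <= u <= T -> 0 <= v <= T ->
    `|r - s| <= L -> `|u - v| <= L ->
    `|(f r - f s) * (g u - g v)| <= C * L `^ (alpha + beta).
  move=> hr hs hu hv rsL uvL; have L0 : 0 <= L by exact: le_trans rsL.
  rewrite normrM (addrC alpha) powRD; last by rewrite gt_eqF// addr_gt0.
  have pow_le gam y : 0 < gam -> 0 <= y -> y <= L -> y `^ gam <= L `^ gam.
    by move=> gam0 y0; apply: ge0_ler_powR; rewrite ?nnegrE// ltW.
  rewrite /C mulrACA; apply: ler_pM => //.
    have hr' : `[0, T]%classic r by rewrite /= in_itv.
    have hs' : `[0, T]%classic s by rewrite /= in_itv.
    apply: le_trans (hf r s hr' hs') _.
    apply: le_trans (ler_wpM2r (powR_ge0 _ _) (ler_norm _)) _.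
    by apply: ler_wpM2l => //; apply: pow_le.
  have hu' : `[0, T]%classic u by rewrite /= in_itv.
  have hv' : `[0, T]%classic v by rewrite /= in_itv.
  apply: le_trans (hg u v hu' hv') _.
  apply: le_trans (ler_wpM2r (powR_ge0 _ _) (ler_norm _)) _.
  by apply: ler_wpM2l => //; apply: pow_le.
have C0 : 0 <= C by rewrite mulr_ge0.
have [I [I0 hI]] := young_sewing T0 C0 ab1 al0 be0 fg.
set K := 2 * C / _ in hI.
(* The sign of [K] is read off from the estimate itself on the whole of [0, T]. *)
have K0 : 0 <= K.
  have := le_trans (normr_ge0 _) (hI 0 T (lexx _) (ltW T0) (lexx _)).
  by rewrite pmulr_lge0// powR_gt0// subr0.
have IE t : 0 <= t <= T -> RS_integral f g 0 t = I t.
  move=> tT; have /andP[t0 _] := tT; apply: RS_integralE => //.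
  exact: (sewing_is_RS_integral T0 C0 ab1 al0 be0 fg).
exists K => //; split; first by rewrite IE ?lexx ?ltW.
by move=> u v u0 uv vT; rewrite !IE ?u0 ?vT ?(le_trans u0) ?(le_trans uv)//; exact: hI.
Qed.

(** * Uniform convergence *)

Section integral_increments.
Context {R : realType}.
Local Notation mu := (@lebesgue_measure R).
Implicit Types (f : R -> R) (T c M u v t : R).

Lemma Rintegral_increment f T u v : mu.-integrable `[0, T] (EFin \o f) ->
  0 <= u -> u <= v -> v <= T ->
  \int[mu]_(s in `[0, v]) f s - \int[mu]_(s in `[0, u]) f s = \int[mu]_(s in `]u, v]) f s.
Proof.
move=> fi u0 uv vT; apply: Rintegral_itvB; rewrite ?bnd_simp//.
by apply: integrableS fi => //; apply: subset_itvl; rewrite bnd_simp.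
Qed.

Lemma Rintegral_increment_le f T c M u v : mu.-integrable `[0, T] (EFin \o f) ->
  0 <= u -> u <= v -> v <= T -> (forall s, u <= s <= v -> `|f s - c| <= M) ->
  `|\int[mu]_(s in `[0, v]) f s - \int[mu]_(s in `[0, u]) f s - c * (v - u)| <= M * (v - u).
Proof.
move=> fi u0 uv vT fM; rewrite (Rintegral_increment fi)//.
have fin : (mu `]u, v] < +oo)%E by rewrite lebesgue_measure_itv/= lte_fin; case: ifP; rewrite ltry.
have ci k : mu.-integrable `]u, v] (EFin \o cst k).
  apply/integrableP; split; first exact/measurable_EFinP/measurable_cst.
  under eq_integral do rewrite /=.
  by rewrite integral_cst//= lte_mul_pinfty.
have cE k : \int[mu]_(s in `]u, v]) k = k * (v - u).
  rewrite Rintegral_cst//= lebesgue_measure_itv/= lte_fin.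
  by case: ltP => [//|vu]; rewrite (le_anti (introT andP (conj uv vu))) subrr.
have fi' : mu.-integrable `]u, v] (EFin \o f).
  apply: integrableS fi => // s /=; rewrite !in_itv/= => /andP[us sv].
  by rewrite (le_trans u0 (ltW us)) (le_trans sv).
rewrite -cE -(RintegralB _ fi' (ci c))//.
have fci : mu.-integrable `]u, v] (EFin \o (fun s => f s - c)).
  by rewrite (_ : _ \o _ = ((EFin \o f) \- (EFin \o cst c))%E)//; exact: integrableB.
apply: le_trans (le_normr_Rintegral _ fci) _ => //.
rewrite -cE; apply: le_Rintegral => //; [exact: integrable_norm|exact: ci|].
by move=> s /=; rewrite in_itv/= => /andP[us sv]; apply: fM; rewrite ltW.
Qed.

Lemma Rintegral_bounded f T : mu.-integrable `[0, T] (EFin \o f) ->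
  exists M, forall t, 0 <= t <= T -> `|\int[mu]_(s in `[0, t]) f s| <= M.
Proof.
move=> fi; exists (\int[mu]_(s in `[0, T]) `|f s|) => t /andP[t0 tT].
have fi' : mu.-integrable `[0, t] (EFin \o f).
  by apply: integrableS fi => //; apply: subset_itvl; rewrite bnd_simp.
apply: le_trans (le_normr_Rintegral _ fi') _ => //.
have fn : mu.-integrable `[0, T] (EFin \o (fun s => `|f s|)) by exact: integrable_norm.
rewrite -subr_ge0 (Rintegral_increment fn)//.
exact: Rintegral_ge0.
Qed.

End integral_increments.

Section uniform_monotone.
Context {R : realType}.

Lemma uniform_cvg_itv (T : R) (F : nat -> R -> R) (G : R -> R) :
  (forall e, 0 < e -> exists n0, forall n, (n0 <= n)%N ->
     forall t, 0 <= t <= T -> `|G t - F n t| < e) ->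
  {uniform `[0, T], F @ \oo --> G}.
Proof.
move=> h P /uniform_nbhs[E [entE EP]].
move: entE; rewrite -entourage_ballE => -[e /= e0 eE].
have [n0 hn0] := h e e0.
exists n0 => // n /= hn; apply: EP => t /=; rewrite in_itv/= => tT.
by apply: eE; rewrite /= /ball/=; exact: hn0.
Qed.

Lemma eventually_all (P : nat -> nat -> Prop) (K : nat) :
  (forall k, (k <= K)%N -> exists n0, forall n, (n0 <= n)%N -> P k n) ->
  exists n0, forall n, (n0 <= n)%N -> forall k, (k <= K)%N -> P k n.
Proof.
elim: K => [|K IH] h.
  have [n0 hn0] := h 0%N isT; exists n0 => n hn k; rewrite leqn0 => /eqP ->.
  exact: hn0.
have [n1 hn1] := IH (fun k kK => h k (leqW kK)).
have [n2 hn2] := h K.+1 (leqnn _).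
exists (maxn n1 n2) => n; rewrite geq_max => /andP[h1 h2] k.
rewrite leq_eqVlt => /predU1P[->|]; first exact: hn2.
by rewrite ltnS; exact: hn1.
Qed.

(** Between neighbouring grid points monotonicity squeezes [F n], while [G] varies by at most L
    T/(M+1) < e/2; so closeness at finitely many points suffices. *)
Lemma uniform_cvg_nondecreasing (T L : R) (F : nat -> R -> R) (G : R -> R) :
  0 < T -> 0 <= L ->
  (forall n s t, 0 <= s -> s <= t -> F n s <= F n t) ->
  (forall s t, 0 <= s -> s <= t -> t <= T -> 0 <= G t - G s <= L * (t - s)) ->
  (forall M k, (k <= M.+1)%N ->
     F n (T * (k%:R / M.+1%:R)) @[n --> \oo] --> G (T * (k%:R / M.+1%:R))) ->
  {uniform `[0, T], F @ \oo --> G}.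
Proof.
move=> T0 L0 Fmono Gmono cvgFG; apply: uniform_cvg_itv => e e0.
pose M := Num.truncn (L * T / (e / 2)).
have e2 : 0 < e / 2 by rewrite divr_gt0.
have hM : L * (T / M.+1%:R) < e / 2.
  by rewrite mulrA ltr_pdivrMr// (mulrC (e / 2)) -ltr_pdivrMr// truncnS_gt.
pose x k : R := T * (k%:R / M.+1%:R).
have [k kM|n0 hn0] := @eventually_all (fun k n => `|G (x k) - F n (x k)| < e / 2) M.+1.
  have /cvgrPdist_lt/(_ _ e2)[n0 _ hn0] := cvgFG M k kM.
  by exists n0 => n hn; exact: hn0.
exists n0 => n hn t /andP[t0 tT].
have x0 k : 0 <= x k by rewrite mulr_ge0 ?divr_ge0// ltW.
have xN : x M.+1 = T by rewrite /x divff ?pnatr_eq0// mulr1.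
pose k := Num.truncn (t / T * M.+1%:R).
have tk0 : 0 <= t / T * M.+1%:R by rewrite mulr_ge0// divr_ge0// ltW.
have /andP[k1 k2] := truncn_itv tk0; rewrite -/k in k1 k2.
have nz : 1 + M%:R != 0 :> R by rewrite nat1r pnatr_eq0.
have xk : x k <= t.
  have -> : t = T * (t / T * M.+1%:R / M.+1%:R) by field; rewrite nz gt_eqF.
  by rewrite ler_pM2l// ler_pM2r ?invr_gt0.
have kS : t < x k.+1.
  have -> : t = T * (t / T * M.+1%:R / M.+1%:R) by field; rewrite nz gt_eqF.
  by rewrite ltr_pM2l// ltr_pM2r ?invr_gt0.
(* The index reaches [M.+1] only for t = T, which is a grid point itself. *)
have [kM|Mk] := leqP k.+1 M.+1; last first.
  have tE : t = T.
    apply/eqP; rewrite eq_le tT/= (le_trans _ xk)// -xN /x ler_pM2l//.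
    by rewrite ler_pM2r ?invr_gt0// ler_nat -ltnS.
  rewrite tE -xN; apply: lt_trans (hn0 n hn M.+1 (leqnn _)) _; lra.
have xS : x k.+1 - x k = T / M.+1%:R.
  by rewrite /x -mulrBr -mulrBl -natrB// subSnn mul1r.
have xT : x k.+1 <= T by rewrite -xN /x ler_pM2l// ler_pM2r ?invr_gt0// ler_nat.
have f1 := Fmono n _ _ (x0 k) xk; have f2 := Fmono n _ _ t0 (ltW kS).
have /andP[g1 _] := Gmono _ _ (x0 k) xk tT.
have /andP[g2 _] := Gmono _ _ t0 (ltW kS) xT.
have /andP[_ g3] := Gmono _ _ (x0 k) (ltW (le_lt_trans xk kS)) xT; rewrite xS in g3.
have h1 : `|G (x k) - F n (x k)| < e / 2 := hn0 n hn k (ltnW kM).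
have h2 : `|G (x k.+1) - F n (x k.+1)| < e / 2 := hn0 n hn k.+1 kM.
move: h1 h2; rewrite !ltr_norml => /andP[a1 a2] /andP[b1 b2].
move: f1 f2 g1 g2 g3 hM a1 a2 b1 b2; set d := _ * (T / _).
by move=> *; apply/andP; split; lra.
Qed.

End uniform_monotone.

(** * Weighted sums by Riemann approximation *)

Section weighted_sums.
Context {R : realType}.
Local Notation mu := (@lebesgue_measure R).
Variables (eta : nat -> nat -> R) (w : R -> R) (t : R).
Hypotheses (eta_ge0 : forall n i, 0 <= eta n i) (t_ge0 : 0 <= t).
Local Notation N n x := (Num.truncn (n.+1%:R * x)).
Local Notation S n x := (\sum_(0 <= i < N n x) eta n i).
Local Notation W n x := (\sum_(0 <= i < N n x) w (i%:R / n.+1%:R) * eta n i).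
Local Notation x M k := (t * (k%:R / M.+1%:R)).
Hypothesis S_cvg : forall M k, (k <= M.+1)%N -> S n (x M k) @[n --> \oo] --> x M k.
Hypothesis w_uc : forall e, 0 < e -> exists2 delta, 0 < delta &
  forall r s, 0 <= r <= t -> 0 <= s <= t -> `|r - s| < delta -> `|w r - w s| <= e.
Hypothesis w_int : mu.-integrable `[0, t] (EFin \o w).

Let x_ge0 M k : 0 <= x M k. Proof. by rewrite mulr_ge0 ?divr_ge0. Qed.

Let x_le M k : (k <= M.+1)%N -> x M k <= t.
Proof. by move=> kM; rewrite ler_piMr// ler_pdivrMr// mul1r ler_nat. Qed.

Let xS M k : x M k.+1 - x M k = t / M.+1%:R.
Proof. by rewrite -mulrBr -mulrBl -natrB// subSnn mul1r. Qed.

Let x_mono M k : x M k <= x M k.+1.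
Proof. by rewrite -subr_ge0 xS divr_ge0. Qed.

Let xN M : x M M.+1 = t.
Proof. by rewrite divff ?pnatr_eq0// mulr1. Qed.

Let x0 M : x M 0%N = 0. Proof. by rewrite mul0r mulr0. Qed.

Let block_le n M k e delta : 0 < delta -> (k < M.+1)%N ->
  t / M.+1%:R < delta -> n.+1%:R^-1 < delta ->
  (forall r s, 0 <= r <= t -> 0 <= s <= t -> `|r - s| < delta -> `|w r - w s| <= e) ->
  `|(W n (x M k.+1) - W n (x M k)) - w (x M k) * (S n (x M k.+1) - S n (x M k))|
    <= e * (S n (x M k.+1) - S n (x M k)).
Proof.
move=> d0 kM hM hn hw.
have n0 : 0 < n.+1%:R :> R by [].
have u0 : 0 <= n.+1%:R * x M k by rewrite mulr_ge0.
have v0 : 0 <= n.+1%:R * x M k.+1 by rewrite mulr_ge0.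
have /andP[a1 a2] := truncn_itv u0; have /andP[b1 b2] := truncn_itv v0.
have ab : (N n (x M k) <= N n (x M k.+1))%N.
  by apply: le_truncn; rewrite ler_pM2l// x_mono.
move: a1 a2 b1 b2 ab; set a := N n (x M k); set b := N n (x M k.+1) => a1 a2 b1 b2 ab.
have cat (F : nat -> R) : \sum_(0 <= i < b) F i - \sum_(0 <= i < a) F i = \sum_(a <= i < b) F i.
  by rewrite (big_cat_nat (n := a))//= addrAC subrr add0r.
rewrite !cat !mulr_sumr -sumrB; apply: le_trans (ler_norm_sum _ _ _) _.
rewrite big_nat [leRHS]big_nat; apply: ler_sum => i /andP[ai ib].
rewrite -mulrBl normrM (ger0_norm (eta_ge0 _ _)) ler_wpM2r//.
have h1 : i%:R / n.+1%:R <= x M k.+1.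
  rewrite ler_pdivrMr// mulrC (le_trans _ b1)// ler_nat; exact: ltnW.
(* The indices of a block begin at an integer part, so the first node may lie left of [x M k] by up
   to one fine step; hence the second smallness condition. *)
have h2 : x M k - n.+1%:R^-1 <= i%:R / n.+1%:R.
  rewrite ler_pdivlMr// mulrBl mulVf ?gt_eqF// lerBlDr natr1 mulrC.
  by rewrite (le_trans (ltW a2))// ler_nat.
apply: hw.
- by rewrite divr_ge0//= (le_trans h1)// x_le.
- by rewrite x_ge0 x_le// ltnW.
- move: h1 h2 (xS M k) hM hn; rewrite ltr_norml.
  set y := x M k; set z := x M k.+1; set r := _ / n.+1%:R; set m := t / _; set j := _^-1.
  by move=> *; apply/andP; split; lra.
Qed.

(** The masses [eta n i] placed at the nodes converge to Lebesgue measure on coarse intervals.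
    Freezing [w] on a coarse grid compares the sum with [A n], then with its limit [B], then with
    the integral. *)
Lemma weighted_sum_cvg : W n t @[n --> \oo] --> \int[mu]_(s in `[0, t]) w s.
Proof.
pose F r := \int[mu]_(s in `[0, r]) w s.
have F0 : F 0 = 0 by rewrite /F set_itv1 Rintegral_set1.
apply/cvgrPdist_le => e e0.
(* The errors are e1 t, e/2 and e1 (t + 1), the last because the total mass is eventually at most t
   + 1; they add up to e. *)
pose e1 := e / (2 * (2 * t + 1)).
have D0 : 0 < 2 * (2 * t + 1) by rewrite mulr_gt0// ltr_wpDl// mulr_ge0.
have e10 : 0 < e1 by rewrite divr_gt0.
have [delta d0 hw] := w_uc e10.
pose M := Num.truncn (t / delta).
have hM : t / M.+1%:R < delta.
  by rewrite ltr_pdivrMr// mulrC -ltr_pdivrMr// truncnS_gt.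
pose A n := \sum_(0 <= k < M.+1) w (x M k) * (S n (x M k.+1) - S n (x M k)).
pose B := \sum_(0 <= k < M.+1) w (x M k) * (x M k.+1 - x M k).
have cA : A n @[n --> \oo] --> B.
  suff h K : (K <= M.+1)%N ->
      \sum_(0 <= k < K) w (x M k) * (S n (x M k.+1) - S n (x M k)) @[n --> \oo] -->
      \sum_(0 <= k < K) w (x M k) * (x M k.+1 - x M k) by exact: h.
  elim: K => [_|K IH KM].
    by rewrite big_geq//; under eq_fun do rewrite big_geq//; exact: cvg_cst.
  rewrite big_nat_recr//=; under eq_fun do rewrite big_nat_recr//=.
  apply: cvgD; first exact/IH/ltnW.
  apply: cvgM; first exact: cvg_cst.
  by apply: cvgB; apply: S_cvg => //; exact: ltnW.
have BF : `|F t - B| <= e1 * t.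
  have FE : F t = \sum_(0 <= k < M.+1) (F (x M k.+1) - F (x M k)).
    by rewrite (telescope_sumr (fun k => F (x M k)))// x0 F0 subr0 xN.
  have tE : t = \sum_(0 <= k < M.+1) (x M k.+1 - x M k).
    by rewrite (telescope_sumr (fun k => x M k))// x0 subr0 xN.
  rewrite FE /B -sumrB [X in _ <= e1 * X]tE mulr_sumr.
  apply: le_trans (ler_norm_sum _ _ _) _.
  rewrite big_nat [leRHS]big_nat; apply: ler_sum => k /andP[_ kM].
  apply: (Rintegral_increment_le w_int) => //; first exact: x_le.
  move=> s /andP[ks sk]; apply: hw.
  - by rewrite (le_trans (x_ge0 M k) ks) (le_trans sk)// x_le.
  - by rewrite x_ge0 x_le// ltnW.
  - move: (xS M k) hM ks sk; rewrite ltr_norml; set y := x M k; set z := x M k.+1; set m := t / _.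
    by move=> *; apply/andP; split; lra.
have e20 : 0 < e / 2 by rewrite divr_gt0.
have St : S n t @[n --> \oo] --> t by have := @S_cvg 0%N 1%N isT; rewrite divff// mulr1.
near=> n.
have hn : n.+1%:R^-1 < delta.
  near: n; exists (Num.truncn delta^-1) => // n /= hn.
  by rewrite invf_plt ?posrE// (lt_le_trans (truncnS_gt _))// ler_nat ltnS.
have AB : `|B - A n| <= e / 2 by near: n; move/cvgrPdist_le : cA; exact.
have Sn : `|t - S n t| <= 1 by near: n; move/cvgrPdist_le : St; apply.
have WA : `|W n t - A n| <= e1 * S n t.
  have W0 : W n (x M 0%N) = 0 by rewrite x0 mulr0 truncn0 big_geq.
  have S0 : S n (x M 0%N) = 0 by rewrite x0 mulr0 truncn0 big_geq.
  have WE : W n t = \sum_(0 <= k < M.+1) (W n (x M k.+1) - W n (x M k)).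
    by rewrite (telescope_sumr (fun k => W n (x M k)))// W0 subr0 xN.
  have SE : S n t = \sum_(0 <= k < M.+1) (S n (x M k.+1) - S n (x M k)).
    by rewrite (telescope_sumr (fun k => S n (x M k)))// S0 subr0 xN.
  rewrite WE SE /A -sumrB mulr_sumr.
  apply: le_trans (ler_norm_sum _ _ _) _.
  rewrite big_nat [leRHS]big_nat; apply: ler_sum => k /andP[_ kM].
  exact: (block_le d0).
rewrite -/(F t).
have -> : F t - W n t = (F t - B) + (B - A n) - (W n t - A n) by ring.
apply: le_trans (ler_normB _ _) _.
apply: le_trans (lerD (le_trans (ler_normD _ _) (lerD BF AB)) WA) _.
have Sn1 : S n t <= t + 1 by move: Sn; rewrite ler_norml => /andP[]; lra.
have := ler_wpM2l (ltW e10) Sn1.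
have : e1 * (2 * t + 1) = e / 2 by rewrite /e1; field; rewrite ?gt_eqF//; lra.
lra.
Unshelve. all: by end_near. Qed.

End weighted_sums.

(** * Increments of the solution along a fixed path *)

Section pathwise.
Context {R : realType}.
Local Notation mu := (@lebesgue_measure R).
Implicit Types (f g sigma x : R -> R).

Lemma hoelder_on_bounds f T beta : 0 < T -> 0 < beta -> hoelder_on `[0, T] beta f ->
  exists2 C : R, 0 <= C &
    (forall s t, 0 <= s <= T -> 0 <= t <= T -> `|f s - f t| <= C * `|s - t| `^ beta) /\
    (forall s, 0 <= s <= T -> `|f s| <= C).
Proof.
move=> T0 be0 [C hC]; pose D := `|f 0| + `|C| * T `^ beta + `|C|.
have CD : `|C| <= D by rewrite lerDr addr_ge0// mulr_ge0// powR_ge0.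
have hf s t : 0 <= s <= T -> 0 <= t <= T -> `|f s - f t| <= `|C| * `|s - t| `^ beta.
  move=> hs ht; apply: le_trans (hC s t _ _) _; rewrite /= ?in_itv//.
  by rewrite ler_wpM2r ?powR_ge0// ler_norm.
exists D; first by rewrite (le_trans _ CD).
split=> [s t hs ht|s hs].
  by apply: le_trans (hf s t hs ht) _; rewrite ler_wpM2r ?powR_ge0.
have h0 : 0 <= (0 : R) <= T by rewrite lexx ltW.
have := hf s 0 hs h0; rewrite subr0 => h.
have -> : f s = f 0 + (f s - f 0) by ring.
apply: le_trans (ler_normD _ _) _; rewrite /D -addrA lerD2l (le_trans h)//.
rewrite -[leLHS]addr0 lerD// ler_wpM2l//.
case/andP: hs => s0 sT.
by apply: ge0_ler_powR; rewrite ?nnegrE ?normr_ge0 ?(ltW T0) ?(ltW be0)// ger0_norm.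
Qed.

Lemma powR_le_linear (T gamma y : R) : 1 <= gamma -> 0 <= y -> y <= T ->
  y `^ gamma <= T `^ (gamma - 1) * y.
Proof.
move=> g1 y0 yT.
rewrite -(@mulr_powRB1 _ y) ?(lt_le_trans ltr01)// mulrC ler_wpM2r//.
by apply: ge0_ler_powR; rewrite ?nnegrE ?subr_ge0// (le_trans y0).
Qed.

Lemma hoelder_on_expRN (T : R) : hoelder_on `[0, T] 1 (fun s : R => expR (- s)).
Proof.
exists 1 => s t; rewrite /= !in_itv/= => /andP[s0 _] /andP[t0 _].
rewrite mul1r powRr1//.
suff main (u v : R) : 0 <= u -> u <= v -> `|expR (- u) - expR (- v)| <= v - u.
  have [st|/ltW ts] := leP s t.
    by rewrite [leRHS]distrC (ger0_norm (_ : 0 <= t - s)) ?subr_ge0//; exact: main.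
  by rewrite distrC (ger0_norm (_ : 0 <= s - t)) ?subr_ge0//; exact: main.
move=> u0 uv; rewrite ger0_norm; last by rewrite subr_ge0 ler_expR lerN2.
have := expR_sub1_le (v - u).
have e1 : expR (- u) <= 1 by rewrite expR_le1 oppr_le0.
have e2 : expR (- v) = expR (- u) * expR (- (v - u)) by rewrite -expRD; congr expR; ring.
have := expR_ge1Dx (- (v - u)); rewrite e2.
have := expR_gt0 (- u); set a := expR (- u) in e1 e2 *; set b := expR (- (v - u)).
move=> a0 hb _.
have : a * (1 - b) <= 1 * (v - u).
  apply: ler_pM; [exact: ltW| |by []|by lra].
  by rewrite subr_ge0 /b expR_le1 oppr_le0 subr_ge0.
lra.
Qed.

(** Young's estimate is used twice: for [Y] against [g] with exponent alpha + 1, which also shows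
    that [Y] inherits the exponent alpha, and for [sigma] against [Y] with exponent alpha + beta.
    Both exponents exceed 1, so the errors are linear in v - u, as is the drift. *)
Lemma solution_increment_le (theta T x0 alpha beta : R) (sigma g x : R -> R) :
  0 < T -> 0 < alpha -> 0 < beta -> 1 < alpha + beta ->
  hoelder_on `[0, T] alpha g -> hoelder_on `[0, T] beta sigma ->
  is_solution theta T x0 sigma (RS_integral (fun s => expR (- s)) g 0) x ->
  exists2 K : R, 0 <= K & forall u v, 0 <= u -> u <= v -> v <= T ->
    `|x v - x u - sigma u * expR (- u) * (g v - g u)| <= K * (v - u).
Proof.
move=> T0 al0 be0 ab1 hg hs [xi xE].
set Y := RS_integral _ g 0 in xE.
have al1 : 1 < alpha + 1 by rewrite ltrDr.
have [K1 K10 [Y0 hY]] := young_integral T0 al0 ltr01 al1 (hoelder_on_expRN T) hg.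
have [Cg Cg0 [hg1 hg2]] := hoelder_on_bounds T0 al0 hg.
have [Cs Cs0 [hs1 hs2]] := hoelder_on_bounds T0 be0 hs.
have itv u v : 0 <= u -> u <= v -> v <= T -> (0 <= u <= T) /\ (0 <= v <= T).
  by move=> u0 uv vT; rewrite u0 vT (le_trans uv)// (le_trans u0).
have Yinc u v : 0 <= u -> u <= v -> v <= T ->
    `|Y v - Y u| <= (K1 * T + Cg) * (v - u) `^ alpha.
  move=> u0 uv vT; have [hu hv] := itv u v u0 uv vT.
  have h1 := hY u v u0 uv vT; rewrite -/Y in h1.
  have h2 := hg1 v u hv hu.
  have vu0 : 0 <= v - u by rewrite subr_ge0.
  rewrite (ger0_norm vu0) in h2.
  have h3 : (v - u) `^ (alpha + 1) <= T * (v - u) `^ alpha.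
    rewrite powRD; last by rewrite gt_eqF// addr_gt0.
    rewrite powRr1// mulrC ler_wpM2r ?powR_ge0//; lra.
  have h4 : `|expR (- u) * (g v - g u)| <= Cg * (v - u) `^ alpha.
    rewrite normrM (ger0_norm (expR_ge0 _)); apply: (le_trans _ h2).
    by rewrite ler_piMl// expR_le1 oppr_le0.
  have -> : Y v - Y u = (Y v - Y u - expR (- u) * (g v - g u)) + expR (- u) * (g v - g u) by ring.
  apply: le_trans (ler_normD _ _) _; rewrite mulrDl; apply: lerD => //.
  apply: le_trans h1 _; rewrite -mulrA ler_wpM2l//.
have CY0 : 0 <= K1 * T + Cg by rewrite addr_ge0// mulr_ge0// ltW.
have hYh : hoelder_on `[0, T] alpha Y.
  exists (K1 * T + Cg) => s t; rewrite /= !in_itv/= => /andP[s0 sT] /andP[t0 tT].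
  have [st|/ltW ts] := leP s t.
    by rewrite distrC (distrC s) (ger0_norm (_ : 0 <= t - s)) ?subr_ge0//; exact: Yinc.
  by rewrite (ger0_norm (_ : 0 <= s - t)) ?subr_ge0//; exact: Yinc.
have [K2 K20 [Z0 hZ]] := young_integral T0 al0 be0 ab1 hs hYh.
set Z := RS_integral sigma Y 0 in Z0 hZ xE.
have [CY CY0' [hY1 hY2]] := hoelder_on_bounds T0 al0 hYh.
have [MI hMI] := Rintegral_bounded xi.
have Zbound t : 0 <= t <= T -> `|Z t| <= K2 * T `^ (alpha + beta) + Cs * (CY + CY).
  move=> tT; have /andP[t0 tT'] := tT.
  have h00 : 0 <= (0 : R) <= T by rewrite lexx ltW.
  have := hZ 0 t (lexx _) t0 tT'; rewrite Z0 !subr0 => h.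
  have -> : Z t = (Z t - sigma 0 * (Y t - Y 0)) + sigma 0 * (Y t - Y 0) by ring.
  apply: le_trans (ler_normD _ _) _; apply: lerD.
    apply: le_trans h _; apply: ler_wpM2l => //.
    by apply: ge0_ler_powR; rewrite ?nnegrE ?(ltW T0)// addr_ge0// ltW.
  rewrite normrM; apply: ler_pM => //; first exact: hs2.
  apply: le_trans (ler_normB _ _) _; apply: lerD; exact: hY2.
pose Mx := `|x0| + `|theta| * `|MI| + (K2 * T `^ (alpha + beta) + Cs * (CY + CY)).
(* [is_solution] provides integrability of [x] only; its boundedness, and with it the linear bound
   on the drift, comes from the equation. *)
have xbound t : 0 <= t <= T -> `|x t| <= Mx.
  move=> tT; rewrite (xE t tT) -/(Z t).
  apply: le_trans (ler_normD _ _) _; apply: lerD; last exact: Zbound.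
  apply: le_trans (ler_normB _ _) _; rewrite lerD2l normrM ler_wpM2l//.
  exact: le_trans (hMI t tT) (ler_norm _).
have Mx0 : 0 <= Mx.
  by apply: le_trans (xbound 0 _) => //; rewrite lexx ltW.
pose K := `|theta| * Mx + K2 * T `^ (alpha + beta - 1) + Cs * (K1 * T `^ (alpha + 1 - 1)).
exists K; first by rewrite !addr_ge0// !mulr_ge0// powR_ge0.
move=> u v u0 uv vT; have [hu hv] := itv u v u0 uv vT.
have vu0 : 0 <= v - u by rewrite subr_ge0.
have vuT : v - u <= T by lra.
have i1 : `|\int[mu]_(s in `[0, v]) x s - \int[mu]_(s in `[0, u]) x s| <= Mx * (v - u).
  have := @Rintegral_increment_le R x T 0 Mx u v xi u0 uv vT.
  rewrite mul0r subr0; apply=> s /andP[us sv]; rewrite subr0; apply: xbound.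
  by rewrite (le_trans u0 us) (le_trans sv).
have i2 : `|Z v - Z u - sigma u * (Y v - Y u)| <= K2 * T `^ (alpha + beta - 1) * (v - u).
  apply: le_trans (hZ u v u0 uv vT) _; rewrite -mulrA ler_wpM2l//.
  by apply: powR_le_linear => //; exact: ltW.
have i3 : `|sigma u * (Y v - Y u - expR (- u) * (g v - g u))| <=
    Cs * (K1 * T `^ (alpha + 1 - 1)) * (v - u).
  rewrite normrM -mulrA; apply: ler_pM => //; first exact: hs2.
  apply: le_trans (hY u v u0 uv vT) _; rewrite -mulrA ler_wpM2l//.
  by apply: powR_le_linear => //; exact: ltW.
have -> : x v - x u - sigma u * expR (- u) * (g v - g u) =
  - (theta * (\int[mu]_(s in `[0, v]) x s - \int[mu]_(s in `[0, u]) x s)) +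
  (Z v - Z u - sigma u * (Y v - Y u)) +
  sigma u * (Y v - Y u - expR (- u) * (g v - g u)).
  by rewrite (xE v hv) (xE u hu) -/(Z u) -/(Z v); ring.
apply: le_trans (ler_normD _ _) _; rewrite /K mulrDl; apply: lerD => //.
apply: le_trans (ler_normD _ _) _; rewrite mulrDl; apply: lerD => //.
by rewrite normrN normrM -mulrA ler_wpM2l.
Qed.

End pathwise.

(** * Quadratic variation of the solution along a fixed path *)

Section pathwise_qv.
Context {R : realType}.
Local Notation mu := (@lebesgue_measure R).
Variables (H T beta K : R) (sigma g x : R -> R).
Hypotheses (H_gt0 : 0 < H) (H_lt1 : H < 1) (T_gt0 : 0 < T) (beta_gt0 : 0 < beta).
Hypothesis K_ge0 : 0 <= K.
Hypothesis sigma_hoelder : hoelder_on `[0, T] beta sigma.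
Local Notation eta := (fun n i => n.+1%:R `^ (2 * H - 1) *
  (expR (- (i%:R / n.+1%:R)) * (g (i.+1%:R / n.+1%:R) - g (i%:R / n.+1%:R))) ^+ 2).
Local Notation w := (fun s => `|sigma s| ^+ 2).
Hypothesis g_qv : forall a b, (a <= b.+1)%N ->
  \sum_(i < Num.truncn (n.+1%:R * (T * (a%:R / b.+1%:R)))) eta n i @[n --> \oo]
    --> T * (a%:R / b.+1%:R).
Hypothesis x_increment : forall u v, 0 <= u -> u <= v -> v <= T ->
  `|x v - x u - sigma u * expR (- u) * (g v - g u)| <= K * (v - u).

(** From 2 |a r| <= e a^2 + r^2 / e: the cross term is charged partly to the main sum, which stays
    bounded, and partly to the remainder. *)
Let sqr_perturb (a r e : R) : 0 < e ->
  `| `|a + r| ^+ 2 - `|a| ^+ 2| <= e * `|a| ^+ 2 + (1 + e^-1) * r ^+ 2.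
Proof.
move=> e0; rewrite !real_normK ?num_real//.
have -> : (a + r) ^+ 2 - a ^+ 2 = 2 * (a * r) + r ^+ 2 by ring.
apply: le_trans (ler_normD _ _) _.
rewrite (ger0_norm (sqr_ge0 r)).
have -> : e * a ^+ 2 + (1 + e^-1) * r ^+ 2 = (e * a ^+ 2 + e^-1 * r ^+ 2) + r ^+ 2 by ring.
rewrite lerD2r.
have -> : e * a ^+ 2 + e^-1 * r ^+ 2 = e * (a ^+ 2 + (e^-1 * r) ^+ 2) by field; rewrite gt_eqF.
have h1 := sqr_ge0 (a - e^-1 * r); have h2 := sqr_ge0 (a + e^-1 * r).
have -> : 2 * (a * r) = e * (2 * (a * (e^-1 * r))) by field; rewrite gt_eqF.
rewrite normrM (gtr0_norm e0) ler_pM2l// ler_norml; apply/andP; split; lra.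
Qed.

Lemma w_uniformly_continuous e : 0 < e -> exists2 delta, 0 < delta &
  forall r s, 0 <= r <= T -> 0 <= s <= T -> `|r - s| < delta -> `|w r - w s| <= e.
Proof.
move=> e0; have [C C0 [h1 h2]] := hoelder_on_bounds T_gt0 beta_gt0 sigma_hoelder.
have D0 : 0 < 2 * C * C + 1 by rewrite ltr_wpDl// !mulr_ge0.
have [delta d0 hd] := powR_small beta_gt0 (divr_gt0 e0 D0).
exists delta => // r s hr hs rs.
have p := hd _ (introT andP (conj (normr_ge0 (r - s)) rs)).
rewrite !real_normK ?num_real// subr_sqr normrM.
have a1 : `|sigma r + sigma s| <= 2 * C.
  by apply: le_trans (ler_normD _ _) _; have := h2 r hr; have := h2 s hs; lra.
have a2 : `|sigma r - sigma s| <= C * (e / (2 * C * C + 1)).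
  by apply: le_trans (h1 r s hr hs) _; apply: ler_wpM2l => //; exact: ltW.
apply: le_trans (ler_pM _ _ a2 a1) _ => //.
rewrite [leLHS](_ : _ = e * ((2 * C * C) / (2 * C * C + 1))); last by ring.
by rewrite ler_piMr ?(ltW e0)// ler_pdivrMr// mul1r lerDl.
Qed.

Lemma w_integrable : mu.-integrable `[0, T] (EFin \o w).
Proof.
apply: continuous_compact_integrable; first exact: segment_compact.
apply/subspace_continuousP => s; rewrite /= in_itv/= => hs.
apply/cvgrPdist_le => e e0; have [delta d0 hw] := w_uniformly_continuous e0.
apply/nbhs_ballP; exists delta => //= y; rewrite /ball/= => sy; rewrite in_itv/= => hy.
exact: hw.
Qed.

Lemma QV_shift n t : QV H n.+1 x t = \sum_(0 <= i < Num.truncn (n.+1%:R * t))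
  n.+1%:R `^ (2 * H - 1) * `|x (i.+1%:R / n.+1%:R) - x (i%:R / n.+1%:R)| ^+ 2.
Proof. by rewrite /QV /V_ big_add1/= mulr_sumr. Qed.

(** Remainders of size K/n contribute about n^{2H-1} n (K/n)^2 = K^2 n^{2H-2}, which vanishes
    because H < 1. *)
Lemma QV_cvg a b t : (a <= b.+1)%N -> t = T * (a%:R / b.+1%:R) ->
  QV H n.+1 x t @[n --> \oo] --> \int[mu]_(s in `[0, t]) w s.
Proof.
move=> ab tE.
have t0 : 0 <= t by rewrite tE mulr_ge0 ?divr_ge0// ltW.
have tT : t <= T by rewrite tE -[leRHS]mulr1 ler_pM2l// ler_pdivrMr// mul1r ler_nat.
set I := \int[mu]_(s in `[0, t]) w s.
pose W n := \sum_(0 <= i < Num.truncn (n.+1%:R * t)) w (i%:R / n.+1%:R) * eta n i.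
have eta0 n i : 0 <= eta n i by rewrite mulr_ge0 ?powR_ge0// sqr_ge0.
have cW : W n @[n --> \oo] --> I.
  apply: (weighted_sum_cvg eta0 t0).
  - move=> M k kM; under eq_fun do rewrite big_mkord.
    (* A fraction k/(M+1) of [t] is again a rational multiple of [T], with denominator (b+1)(M+1),
       so [g_qv] applies to it. *)
    pose b' := ((b.+1 * M.+1).-1)%N.
    have bE : b'.+1 = (b.+1 * M.+1)%N by rewrite /b' prednK// muln_gt0.
    have -> : t * (k%:R / M.+1%:R) = T * ((a * k)%N%:R / b'.+1%:R).
      rewrite bE !natrM tE invfM; ring.
    by apply: g_qv; rewrite bE leq_mul.
  - move=> e e0; have [delta d0 hw] := w_uniformly_continuous e0.
    exists delta => // r s /andP[r0 rt] /andP[s0 st]; apply: hw.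
      by rewrite r0 (le_trans rt).
    by rewrite s0 (le_trans st).
  - apply: integrableS w_integrable => //; apply: subset_itvl.
    by rewrite bnd_simp.
have I0 : 0 <= I by apply: Rintegral_ge0 => s _; rewrite sqr_ge0.
apply/cvgrPdist_le => e e0.
(* The error is split into thirds; [d] makes d (I + 1) = e/3, and the weighted sum is eventually at
   most I + 1. *)
pose d := e / (3 * (I + 1)).
have I1 : 0 < 3 * (I + 1) by rewrite mulr_gt0// ltr_wpDl.
have d0 : 0 < d by rewrite divr_gt0.
pose A := (1 + d^-1) * (K ^+ 2 * t).
have A0 : 0 <= A by rewrite mulr_ge0 ?mulr_ge0 ?sqr_ge0// addr_ge0// invr_ge0 ltW.
have e3 : 0 < e / 3 by rewrite divr_gt0.
have H1 : 0 < 2 - 2 * H by move: H_lt1 => ?; lra.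
have [del del0 hdel] := powR_small H1 (divr_gt0 e3 (ltr_wpDl A0 ltr01 : 0 < A + 1)).
near=> n.
have hn : n.+1%:R^-1 < del.
  near: n; exists (Num.truncn del^-1) => // n /= hn.
  by rewrite invf_plt ?posrE// (lt_le_trans (truncnS_gt _))// ler_nat ltnS.
have Wn : `|I - W n| <= e / 3 by near: n; move/cvgrPdist_le : cW; exact.
have Wn1 : `|I - W n| <= 1 by near: n; move/cvgrPdist_le : cW; apply.
have n0 : 0 < n.+1%:R :> R by [].
have nt0 : 0 <= n.+1%:R * t by rewrite mulr_ge0.
have /andP[N1 _] := truncn_itv nt0.
set N := Num.truncn (n.+1%:R * t) in N1.
have key : `|QV H n.+1 x t - W n| <= d * W n + A * n.+1%:R^-1 `^ (2 - 2 * H).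
  rewrite QV_shift -/N /W -/N -sumrB.
  apply: (@le_trans _ _ (\sum_(0 <= i < N) (d * (w (i%:R / n.+1%:R) * eta n i) +
     n.+1%:R `^ (2 * H - 1) * ((1 + d^-1) * (K / n.+1%:R) ^+ 2)))).
    apply: le_trans (ler_norm_sum _ _ _) _.
    rewrite big_nat [leRHS]big_nat; apply: ler_sum => i /andP[_ iN].
    set u := i%:R / n.+1%:R; set v := i.+1%:R / n.+1%:R.
    have uv : u <= v by rewrite ler_pM2r ?invr_gt0// ler_nat.
    have u0 : 0 <= u by rewrite divr_ge0.
    have vT : v <= T.
      rewrite (le_trans _ tT)// ler_pdivrMr// mulrC (le_trans _ N1)// ler_nat//.
    have vu : v - u = n.+1%:R^-1 by rewrite /u /v -mulrBl -natrB// subSnn mul1r.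
    have hr := x_increment u0 uv vT; rewrite vu in hr.
    set a' := sigma u * expR (- u) * (g v - g u) in hr.
    set r := x v - x u - a' in hr.
    have -> : w u * (n.+1%:R `^ (2 * H - 1) * (expR (- u) * (g v - g u)) ^+ 2) =
       n.+1%:R `^ (2 * H - 1) * `|a'| ^+ 2.
      by rewrite !real_normK ?num_real// /a'; ring.
    rewrite -mulrBr normrM (ger0_norm (powR_ge0 _ _)).
    rewrite mulrCA -mulrDr; apply: ler_wpM2l; first exact: powR_ge0.
    have -> : x v - x u = a' + r by rewrite /r; ring.
    apply: le_trans (sqr_perturb a' r d0) _; rewrite lerD2l; apply: ler_wpM2l.
      by rewrite addr_ge0// invr_ge0 ltW.
    rewrite -(real_normK (num_real r)); apply: lerXn2r; rewrite ?nnegrE//.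
    by rewrite divr_ge0.
  rewrite big_split/= -mulr_sumr lerD2l big_const_nat subn0 iter_addr_0.
  rewrite -[leLHS]mulr_natl.
  have e1 : n.+1%:R^-1 `^ (2 - 2 * H) = n.+1%:R `^ (2 * H - 1) * n.+1%:R^-1 :> R.
    rewrite -[n.+1%:R^-1]powR_inv1// -powRrM -powRD; last first.
      by apply/implyP => _; rewrite pnatr_eq0.
    by congr (_ `^ _); ring.
  rewrite e1; set p := n.+1%:R `^ (2 * H - 1).
  have p0 : 0 <= p by exact: powR_ge0.
  have c0 : 0 <= p * ((1 + d^-1) * (K / n.+1%:R) ^+ 2).
    by rewrite mulr_ge0// mulr_ge0 ?sqr_ge0// addr_ge0// invr_ge0 ltW.
  apply: le_trans (ler_wpM2r c0 N1) _.
  rewrite le_eqVlt; apply/orP; left; apply/eqP.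
  have : n.+1%:R != 0 :> R by rewrite pnatr_eq0.
  have dn0 : d != 0 by rewrite gt_eqF.
  by rewrite /A; set m := n.+1%:R => m0; field; rewrite nat1r pnatr_eq0 dn0.
have small : A * n.+1%:R^-1 `^ (2 - 2 * H) <= e / 3.
  have := hdel _ (introT andP (conj (_ : 0 <= n.+1%:R^-1) hn)).
  rewrite invr_ge0 ler0n => /(_ isT); rewrite ltr_pdivlMr ?ltr_wpDl//.
  have := powR_ge0 (n.+1%:R^-1) (2 - 2 * H); set y := _ `^ _; nra.
have WI : W n <= I + 1 by move: Wn1; rewrite ler_norml => /andP[]; lra.
have dW : d * W n <= e / 3.
  apply: le_trans (ler_wpM2l (ltW d0) WI) _.
  rewrite le_eqVlt; apply/orP; left; apply/eqP; rewrite /d; field.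
  by rewrite gt_eqF// ltr_wpDl.
have tri : `|I - QV H n.+1 x t| <= `|I - W n| + `|QV H n.+1 x t - W n|.
  by rewrite (distrC (QV _ _ _ _)); exact: ler_distD.
apply: le_trans tri _; lra.
Unshelve. all: by end_near. Qed.

Lemma QV_uniform_cvg : {uniform `[0, T],
   (fun n : nat => QV H n x) @ \oo --> (fun t => \int[mu]_(s in `[0, t]) w s)}.
Proof.
have [C C0 [h1 h2]] := hoelder_on_bounds T_gt0 beta_gt0 sigma_hoelder.
have : {uniform `[0, T],
   (fun n : nat => QV H n.+1 x) @ \oo --> (fun t => \int[mu]_(s in `[0, t]) w s)}.
  apply: (uniform_cvg_nondecreasing (L := C ^+ 2)) => //; first exact: sqr_ge0.
  - move=> n s t s0 st; rewrite !QV_shift.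
    have st' : (Num.truncn (n.+1%:R * s) <= Num.truncn (n.+1%:R * t))%N.
      by apply: le_truncn; rewrite ler_pM2l.
    rewrite (big_cat_nat (n := Num.truncn (n.+1%:R * s)) (p := Num.truncn (n.+1%:R * t)))//=.
    rewrite lerDl; apply: sumr_ge0 => i _.
    by rewrite mulr_ge0 ?powR_ge0 ?sqr_ge0.
  - move=> s t s0 st tT; apply/andP; split.
      by rewrite (Rintegral_increment w_integrable)//; apply: Rintegral_ge0 => r _; rewrite sqr_ge0.
    have := @Rintegral_increment_le R w T 0 (C ^+ 2) s t w_integrable s0 st tT.
    rewrite mul0r subr0 => h; apply: le_trans (ler_norm _) (h _) => r /andP[sr rt].
    rewrite subr0 ger0_norm ?sqr_ge0//; apply: lerXn2r; rewrite ?nnegrE//.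
    by apply: h2; rewrite (le_trans s0 sr) (le_trans rt).
  - by move=> M k kM; exact: (QV_cvg kM erefl).
(* Passage from the indices [n.+1] back to [n]. *)
by move=> h P /h [n0 _ hn0]; exists n0.+1 => // -[|n] //= hn; exact: hn0.
Qed.

End pathwise_qv.

Theorem theorem9 (R : realType) (d : measure_display)
    (Omega : measurableType d) (P : probability Omega R)
    (H T theta beta x0 : R) (B : R -> {RV P >-> R})
    (sigma : R -> R) (X : R -> Omega -> R)
    (H_gt0 : 0 < H) (H_lt1 : H < 1) (T_gt0 : 0 < T)
    (fBm : fractional_brownian_motion H B)
    (beta_gt : 1 - H < beta)
    (sigma_hoelder : hoelder_on `[0, T] beta sigma)
    (X_sol : {ae P, forall w,
       is_solution theta T x0 sigma (Y1 H (fun t => B t w)) (fun t => X t w)}) :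
  {ae P, forall w,
    {uniform `[0, T],
      (fun n : nat => QV H n (fun t => X t w)) @ \oo -->
      (fun t : R => \int[lebesgue_measure]_(s in `[0, t]) (`|sigma s| ^+ 2))}}.
Proof.
(* The midpoint between max(0, 1 - beta) and H lies strictly below H and satisfies alpha + beta > 1;
   the maximum with 0 keeps it positive when beta > 1. *)
pose alpha := (H + Num.max 0 (1 - beta)) / 2.
have m0 : 0 <= Num.max 0 (1 - beta) by rewrite le_max lexx.
have m1 : 1 - beta <= Num.max 0 (1 - beta) by rewrite le_max lexx orbT.
have mH : Num.max 0 (1 - beta) < H by rewrite gt_max H_gt0/=; lra.
have beta_gt0 : 0 < beta by lra.
have alpha01 : 0 < alpha < H by rewrite /alpha; apply/andP; split; lra.
have ab1 : 1 < alpha + beta by rewrite /alpha; lra.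
have /andP[alpha0 _] := alpha01.
have g_hoelder := fbm_hoelder_ae H_gt0 fBm T_gt0 alpha01.
have g_qv : {ae P, forall w, forall a b : nat,
    \sum_(i < Num.truncn (n.+1%:R * (T * (a%:R / b.+1%:R)))) (n.+1%:R : R) `^ (2 * H - 1) *
      (expR (- (i%:R / n.+1%:R)) * (B (a_ H (i.+1%:R / n.+1%:R)) w -
        B (a_ H (i%:R / n.+1%:R)) w)) ^+ 2 @[n --> \oo] --> T * (a%:R / b.+1%:R)}.
  (* Countably many times, the rational multiples of [T], leave a single null set. *)
  apply: ae_foralln => a; apply: ae_foralln => b.
  apply: (fbm_weighted_qv_cvg H_gt0 H_lt1 fBm).
  by rewrite mulr_ge0 ?divr_ge0// ltW.
apply: filterS3 g_hoelder g_qv X_sol => w gh gq sol.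
have [K K0 hK] := solution_increment_le T_gt0 alpha0 beta_gt0 ab1 gh sigma_hoelder sol.
exact: (QV_uniform_cvg H_lt1 T_gt0 beta_gt0 K0 sigma_hoelder (fun a b _ => gq a b) hK).
Qed.
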